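(* Consider the matrix flow $H_t=T+V+\Phi_t$ described in the context and $S_t(z)=\frac1N\operatorname{Tr}(H_t-z)^{-1}$. For every $c>0$ there exists $C<\infty$, depending only on $c$ and $C_V$, such that \[\mathbb{E}\,|S_t(E+i\eta)-S_0(E+i\eta)|\le C N^{-c/2}\Big(1+\frac{1}{N\eta}+\frac{1}{(N\eta)^3}\Big)\] for all $N$, all $t\le N^{-(1+c)}$, all $E\in\mathbb{R}$ and all $\eta>0$.
   Context: $H_t=T+V+\Phi_t$ is an $N\times N$ real symmetric random matrix flow. $\Phi_t$ has entries $\langle\delta_y,\Phi_t\delta_x\rangle=\sqrt{(1+\delta_{xy})/N}\,B_{xy}(t)$, where $B_{xy}(t)=B_{yx}(t)$, $x\le y$, are independent standard Brownian motions. $V=\sum_x V(x)|\delta_x\rangle\langle\delta_x|$ is a random diagonal potential, independent of the Brownian motions, whose conditional distributions satisfy $\mathbb{P}(V(x)\in I\mid\{V(y)\}_{y\ne x})\le C_V|I|$ for all Borel $I\subset\mathbb{R}$ and all $x$, with $C_V<\infty$ independent of $N$. $T$ is a (possibly random) real symmetric $N\times N$ matrix, and $T$, $V$, $(\Phi_t)$ are independent. *)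

(* Defs.v *)
From HB Require Import structures.
From mathcomp Require Import all_boot all_order all_algebra.
From mathcomp Require Import all_classical all_reals.
From mathcomp Require Import all_analysis.
From mathcomp.real_closed Require Import complex.

Set Implicit Arguments. Unset Strict Implicit. Unset Printing Implicit Defensive.
Import Order.TTheory GRing.Theory Num.Theory.
Import numFieldNormedType.Exports.
Local Open Scope classical_set_scope.
Local Open Scope ring_scope.

Section Defs.
Context {R : realType} {d : measure_display} {Omega : measurableType d}.
Variable P : probability Omega R.

Definition sigma_of (I : Type) (f : I -> Omega -> R) : set (set Omega) :=
  <<s \bigcup_(i in [set: I]) preimage_set_system [set: Omega] (f i) measurable >>.

Definition mutually_independent (I : finType) (D : {pred I})
    (F : I -> set (set Omega)) : Prop :=
  forall A : I -> set Omega, (forall i, D i -> F i (A i)) ->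
    P (\bigcap_(i in [set i | D i]) A i) = (\prod_(i in D) P (A i))%E.

Definition standard_BM (B : R -> Omega -> R) : Prop :=
  [/\ (forall s, 0 <= s -> measurable_fun [set: Omega] (B s)),
      (forall w, B 0 w = 0),
      (forall w, {within `[0, +oo[, continuous (fun s : R => B s w)}) &
      (forall (k : nat) (ts : nat -> R), 0 <= ts 0%N ->
         (forall i, (i < k)%N -> ts i < ts i.+1) ->
         mutually_independent (I := 'I_k) predT
           (fun i => sigma_of (I := unit) (fun _ w => B (ts i.+1) w - B (ts i) w))
         /\ (forall (i : 'I_k) (A : set R), measurable A ->
              P ((fun w => B (ts i.+1) w - B (ts i) w) @^-1` A)
              = normal_prob 0 (Num.sqrt (ts i.+1 - ts i)) A))].

End Defs.

Definition Phi {R : realType} {Omega : Type} (N : nat)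
    (B : 'I_N -> 'I_N -> R -> Omega -> R) (t : R) (w : Omega) : 'M[R]_N :=
  \matrix_(i < N, j < N)
     (Num.sqrt ((1 + (i == j)%:R) / N%:R) * B i j t w).

Definition Hflow {R : realType} {Omega : Type} (N : nat)
    (T : 'I_N -> 'I_N -> Omega -> R) (V : 'I_N -> Omega -> R)
    (B : 'I_N -> 'I_N -> R -> Omega -> R) (t : R) (w : Omega) : 'M[R]_N :=
  \matrix_(i < N, j < N) T i j w + diag_mx (\row_i V i w) + Phi B t w.

Definition Stieltjes {R : realType} {Omega : Type} (N : nat)
    (T : 'I_N -> 'I_N -> Omega -> R) (V : 'I_N -> Omega -> R)
    (B : 'I_N -> 'I_N -> R -> Omega -> R) (t : R) (z : R[i]) (w : Omega) : R[i] :=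
  (N%:R)^-1 * \tr (invmx (map_mx (real_complex R) (Hflow T V B t w) - z%:M)).

(* Main.v *)
(** With G_t = (H_t - z)^-1 and tau_t = tr G_t, one follows the smoothed modulus
    sqrt (eps^2 + |tau_t - tau_0|^2) along a grid of [0, t] whose mesh s tends to 0.
    Expanding the resolvent in the independent increment W of the matrix Brownian motion, the
    term of first order has mean zero; by concavity of the square root, the quadratic variation
    of tau contributes at most O(s) |tr (G G Gbar Gbar)| / (N eps) per step, and the terms of
    second order contribute O(s) (|tr G^2 tr G| + |tr G^3|) / N.  The Ward identity
    G Gbar = Im G / Im z reduces these to the means of Im tr G and |tr G|^2.  Conditionally on T
    and Phi these two means are controlled by the random potential: the diagonal resolvent
    entries are (V(x) - w)^-1 with w independent of V(x), so that E Im G_xx = O(1), while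
    E |tr G|^2 is O(N^2) up to logarithms of 1 / eta.  Finally, eps is chosen of order
    N^(1 - c/2) (1 + (N eta)^-3), and the logarithms are absorbed by N^(c/2) (1 + 1 / (N eta)). *)

Require Import Defs.
From HB Require Import structures.
From mathcomp Require Import all_boot all_order all_algebra.
From mathcomp Require Import all_classical all_reals.
From mathcomp Require Import all_analysis measurable_realfun.
From mathcomp.real_closed Require Import complex.
From mathcomp Require Import ring lra.
Import Order.TTheory GRing.Theory Num.Theory.
Import numFieldNormedType.Exports.
Local Open Scope classical_set_scope.
Local Open Scope ring_scope.
Set Implicit Arguments. Unset Strict Implicit. Unset Printing Implicit Defensive.

(** * Resolvents of real symmetric matrices *)

(** No stochastic integral is used: over $t/s$ steps, a remainder $O(s^{3/2})$ per step adds up to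
    $O(\sqrt s)$, so its constant may depend on $N$ and $\eta$ in any manner, and sharp bounds are
    required only for the terms of order $s$. Two obstacles shape the rest. The increments have to
    be tested against functions of the earlier flow, while the hypotheses give independence of the
    paths of different entries and, separately, of the successive increments of one path; hence a
    past is attached to each entry, containing the other paths entirely. And the density bound
    concerns a fixed interval, whereas $G_{xx}$ as a function of $V(x)$ has a random centre and
    width; these are first confined to countably many cells. The time bound enters as
    $t/N\le(p/N)^2$ with $p=N^{-c/2}$. With $v=1/(N\eta)$ and $w=1+v+v^3$, the quadratic variation
    contributes $(t/N)\eta^{-3}N/\epsilon$ up to constants, which for $\epsilon=Npw$ is at most
    $Np\,v^3/w\le Np$: this is the origin of the cube in the bound. *)

Notation Re := complex.Re.
Notation Im := complex.Im.

Section Modulus.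
Context {R : realType}.
Implicit Types (x y : R[i]) (a : R).
Local Open Scope complex_scope.

Definition cmod x : R := Re `|x|.

Lemma cmodE x : `|x| = (cmod x)%:C.
Proof. by rewrite /cmod normc_def. Qed.

Lemma cmod_ge0 x : 0 <= cmod x.
Proof. by rewrite -lecR -cmodE normr_ge0. Qed.

Lemma cmodM x y : cmod (x * y) = cmod x * cmod y.
Proof. by apply: complexI; rewrite rmorphM /= -!cmodE normrM. Qed.

Lemma cmodV x : cmod x^-1 = (cmod x)^-1.
Proof. by apply: complexI; rewrite fmorphV /= -!cmodE normfV. Qed.

Lemma cmodD x y : cmod (x + y) <= cmod x + cmod y.
Proof. by rewrite -lecR rmorphD /= -!cmodE ler_normD. Qed.

Lemma cmodN x : cmod (- x) = cmod x.
Proof. by apply: complexI; rewrite -!cmodE normrN. Qed.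

Lemma cmod0 : cmod 0 = 0.
Proof. by apply: complexI; rewrite -cmodE normr0. Qed.

Lemma cmod_eq0 x : (cmod x == 0) = (x == 0).
Proof. by rewrite -(inj_eq (@complexI R)) -cmodE normr_eq0. Qed.

Lemma cmod_sum (I : Type) (r : seq I) (P : pred I) (F : I -> R[i]) :
  cmod (\sum_(i <- r | P i) F i) <= \sum_(i <- r | P i) cmod (F i).
Proof.
elim/big_ind2: _ => [|x1 x2 y1 y2 h1 h2|//]; first by rewrite cmod0.
by apply: le_trans (cmodD _ _) _; rewrite lerD.
Qed.

Lemma cmod_sqr x : cmod x ^+ 2 = Re x ^+ 2 + Im x ^+ 2.
Proof. by rewrite /cmod normc_def /= sqr_sqrtr // addr_ge0 // sqr_ge0. Qed.

Lemma cmod_sqrE x : (cmod x ^+ 2)%:C = x * x^*.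
Proof. by rewrite rmorphXn /= -cmodE sqr_normc. Qed.

Lemma Re_le_cmod x : `|Re x| <= cmod x.
Proof. by rewrite -lecR -cmodE normc_ge_Re. Qed.

Lemma Im_le_cmod x : `|Im x| <= cmod x.
Proof.
rewrite -(@ler_pXn2r _ 2) ?nnegrE ?cmod_ge0 // real_normK ?num_real //.
by rewrite cmod_sqr lerDr sqr_ge0.
Qed.

Lemma cmod_real a : cmod a%:C = `|a|.
Proof. by rewrite /cmod normc_def /= expr0n addr0 sqrtr_sqr. Qed.

Lemma ReM x y : Re (x * y) = Re x * Re y - Im x * Im y.
Proof. by case: x; case: y. Qed.

Lemma ImM x y : Im (x * y) = Re x * Im y + Im x * Re y.
Proof. by case: x => a b; case: y. Qed.

Lemma ReD x y : Re (x + y) = Re x + Re y.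
Proof. by case: x; case: y. Qed.

Lemma ImD x y : Im (x + y) = Im x + Im y.
Proof. by case: x; case: y. Qed.

Lemma ReN x : Re (- x) = - Re x. Proof. by case: x. Qed.

Lemma ImN x : Im (- x) = - Im x. Proof. by case: x. Qed.

Lemma Re_sum (I : Type) (r : seq I) (P : pred I) (F : I -> R[i]) :
  Re (\sum_(i <- r | P i) F i) = \sum_(i <- r | P i) Re (F i).
Proof. by apply: (big_morph _ ReD). Qed.

Lemma Im_sum (I : Type) (r : seq I) (P : pred I) (F : I -> R[i]) :
  Im (\sum_(i <- r | P i) F i) = \sum_(i <- r | P i) Im (F i).
Proof. by apply: (big_morph _ ImD). Qed.

Lemma ReZ a x : Re (a%:C * x) = a * Re x.
Proof. by rewrite ReM /= mul0r subr0. Qed.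

Lemma ImZ a x : Im (a%:C * x) = a * Im x.
Proof. by rewrite ImM /= mul0r addr0. Qed.

End Modulus.

Section Resolvent.
Context {R : realType} {n : nat}.
Local Open Scope complex_scope.
Implicit Types (A W : 'M[R]_n) (z : R[i]).

Definition resolvent A z : 'M[R[i]]_n :=
  invmx (map_mx (real_complex R) A - z%:M).

Local Notation toC := (map_mx (real_complex R)).

Lemma symC A : A^T = A -> (toC A)^T = toC A.
Proof. by move=> sA; rewrite -[in RHS]sA matrix.map_trmx. Qed.

Section FixedMatrix.
Variables (A : 'M[R]_n) (z : R[i]).
Hypotheses (sA : A^T = A) (zpos : 0 < Im z).

Local Notation G := (resolvent A z).
Local Notation Gbar := (map_mx conjc G).

(* If v (A - z) = 0 then z v v^* = v A v^* is real. *)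
Lemma resolvent_unit : toC A - z%:M \in unitmx.
Proof.
rewrite -row_free_unit -kermx_eq0; apply/eqP/row_matrixP => i.
rewrite row0; set v := row i _.
have vA : v *m toC A = z *: v.
  have : v *m (toC A - z%:M) = 0 by rewrite /v -row_mul mulmx_ker row0.
  by rewrite mulmxBr mul_mx_scalar => /eqP; rewrite subr_eq0 => /eqP.
pose q := (v *m toC A *m (map_mx conjc v)^T) 0 0.
pose m := (v *m (map_mx conjc v)^T) 0 0.
have mE : m = (\sum_j cmod (v 0 j) ^+ 2)%:C.
  rewrite /m mxE rmorph_sum; apply: eq_bigr => j _.
  by rewrite !mxE /= cmod_sqrE.
have qE : q = z * m by rewrite /q vA -scalemxAl mxE.
have qJ : q^* = q.
  have -> : q^* = (map_mx conjc (v *m toC A *m (map_mx conjc v)^T)) 0 0.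
    by rewrite mxE.
  rewrite !map_mxM -matrix.map_trmx; set w := map_mx conjc v.
  have -> : map_mx conjc w = v by apply/matrixP=> a b; rewrite !mxE conjcK.
  have -> : map_mx conjc (toC A) = toC A.
    by apply/matrixP => a b; rewrite !mxE conjc_real.
  have -> : w *m toC A *m v^T = (v *m toC A *m w^T)^T.
    by rewrite !trmx_mul trmxK (symC sA) mulmxA.
  by rewrite mxE.
have : Im q = 0 by have := congr1 (@Im R) qJ; case: (q) => a b /= h; lra.
rewrite qE mE mulrC ImZ => /eqP; rewrite mulf_eq0 (gt_eqF zpos) orbF.
rewrite psumr_eq0; last by move=> j _; rewrite sqr_ge0.
move=> /allP h; apply/rowP => j; rewrite [RHS]mxE.
have := h j (mem_index_enum _); rewrite /= expf_eq0 /= cmod_eq0.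
by move/eqP.
Qed.

Lemma resolvent_mulr : (toC A - z%:M) *m G = 1%:M.
Proof. exact: mulmxV resolvent_unit. Qed.

Lemma resolvent_mull : G *m (toC A - z%:M) = 1%:M.
Proof. exact: mulVmx resolvent_unit. Qed.

Lemma resolvent_sym : G^T = G.
Proof. by rewrite /resolvent trmx_inv linearB /= symC // tr_scalar_mx. Qed.

Lemma resolvent_symE i j : G i j = G j i.
Proof. by rewrite -[in RHS]resolvent_sym mxE. Qed.

(** Since [A] is real, conjugating the entries replaces $z$ by $\bar z$: [Gbar] is the resolvent at
    $\bar z$ and, [G] being symmetric, also the adjoint of [G]. *)
Lemma conj_shift : map_mx conjc (toC A - z%:M) = toC A - (z^*)%:M.
Proof.
apply/matrixP => a b; rewrite !mxE rmorphB rmorphMn. by congr (_ - _); rewrite /= ?oppr0.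
Qed.

Lemma conj_mulr : (toC A - (z^*)%:M) *m Gbar = 1%:M.
Proof. by rewrite -conj_shift -map_mxM resolvent_mulr map_mx1. Qed.

Lemma conj_mull : Gbar *m (toC A - (z^*)%:M) = 1%:M.
Proof. by rewrite -conj_shift -map_mxM resolvent_mull map_mx1. Qed.

Lemma shift_diff : (toC A - (z^*)%:M) - (toC A - z%:M) = (z - z^*)%:M.
Proof. by rewrite [(z - _)%:M]raddfB /= opprB addrC addrA subrK addrC. Qed.

Lemma resolvent_conj : G - Gbar = (z - z^*) *: (G *m Gbar).
Proof.
rewrite -mul_scalar_mx -shift_diff mulmxA -[X in _ = X *m _ *m _]mul1mx.
have -> : G - Gbar = G *m ((toC A - (z^*)%:M) - (toC A - z%:M)) *m Gbar.
  by rewrite mulmxBr mulmxBl resolvent_mull mul1mx -mulmxA conj_mulr mulmx1.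
by rewrite shift_diff mul_mx_scalar mul1mx mul_scalar_mx -scalemxAl.
Qed.

Lemma conj_resolvent : G - Gbar = (z - z^*) *: (Gbar *m G).
Proof.
have -> : G - Gbar = Gbar *m ((toC A - (z^*)%:M) - (toC A - z%:M)) *m G.
  by rewrite mulmxBr mulmxBl conj_mull mul1mx -mulmxA resolvent_mulr mulmx1.
by rewrite shift_diff mul_mx_scalar -scalemxAl.
Qed.

Lemma subzJ : z - z^* = (Im z *+ 2) *i.
Proof.
by case: z => a b /=; apply/eqP; rewrite eq_complex /=; apply/andP; split; apply/eqP; ring.
Qed.

Lemma subzJ_neq0 : z - z^* != 0.
Proof. by rewrite subzJ eq_complex /= mulrn_eq0 /= (gt_eqF zpos) andbF. Qed.

(** The resolvent identity between $z$ and $\bar z$, divided by $z-\bar z=2i\,\mathrm{Im}\,z$. The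
    diagonal entries give [Ward]; the off-diagonal ones are used in [hs_sqr]. *)
Lemma GGbarE i j : (G *m Gbar) i j = ((Im z)^-1 * Im (G i j))%:C.
Proof.
have /matrixP/(_ i j) := resolvent_conj; rewrite !mxE /= => h.
apply: (mulfI subzJ_neq0); rewrite -h subzJ.
have z0 : Im z != 0 by rewrite gt_eqF.
case: (resolvent A z i j) => a b /=; apply/eqP; rewrite eq_complex /=.
by apply/andP; split; apply/eqP; field.
Qed.

Lemma GbarGE i j : (Gbar *m G) i j = ((Im z)^-1 * Im (G i j))%:C.
Proof.
rewrite -GGbarE; congr fun_of_matrix.
apply: (scalerI subzJ_neq0); by rewrite -resolvent_conj conj_resolvent.
Qed.

Lemma Ward i : Im (G i i) = Im z * \sum_j cmod (G i j) ^+ 2.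
Proof.
have := GGbarE i i; rewrite mxE.
have -> : \sum_j G i j * Gbar j i = (\sum_j cmod (G i j) ^+ 2)%:C.
  rewrite rmorph_sum; apply: eq_bigr => j _ /=.
  by rewrite cmod_sqrE [map_mx _ _ _ _]mxE (resolvent_symE j).
by move=> /complexI ->; rewrite mulrA divff ?mul1r // gt_eqF.
Qed.

Lemma Im_resolvent_ge0 i : 0 <= Im (G i i).
Proof. by rewrite Ward mulr_ge0 ?(ltW zpos) // sumr_ge0 // => j _; exact: sqr_ge0. Qed.

Lemma row_sqr_resolvent i : \sum_j cmod (G i j) ^+ 2 = (Im z)^-1 * Im (G i i).
Proof. by rewrite Ward mulrA mulVf ?mul1r // gt_eqF. Qed.

Lemma cmod_sqr_resolvent i j : cmod (G i j) ^+ 2 <= (Im z)^-1 * Im (G i i).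
Proof.
rewrite -row_sqr_resolvent (bigD1 j) //= lerDl sumr_ge0 // => k _.
exact: sqr_ge0.
Qed.

(** $|G_{ii}|^2\le\mathrm{Im}\,G_{ii}/\mathrm{Im}\,z\le|G_{ii}|/\mathrm{Im}\,z$, and one factor
    $|G_{ii}|$ cancels. *)
Lemma cmod_resolvent_diag i : cmod (G i i) <= (Im z)^-1.
Proof.
have h := cmod_sqr_resolvent i i.
have h1 : Im (G i i) <= cmod (G i i) by apply: le_trans (Im_le_cmod _); exact: ler_norm.
have [->|g0] := eqVneq (cmod (G i i)) 0; first by rewrite invr_ge0 ltW.
have gpos : 0 < cmod (G i i) by rewrite lt0r g0 cmod_ge0.
rewrite -(ler_pM2r gpos) -expr2; apply: le_trans h _.
by rewrite ler_wpM2l // invr_ge0 ltW.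
Qed.

Lemma Im_resolvent_le i : Im (G i i) <= (Im z)^-1.
Proof.
apply: le_trans (cmod_resolvent_diag i).
by apply: le_trans (Im_le_cmod _); exact: ler_norm.
Qed.

Lemma cmod_resolvent i j : cmod (G i j) <= (Im z)^-1.
Proof.
have z0 : 0 <= (Im z)^-1 by rewrite invr_ge0 ltW.
rewrite -(@ler_pXn2r _ 2) ?nnegrE ?cmod_ge0 //.
apply: le_trans (cmod_sqr_resolvent i j) _.
by rewrite expr2 ler_wpM2l // Im_resolvent_le.
Qed.

(** If the Ward sum vanished, row $i$ of the invertible matrix [G] would be zero. Strictness allows
    division by $G_{xx}$ in the rank-one formulas. *)
Lemma resolvent_diag_gt0 i : 0 < Im (G i i).
Proof.
rewrite Ward mulr_gt0 // lt0r sumr_ge0 ?andbT; last by move=> j _; exact: sqr_ge0.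
apply/negP => /eqP/psumr_eq0P h.
have Gi j : G i j = 0.
  by apply/eqP; rewrite -cmod_eq0 -sqrf_eq0 h // => k _; exact: sqr_ge0.
have /matrixP/(_ i i) := resolvent_mull; rewrite !mxE eqxx big1 => [|j _].
  by move/eqP; rewrite eq_sym oner_eq0.
by rewrite Gi mul0r.
Qed.

(** The squared Hilbert-Schmidt norm of the resolvent. *)
Definition hs : R := \sum_i \sum_j cmod (G i j) ^+ 2.

Lemma hsE : hs = (Im z)^-1 * Im (\tr G).
Proof.
rewrite /hs /mxtrace Im_sum mulr_sumr; apply: eq_bigr => i _.
exact: row_sqr_resolvent.
Qed.

(* With Q := G Gbar = Gbar G = Im G / Im z, tr (G G Gbar Gbar) = tr (Q Q). *)
Lemma hs_sqr :
  \sum_i \sum_j cmod ((G *m G) i j) ^+ 2 <= (Im z)^-1 ^+ 3 * Im (\tr G).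
Proof.
have -> : \sum_i \sum_j cmod ((G *m G) i j) ^+ 2 =
          \sum_i \sum_j ((Im z)^-1 * Im (G i j)) ^+ 2.
  apply: complexI; rewrite !rmorph_sum /=.
  have QQ : \tr (G *m G *m (Gbar *m Gbar)) = \tr (Gbar *m G *m (G *m Gbar)).
    by rewrite [in LHS]mulmxA mxtrace_mulC !mulmxA.
  have -> : \sum_i (\sum_j cmod ((G *m G) i j) ^+ 2)%:C =
      \tr (G *m G *m (Gbar *m Gbar)).
    apply: eq_bigr => i _; rewrite rmorph_sum /= mxE; apply: eq_bigr => j _.
    rewrite cmod_sqrE -map_mxM [map_mx _ _ _ _]mxE; congr (_ * _^*).
    by rewrite -[in LHS](trmxK (G *m G)) trmx_mul resolvent_sym mxE.
  rewrite QQ; apply: eq_bigr => i _; rewrite rmorph_sum /= mxE.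
  apply: eq_bigr => j _; rewrite GGbarE GbarGE resolvent_symE.
  by rewrite (resolvent_symE j) -rmorphM expr2.
rewrite exprSr -mulrA -hsE /hs mulr_sumr; apply: ler_sum => i _.
rewrite mulr_sumr; apply: ler_sum => j _.
rewrite exprMn ler_wpM2l ?exprn_ge0 ?invr_ge0 ?(ltW zpos) //.
by rewrite cmod_sqr lerDr sqr_ge0.
Qed.

Lemma cmod_trGG : cmod (\tr (G *m G)) <= (Im z)^-1 * Im (\tr G).
Proof.
rewrite -hsE /mxtrace; apply: le_trans (cmod_sum _ _ _) _.
apply: ler_sum => i _; rewrite mxE; apply: le_trans (cmod_sum _ _ _) _.
by apply: ler_sum => j _; rewrite cmodM (resolvent_symE j) expr2.
Qed.

(** The double sum is $\mathrm{tr}\,G^3$, because [G] is symmetric. The weights $\mathrm{Im}\,z$ and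
    its inverse in the arithmetic-geometric mean inequality balance [hs_sqr] against [hsE]: each
    half contributes the same amount. *)
Lemma cmod_trGGG : cmod (\sum_i \sum_j (G *m G) i j * G i j) <=
  (Im z)^-1 ^+ 2 * Im (\tr G).
Proof.
have z0 : 0 <= (Im z)^-1 by rewrite invr_ge0 ltW.
have amgm (x y : R) : x * y <= (Im z * x ^+ 2 + (Im z)^-1 * y ^+ 2) / 2.
  rewrite ler_pdivlMr // -subr_ge0.
  have -> : Im z * x ^+ 2 + (Im z)^-1 * y ^+ 2 - x * y * 2 =
            Im z * (x - (Im z)^-1 * y) ^+ 2 by field; rewrite gt_eqF.
  by rewrite mulr_ge0 ?sqr_ge0 // ltW.
apply: (@le_trans _ _ (\sum_i \sum_j
  (Im z * cmod ((G *m G) i j) ^+ 2 + (Im z)^-1 * cmod (G i j) ^+ 2) / 2)).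
  apply: le_trans (cmod_sum _ _ _) _; apply: ler_sum => i _.
  apply: le_trans (cmod_sum _ _ _) _; apply: ler_sum => j _.
  by rewrite cmodM; exact: amgm.
have -> : \sum_i \sum_j (Im z * cmod ((G *m G) i j) ^+ 2 +
    (Im z)^-1 * cmod (G i j) ^+ 2) / 2 =
  (Im z * (\sum_i \sum_j cmod ((G *m G) i j) ^+ 2) + (Im z)^-1 * hs) / 2.
  rewrite /hs !mulr_sumr -big_split /= mulr_suml; apply: eq_bigr => i _.
  by rewrite !mulr_sumr -big_split /= mulr_suml.
rewrite ler_pdivrMr //.
have h := ler_wpM2l (ltW zpos) hs_sqr; rewrite hsE.
apply: le_trans (lerD h (lexx _)) _; rewrite le_eqVlt; apply/orP; left.
by apply/eqP; field; rewrite gt_eqF.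
Qed.

End FixedMatrix.

Lemma resolvent_diff A W z : A^T = A -> W^T = W -> 0 < Im z ->
  resolvent (A + W) z - resolvent A z =
  - (resolvent A z *m toC W *m resolvent (A + W) z).
Proof.
move=> sA sW zpos.
have sAW : (A + W)^T = A + W by rewrite linearD /= sA sW.
have -> : toC W = (toC (A + W) - z%:M) - (toC A - z%:M).
  by rewrite map_mxD opprB addrA addrNK addrAC addrN add0r.
rewrite mulmxBr mulmxBl resolvent_mull // mul1mx -mulmxA resolvent_mulr //.
by rewrite mulmx1 opprB.
Qed.

(** One iteration of [resolvent_diff], with the perturbed resolvent left in the last factor. The
    expansion is exact, so [W] may be large, and the remainder is controlled by the a priori bounds
    on both resolvents. *)
Lemma resolvent_diff2 A W z : A^T = A -> W^T = W -> 0 < Im z ->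
  let G := resolvent A z in
  resolvent (A + W) z - G =
  - (G *m toC W *m G) + G *m toC W *m G *m toC W *m resolvent (A + W) z.
Proof.
move=> sA sW zpos G; rewrite {1}resolvent_diff // -/G.
have e : resolvent (A + W) z = G - G *m toC W *m resolvent (A + W) z.
  by rewrite -[LHS](subrK G) resolvent_diff // addrC.
by rewrite {1}e mulmxBr opprB addrC !mulmxA.
Qed.

End Resolvent.

(** The imaginary part of $g/(1+vg)$ in a form free of division: multiply the equation by the
    conjugate of $1+vg$ and take imaginary parts. *)
Lemma im_div {R : realType} (y g : R[i]) (v : R) :
  y * (1 + (v%:C)%C * g) = g -> Im y * cmod (1 + (v%:C)%C * g) ^+ 2 = Im g.
Proof.
rewrite cmod_sqr; case: y g => p q [d c] e.
have /= e1 := congr1 (@Re R) e; have /= e2 := congr1 (@Im R) e.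
rewrite /= !(mul0r, subr0, addr0, add0r) in e1 e2 *.
have -> : q * ((1 + v * d) ^+ 2 + (v * c) ^+ 2) =
  (p * (v * c) + q * (1 + v * d)) * (1 + v * d) -
  (p * (1 + v * d) - q * (v * c)) * (v * c) by ring.
by rewrite e1 e2; ring.
Qed.

(** * Dependence of the resolvent on a single diagonal entry *)

Section RankOne.
Context {R : realType} {n : nat}.
Local Open Scope complex_scope.
Variables (A : 'M[R]_n) (z : R[i]) (x : 'I_n) (v : R).
Hypotheses (sA : A^T = A) (zpos : 0 < Im z).

Local Notation toC := (map_mx (real_complex R)).
Local Notation G0 := (resolvent A z).
Local Notation G := (resolvent (A + v *: delta_mx x x) z).
Local Notation g := (resolvent A z x x).

Let sE : (v *: delta_mx x x : 'M[R]_n)^T = v *: delta_mx x x.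
Proof. by rewrite linearZ /= trmx_delta. Qed.

Let sAE : (A + v *: delta_mx x x)^T = A + v *: delta_mx x x.
Proof. by rewrite linearD /= sA sE. Qed.

Let rank1E i j : (G0 *m toC (v *: delta_mx x x) *m G) i j = v%:C * (G0 i x * G x j).
Proof.
rewrite mxE (bigD1 x) //= big1 ?addr0 => [|k kx].
  rewrite mxE (bigD1 x) //= big1 ?addr0 => [|l lx].
    by rewrite !mxE !eqxx mulr1 mulrA (mulrC v%:C).
  by rewrite !mxE (negbTE lx) /= mulr0 rmorph0 mulr0.
rewrite mxE big1 ?mul0r // => l _.
by rewrite !mxE (negbTE kx) andbF mulr0 rmorph0 mulr0.
Qed.

Lemma rank1_diag : G x x * (1 + v%:C * g) = g.
Proof.
have h : G x x - g = - (v%:C * (g * G x x)).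
  have /matrixP/(_ x x) := resolvent_diff sA sE zpos.
  by rewrite [in X in X -> _]mxE [in X in _ = X -> _]mxE rank1E [in X in X -> _]mxE.
have {}h : G x x = g - v%:C * (g * G x x) by rewrite -h addrCA subrr addr0.
by rewrite mulrDr mulr1 {1}h; ring.
Qed.

Lemma rank1_trace : \tr G - \tr G0 = - (v%:C * \sum_j G x j * G0 x j).
Proof.
rewrite -raddfB /= resolvent_diff // raddfN /=; congr (- _).
rewrite /mxtrace mulr_sumr; apply: eq_bigr => i _.
by rewrite rank1E (resolvent_symE _ sA i x) mulrC; ring.
Qed.

Lemma g_neq0 : g != 0.
Proof.
have := resolvent_diag_gt0 sA zpos x; apply: contraTneq => ->.
by rewrite ltxx.
Qed.

(** By [GxxE], $G_{xx}=(v-\omega)^{-1}$ with $\omega=-1/g$ free of $v$; [center] and [width] are the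
    real and imaginary parts of $\omega$. Thus $\mathrm{Im}\,G_{xx}$ is a Cauchy profile in $v$. *)
Definition center : R := - Re g^-1.
Definition width : R := - Im g^-1.

Lemma GxxE : G x x = (v%:C + g^-1)^-1.
Proof.
have g0 := g_neq0; have h := rank1_diag.
have k0 : v%:C + g^-1 != 0.
  apply/eqP => k0; have : 1 + v%:C * g = 0 by rewrite -(mulVf g0) -mulrDl addrC k0 mul0r.
  by move=> k1; move: h; rewrite k1 mulr0 => /eqP; rewrite eq_sym (negbTE g0).
apply: (mulIf k0); rewrite mulVf //.
by apply: (mulIf g0); rewrite mul1r -mulrA mulrDl mulVf // [_ + 1]addrC.
Qed.

(** $\mathrm{Im}(-1/g)=\mathrm{Im}\,g/|g|^2$, and the Ward identity gives
    $|g|^2\le\mathrm{Im}\,g/\mathrm{Im}\,z$. *)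
Lemma width_ge : Im z <= width.
Proof.
have gpos := resolvent_diag_gt0 sA zpos x.
have h := cmod_sqr_resolvent sA zpos x x.
move: h; rewrite mulrC ler_pdivlMr // cmod_sqr => h.
rewrite /width; move: gpos h; case: g => a b /= bpos h.
have d0 : 0 < a ^+ 2 + b ^+ 2 by rewrite ltr_wpDl ?sqr_ge0 // exprn_gt0.
by rewrite opprK ler_pdivlMr // mulrC.
Qed.

Lemma Gxx_center : cmod (G x x) * `|v - center| <= 1.
Proof.
rewrite GxxE; set w := v%:C + _.
have wr : `|v - center| <= cmod w.
  have -> : v - center = Re w by rewrite /w /center ReD opprK.
  exact: Re_le_cmod.
rewrite cmodV; have [->|w0] := eqVneq (cmod w) 0; first by rewrite invr0 mul0r ler01.
by rewrite mulrC ler_pdivrMr ?mul1r // lt0r w0 cmod_ge0.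
Qed.

Lemma Im_GxxE : Im (G x x) = width / ((v - center) ^+ 2 + width ^+ 2).
Proof.
rewrite GxxE /center /width opprK; case: (g^-1) => a b /=.
by rewrite add0r sqrrN mulNr.
Qed.

(* Cauchy-Schwarz and Ward bound |(G G0)_xx| by sqrt (Im G_xx Im g) / Im z,
   and Im G_xx = Im g / |1 + v g|^2 with |1 + v g| >= |v| Im g. *)
Lemma rank1_trace_le : cmod (\tr G - \tr G0) <= (Im z)^-1.
Proof.
have zi : 0 <= (Im z)^-1 by rewrite invr_ge0 ltW.
rewrite rank1_trace cmodN cmodM cmod_real.
have gpos := resolvent_diag_gt0 sA zpos x.
have hd := rank1_diag; have g0 := g_neq0.
pose k := cmod (1 + v%:C * g).
have kv : `|v| * Im g <= k.
  have -> : `|v| * Im g = `|Im (1 + v%:C * g)|.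
    by rewrite ImD ImZ add0r normrM (gtr0_norm gpos).
  exact: Im_le_cmod.
have k0 : k != 0.
  rewrite /k cmod_eq0; apply/eqP => e; move: hd; rewrite e mulr0 => /eqP.
  by rewrite eq_sym (negbTE g0).
have kpos : 0 < k by rewrite lt0r k0 cmod_ge0.
have ImG : Im (G x x) * k ^+ 2 = Im g.
  exact: im_div.
apply: (@le_trans _ _ (`|v| * (\sum_j (k * cmod (G x j) ^+ 2 + k^-1 * cmod (G0 x j) ^+ 2) / 2))).
  rewrite ler_wpM2l // (le_trans (cmod_sum _ _ _)) //; apply: ler_sum => j _.
  rewrite cmodM ler_pdivlMr // -subr_ge0.
  set p := cmod _; set q := cmod _.
  have -> : k * p ^+ 2 + k^-1 * q ^+ 2 - p * q * 2 = k * (p - k^-1 * q) ^+ 2 by field.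
  by rewrite mulr_ge0 ?sqr_ge0 // ltW.
rewrite -mulr_suml big_split /= -!mulr_sumr !row_sqr_resolvent //.
have -> : (k * ((Im z)^-1 * Im (G x x)) + k^-1 * ((Im z)^-1 * Im g)) / 2 =
          (Im z)^-1 * (Im g / k).
  by rewrite -ImG; field; rewrite k0 gt_eqF.
rewrite mulrCA ler_piMr // mulrA ler_pdivrMr ?mul1r //.
Qed.

End RankOne.

(** * Independence and measurability *)

Section Independence.
Context {R : realType} {d : measure_display} {Omega : measurableType d}.
Variable P : probability Omega R.

Section Law.
Context {d1 d2 : measure_display} {T1 : measurableType d1} {T2 : measurableType d2}.
Variables (X : Omega -> T1) (Y : Omega -> T2).
Hypotheses (mX : measurable_fun [set: Omega] X) (mY : measurable_fun [set: Omega] Y).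
Hypothesis XY : forall A B, measurable A -> measurable B ->
  P (X @^-1` A `&` Y @^-1` B) = (P (X @^-1` A) * P (Y @^-1` B))%E.

Let mX_pack : {mfun Omega >-> T1} := HB.pack X (isMeasurableFun.Build _ _ _ _ _ mX).
Let mY_pack : {mfun Omega >-> T2} := HB.pack Y (isMeasurableFun.Build _ _ _ _ _ mY).

Let mXY : measurable_fun [set: Omega] (fun w => (X w, Y w)).
Proof. exact: measurable_fun_pair. Qed.

Let mXY_pack : {mfun Omega >-> (T1 * T2)%type} :=
  HB.pack (fun w => (X w, Y w)) (isMeasurableFun.Build _ _ _ _ _ mXY).

Let joint_law A : measurable A ->
  (distribution P mX_pack \x distribution P mY_pack)%E A =
  distribution P mXY_pack A.
Proof. by move=> mA; apply: product_measure_unique => // A1 A2 ? ?; exact: XY. Qed.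

Lemma indep_ge0_integral (F : T1 * T2 -> \bar R) :
  measurable_fun [set: T1 * T2] F -> (forall x, 0 <= F x)%E ->
  (\int[P]_w F (X w, Y w) = \int[P]_w1 \int[P]_w2 F (X w1, Y w2))%E.
Proof.
move=> mF F0.
transitivity (\int[distribution P mXY_pack]_x F x)%E.
  by rewrite ge0_integral_distribution.
transitivity (\int[(distribution P mX_pack \x distribution P mY_pack)]_x F x)%E.
  by apply: eq_measure_integral => A mA _; exact: esym (joint_law mA).
rewrite fubini_tonelli1 //.
rewrite ge0_integral_distribution; last 2 first.
- exact: measurable_fun_fubini_tonelli_F.
- by move=> x; apply: integral_ge0.
apply: eq_integral => w1 _ /=.
rewrite /fubini_F ge0_integral_distribution //.
exact: measurable_fun_pair2.
Qed.

(** This replaces conditioning: a bound that is uniform over frozen values of [X] survives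
    averaging. It serves to freeze $T+\Phi_t$ while averaging over the potential. *)
Lemma indep_ge0_integral_le (F : T1 * T2 -> \bar R) (c : R) :
  measurable_fun [set: T1 * T2] F -> (forall x, 0 <= F x)%E ->
  (forall w1, \int[P]_w2 F (X w1, Y w2) <= c%:E)%E ->
  (\int[P]_w F (X w, Y w) <= c%:E)%E.
Proof.
move=> mF F0 hc; rewrite indep_ge0_integral //.
have -> : (c%:E = \int[P]_w c%:E)%E.
  by rewrite integral_cst // [X in (_ * X)%E](probability_setT P) mule1.
apply: ge0_le_integral => //; first by move=> w _; apply: integral_ge0.
have -> : (fun w1 => \int[P]_w2 F (X w1, Y w2))%E =
    fubini_F (distribution P mY_pack) F \o X.
  apply/funext => w1 /=; rewrite /fubini_F ge0_integral_distribution //.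
  exact: measurable_fun_pair2.
apply: measurableT_comp => //.
exact: measurable_fun_fubini_tonelli_F.
Qed.

Lemma indep_integrable (f : T1 -> R) (g : T2 -> R) :
  measurable_fun setT f -> measurable_fun setT g ->
  P.-integrable setT (EFin \o (f \o X)) -> P.-integrable setT (EFin \o (g \o Y)) ->
  P.-integrable setT (fun w => (f (X w) * g (Y w))%:E).
Proof.
move=> mf mg If Ig; apply/integrableP; split.
  by apply/measurable_EFinP/measurable_funM; exact: measurableT_comp.
have If' := integrable_abse If; have Ig' := integrable_abse Ig.
pose F (x : T1 * T2) := (`|f x.1|%:E * `|g x.2|%:E)%E.
have mF : measurable_fun [set: T1 * T2] F.
  apply: emeasurable_funM; apply/measurable_EFinP; apply: measurableT_comp => //;
  by apply: measurableT_comp => //.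
have F0 x : (0 <= F x)%E by rewrite mule_ge0 // lee_fin.
rewrite (eq_integral (fun w => F (X w, Y w))); last first.
  by move=> w _; rewrite /F /= normrM EFinM.
rewrite indep_ge0_integral // /F /=.
have mgY : measurable_fun setT (fun w => `|g (Y w)|%:E).
  by apply/measurable_EFinP; do 2 apply: measurableT_comp => //.
have mfX : measurable_fun setT (fun w => `|f (X w)|%:E).
  by apply/measurable_EFinP; do 2 apply: measurableT_comp => //.
under eq_integral => w1 _.
  rewrite ge0_integralZl //.
  over.
have cg : (\int[P]_x `|g (Y x)|%:E = (fine (\int[P]_x `|g (Y x)|%:E))%:E)%E.
  by rewrite fineK //; exact: integrable_fin_num.
have fg0 : (0 <= (fine (\int[P]_x `|g (Y x)|%:E))%:E)%E.
  by rewrite lee_fin fine_ge0 // integral_ge0 // => w _; rewrite lee_fin.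
rewrite cg ge0_integralZr //=.
rewrite -cg; apply: lte_mul_pinfty.
- by apply: integral_ge0 => w _; rewrite lee_fin.
- exact: integrable_fin_num.
- by case/integrableP : Ig => _.
Qed.

Lemma indep_Rintegral (f : T1 -> R) (g : T2 -> R) :
  measurable_fun setT f -> measurable_fun setT g ->
  P.-integrable setT (EFin \o (f \o X)) -> P.-integrable setT (EFin \o (g \o Y)) ->
  \int[P]_w (f (X w) * g (Y w)) = (\int[P]_w f (X w)) * (\int[P]_w g (Y w)).
Proof.
move=> mf mg If Ig; have Ifg := indep_integrable mf mg If Ig.
pose F (x : T1 * T2) := (f x.1 * g x.2)%:E.
have mF : measurable_fun [set: T1 * T2] F.
  apply/measurable_EFinP; apply: measurable_funM; exact: measurableT_comp.
have IF1 : (pushforward P mXY_pack).-integrable [set: T1 * T2] F.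
  by apply: integrable_pushforward => //.
have IF : ((distribution P mX_pack \x distribution P mY_pack)%E).-integrable [set: T1 * T2] F.
  apply/integrableP; split => //; case/integrableP : IF1 => _.
  apply: le_lt_trans; rewrite le_eqVlt; apply/orP; left; apply/eqP.
  by apply: eq_measure_integral => A mA _; exact: joint_law mA.
rewrite /Rintegral.
transitivity (fine (\int[pushforward P mXY_pack]_x F x)%E).
  by rewrite integral_pushforward.
transitivity (fine (\int[(distribution P mX_pack \x distribution P mY_pack)]_x F x)%E).
  by congr fine; apply: eq_measure_integral => A mA _; exact: esym (joint_law mA).
have If1 : (distribution P mX_pack).-integrable setT (EFin \o f).
  by apply: integrable_pushforward => //; exact/measurable_EFinP.
have Ig1 : (distribution P mY_pack).-integrable setT (EFin \o g).
  by apply: integrable_pushforward => //; exact/measurable_EFinP.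
rewrite -integral12_prod_meas1 // /fubini_F /F /=.
under eq_integral.
  move=> x _; under eq_integral do rewrite EFinM; rewrite integralZl //.
  over.
have cg : (\int[distribution P mY_pack]_x (g x)%:E =
    (fine (\int[distribution P mY_pack]_x (g x)%:E))%:E)%E.
  by rewrite fineK //; exact: integrable_fin_num.
rewrite cg integralZr // fineM //; last exact: integrable_fin_num.
by rewrite !integral_pushforward //; exact/measurable_EFinP.
Qed.

End Law.

End Independence.

Section IndependentGenerators.
Context {R : realType} {d : measure_display} {Omega : measurableType d}.
Variable P : probability Omega R.
Implicit Types G : set (set Omega).

Lemma generated_measurable G : G `<=` measurable -> <<s G >> `<=` measurable.
Proof.
by move=> Gm; apply: smallest_sub => //; exact: sigma_algebra_measurable.
Qed.

(** For fixed [B], the finite measures $A\mapsto P(A\cap B)$ and $A\mapsto P(A)P(B)$ agree on a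
    pi-system containing the whole space, hence on the sigma-algebra that it generates. *)
Let indep_half G B : G `<=` measurable -> setI_closed G -> G setT ->
  measurable B -> (forall A, G A -> P (A `&` B) = (P A * P B)%E) ->
  forall A, <<s G >> A -> P (A `&` B) = (P A * P B)%E.
Proof.
move=> Gm GI GT mB GB A sA.
have PB : P B = (fine (P B))%:E by rewrite fineK // fin_num_measure.
have PB0 : 0 <= fine (P B) by rewrite fine_ge0.
transitivity (mrestr P mB A); first by [].
transitivity (mscale (NngNum PB0) P A); last by rewrite /mscale /= muleC -PB.
apply: (g_sigma_algebra_measure_unique G Gm (fun=> setT)) => //.
- by rewrite bigcup_const.
- move=> C GC; transitivity (P (C `&` B)); first by [].
  by rewrite GB // muleC {1}PB.
- move=> n; apply: (@le_lt_trans _ _ (P (setT `&` B))) => //.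
  by rewrite setTI; apply: (le_lt_trans (probability_le1 _ _)) => //; rewrite ltry.
Qed.

(** [indep_half] is used twice, first to pass from [G1] to its sigma-algebra and then, with the
    roles exchanged, for [G2]. *)
Lemma indep_generated G1 G2 :
  G1 `<=` measurable -> G2 `<=` measurable -> setI_closed G1 -> setI_closed G2 ->
  G1 setT -> G2 setT ->
  (forall A B, G1 A -> G2 B -> P (A `&` B) = (P A * P B)%E) ->
  forall A B, <<s G1 >> A -> <<s G2 >> B -> P (A `&` B) = (P A * P B)%E.
Proof.
move=> m1 m2 I1 I2 T1 T2 H A B sA sB.
apply: (indep_half m1) => //; first exact: (generated_measurable m2).
move=> C G1C; rewrite setIC muleC; apply: (indep_half m2) => //; first exact: m1.
by move=> D G2D; rewrite setIC H // muleC.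
Qed.

End IndependentGenerators.

(** * Measurability of complex functions and of the resolvent *)

Section ComplexMeasurable.
Context {R : realType} {d : measure_display} {T : measurableType d}.
Implicit Types (f g : T -> R[i]).

Definition cmeasurable f :=
  measurable_fun [set: T] (fun x => Re (f x)) /\ measurable_fun [set: T] (fun x => Im (f x)).

Lemma cmeasurable_cst (c : R[i]) : cmeasurable (fun=> c).
Proof. by split; exact: measurable_cst. Qed.

Lemma cmeasurable_real (h : T -> R) : measurable_fun [set: T] h ->
  cmeasurable (fun x => (h x)%:C%C).
Proof. by move=> mh; split => //=; exact: measurable_cst. Qed.

Lemma cmeasurableD f g : cmeasurable f -> cmeasurable g ->
  cmeasurable (fun x => f x + g x).
Proof.
move=> [f1 f2] [g1 g2]; split.
  by under eq_fun do rewrite ReD; exact: measurable_funD.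
by under eq_fun do rewrite ImD; exact: measurable_funD.
Qed.

Lemma cmeasurableN f : cmeasurable f -> cmeasurable (fun x => - f x).
Proof.
move=> [f1 f2]; split.
  by under eq_fun do rewrite ReN; exact: measurableT_comp.
by under eq_fun do rewrite ImN; exact: measurableT_comp.
Qed.

Lemma cmeasurableB f g : cmeasurable f -> cmeasurable g ->
  cmeasurable (fun x => f x - g x).
Proof. by move=> mf mg; apply: cmeasurableD => //; exact: cmeasurableN. Qed.

Lemma cmeasurableM f g : cmeasurable f -> cmeasurable g ->
  cmeasurable (fun x => f x * g x).
Proof.
move=> [f1 f2] [g1 g2]; split.
  by under eq_fun do rewrite ReM; apply: measurable_funB; exact: measurable_funM.
by under eq_fun do rewrite ImM; apply: measurable_funD; exact: measurable_funM.
Qed.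

Lemma measurable_funV (h : T -> R) : measurable_fun [set: T] h ->
  (forall x, 0 <= h x) -> measurable_fun [set: T] (fun x => (h x)^-1).
Proof.
move=> mh h0; under eq_fun do rewrite -powR_inv1 //.
exact: (measurableT_comp (measurable_powR (-1)) mh).
Qed.

(** $1/f=\bar f/|f|^2$; this also holds where $f=0$, both sides being 0 by the convention for
    inverses. *)
Lemma cmeasurableV f : cmeasurable f -> cmeasurable (fun x => (f x)^-1).
Proof.
move=> [f1 f2].
pose q x := (Re (f x) ^+ 2 + Im (f x) ^+ 2)^-1.
have mq : measurable_fun [set: T] q.
  apply: measurable_funV => [|x]; last by rewrite addr_ge0 // sqr_ge0.
  by apply: measurable_funD; exact: measurable_funX.
split.
  rewrite (_ : (fun x => Re (f x)^-1) = fun x => Re (f x) * q x).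
    exact: measurable_funM.
  by apply/funext => x; rewrite /q; case: (f x) => a b.
rewrite (_ : (fun x => Im (f x)^-1) = fun x => - (Im (f x) * q x)).
  by apply: measurableT_comp => //; exact: measurable_funM.
by apply/funext => x; rewrite /q; case: (f x) => a b /=; rewrite ?mulNr.
Qed.

Lemma cmeasurable_sum (I : Type) (r : seq I) (Q : pred I) (F : I -> T -> R[i]) :
  (forall i, cmeasurable (F i)) -> cmeasurable (fun x => \sum_(i <- r | Q i) F i x).
Proof.
move=> mF; elim: r => [|i r IH].
  by under [X in cmeasurable X]eq_fun do rewrite big_nil; exact: cmeasurable_cst.
under [X in cmeasurable X]eq_fun do rewrite big_cons.
by case: (Q i) => //; exact: cmeasurableD.
Qed.

Lemma cmeasurable_prod (I : Type) (r : seq I) (Q : pred I) (F : I -> T -> R[i]) :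
  (forall i, cmeasurable (F i)) -> cmeasurable (fun x => \prod_(i <- r | Q i) F i x).
Proof.
move=> mF; elim: r => [|i r IH].
  by under [X in cmeasurable X]eq_fun do rewrite big_nil; exact: cmeasurable_cst.
under [X in cmeasurable X]eq_fun do rewrite big_cons.
by case: (Q i) => //; exact: cmeasurableM.
Qed.

Lemma cmeasurable_det n (A : T -> 'M[R[i]]_n) :
  (forall i j, cmeasurable (fun x => A x i j)) -> cmeasurable (fun x => \det (A x)).
Proof.
move=> mA; rewrite /determinant; apply: cmeasurable_sum => s.
apply: cmeasurableM; first exact: cmeasurable_cst.
by apply: cmeasurable_prod => i; exact: mA.
Qed.

(** Cramer's rule exhibits the entries as quotients of polynomials; invertibility everywhere selects
    that branch in the definition of [invmx]. *)
Lemma cmeasurable_invmx n (A : T -> 'M[R[i]]_n) :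
  (forall x, A x \in unitmx) -> (forall i j, cmeasurable (fun x => A x i j)) ->
  forall i j, cmeasurable (fun x => invmx (A x) i j).
Proof.
move=> uA mA i j.
under [X in cmeasurable X]eq_fun => x do rewrite /invmx uA !mxE /cofactor.
apply: cmeasurableM; first exact/cmeasurableV/cmeasurable_det.
apply: cmeasurableM; first exact: cmeasurable_cst.
apply: cmeasurable_det => a b.
by under [X in cmeasurable X]eq_fun do rewrite !mxE; exact: mA.
Qed.

Lemma cmeasurable_resolvent n (A : T -> 'M[R]_n) (z : R[i]) :
  (forall x, (A x)^T = A x) -> 0 < Im z ->
  (forall i j, measurable_fun [set: T] (fun x => A x i j)) ->
  forall i j, cmeasurable (fun x => resolvent (A x) z i j).
Proof.
move=> sA z0 mA; apply: cmeasurable_invmx => [x|i j]; first exact: resolvent_unit.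
under [X in cmeasurable X]eq_fun do rewrite !mxE.
apply: cmeasurableB; last exact: cmeasurable_cst.
exact: cmeasurable_real.
Qed.

Lemma measurable_cmod f : cmeasurable f -> measurable_fun [set: T] (fun x => cmod (f x)).
Proof.
move=> [f1 f2]; rewrite /cmod; under eq_fun do rewrite normc_def /=.
apply: (measurableT_comp (f := @Num.sqrt R)).
  by apply: continuous_measurable_fun; exact: sqrt_continuous.
by apply: measurable_funD; exact: measurable_funX.
Qed.

Lemma cmeasurable_trace n (A : T -> 'M[R[i]]_n) :
  (forall i j, cmeasurable (fun x => A x i j)) -> cmeasurable (fun x => \tr (A x)).
Proof. by move=> mA; apply: cmeasurable_sum => i; exact: mA. Qed.

Lemma cmeasurable_mulmx m n p (A : T -> 'M[R[i]]_(m, n)) (B : T -> 'M[R[i]]_(n, p)) :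
  (forall i j, cmeasurable (fun x => A x i j)) ->
  (forall i j, cmeasurable (fun x => B x i j)) ->
  forall i j, cmeasurable (fun x => (A x *m B x) i j).
Proof.
move=> mA mB i j; under [X in cmeasurable X]eq_fun do rewrite mxE.
by apply: cmeasurable_sum => k; exact: cmeasurableM.
Qed.

End ComplexMeasurable.

(** * Wegner estimates *)

Section Dyadic.
Context {R : realType}.

(** A layer decomposition of $1/x$ truncated at $2^K$. When $x<2^{-k}$ has probability $O(2^{-k})$,
    every scale contributes $O(1)$, and $K$ becomes the logarithm of $1/\eta$. *)
Lemma dyadic_inv (x g : R) (K : nat) : g <= 2 ^+ K -> g * x <= 1 ->
  g <= 1 + \sum_(k < K) 2 ^+ k.+1 * (x < 2^-1 ^+ k)%R%:R.
Proof.
elim: K => [|K IH] gK gx; first by rewrite big_ord0 addr0.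
rewrite big_ord_recr /= addrA; have [xK|xK] := ltP x (2^-1 ^+ K).
  by rewrite mulr1; apply: le_trans gK _; rewrite lerDr addr_ge0 // sumr_ge0.
rewrite mulr0 addr0; apply: IH => //.
have p0 : (0 : R) < 2^-1 ^+ K by rewrite exprn_gt0.
have [g0|g0] := lerP 0 g; last first.
  by apply: (le_trans (ltW g0)); rewrite exprn_ge0.
have -> : (2 : R) ^+ K = (2^-1 ^+ K)^-1 by rewrite exprVn invrK.
rewrite -[leRHS]mul1r ler_pdivlMr //; apply: le_trans gx.
by rewrite ler_wpM2l.
Qed.

(** Here [h] stands for $b/(y^2+b^2)$ with $b$ within a factor 2 of [beta]. The weights $4^{-l}$
    beat the probabilities of order $2^l\beta$ of the balls, so no logarithm arises. The 8 is
    $4\cdot 2$: one scale costs a factor 4, and the 2 comes from $hy^2\le 2\beta$. *)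
Lemma dyadic_cauchy (y h beta : R) (K : nat) : 0 < beta -> 0 <= y -> 0 <= h ->
  h <= 8 / beta -> h * y ^+ 2 <= 2 * beta ->
  h <= 8 / beta * 4^-1 ^+ K +
       \sum_(l < K) 8 / beta * 4^-1 ^+ l * (y < 2 ^+ l * beta)%R%:R.
Proof.
move=> b0 y0 h0 h8 hy; elim: K => [|K IH]; first by rewrite big_ord0 mulr1 addr0.
rewrite big_ord_recr /=; have [yK|yK] := ltP y (2 ^+ K * beta).
  rewrite mulr1 [X in _ + X]addrC addrA; apply: le_trans IH _; rewrite lerD2r lerDr.
  by rewrite mulr_ge0 ?exprn_ge0 // divr_ge0 // ltW.
rewrite mulr0 addr0 -[leLHS]addr0 lerD //; last first.
  apply: sumr_ge0 => l _; rewrite mulr_ge0 // mulr_ge0 ?exprn_ge0 //.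
  by rewrite divr_ge0 // ltW.
have pK : (0 : R) < 4 ^+ K by rewrite exprn_gt0.
have q : 4 ^+ K * beta ^+ 2 <= y ^+ 2.
  have -> : (4 : R) ^+ K = (2 ^+ K) ^+ 2 by rewrite -exprM mulnC exprM; congr (_ ^+ _); ring.
  by rewrite -exprMn lerXn2r // nnegrE // mulr_ge0 ?exprn_ge0 // ltW.
have hq := le_trans (ler_wpM2l h0 q) hy.
rewrite exprS exprVn.
have -> : 8 / beta * (4^-1 * (4 ^+ K)^-1) = 2 * beta / (4 ^+ K * beta ^+ 2).
  by field; rewrite !gt_eqF.
by rewrite ler_pdivlMr // mulr_gt0 // exprn_gt0.
Qed.

End Dyadic.

(** * Averages over one variable with bounded conditional density *)

Section ConditionalDensity.
Context {R : realType} {d : measure_display} {Omega : measurableType d}.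
Variable P : probability Omega R.

Lemma integral_partition_le (D : nat -> set Omega) (h : Omega -> \bar R)
    (Q : {measure set Omega -> \bar R}) (c : R) :
  (forall n, measurable (D n)) -> trivIset setT D -> \bigcup_n D n = setT ->
  measurable_fun setT h -> (forall w, 0 <= h w)%E ->
  (forall n, \int[P]_(w in D n) h w <= c%:E * Q (D n))%E ->
  (\int[P]_w h w <= c%:E * Q setT)%E.
Proof.
move=> mD tD cD mh h0 hD.
rewrite -cD ge0_integral_bigcup //; last by rewrite cD.
rewrite measure_semi_bigcup //; last by rewrite cD.
rewrite -nneseriesZl //; apply: lee_nneseries => // n _ _.
by apply: integral_ge0 => w _.
Qed.

Lemma integral_mrestr (D : set Omega) (mD : measurable D) (f : Omega -> \bar R) :
  measurable_fun setT f -> (forall w, 0 <= f w)%E ->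
  (\int[mrestr P mD]_w f w = \int[P]_(w in D) f w)%E.
Proof.
move=> mf f0.
rewrite -(setUv D) ge0_integral_setU //; first last.
- by rewrite disj_set2E setICr.
- by rewrite setUv.
- exact: measurableC.
rewrite [X in (_ + X)%E]null_set_integral ?adde0 //; first last.
- by rewrite /= /mrestr setICl measure0.
- exact: measurable_funTS.
- exact: measurableC.
by apply: eq_measure_integral => A mA AD; rewrite /= /mrestr setIidl.
Qed.

Variables (G : set (set Omega)) (v : Omega -> R) (C : R).
Hypothesis Gm : G `<=` measurable.
Hypothesis mv : measurable_fun setT v.
Hypothesis C0 : 0 <= C.
Hypothesis density : forall (I : set R) (A : set Omega), measurable I -> <<s G >> A ->
  (P ((v @^-1` I) `&` A) <= C%:E * lebesgue_measure I * P A)%E.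

Local Notation OG := (g_sigma_algebraType G).

Lemma measurable_id_gen : measurable_fun setT (id : Omega -> OG).
Proof. by move=> _ B mB; rewrite setTI; exact: (generated_measurable Gm). Qed.

Lemma measurable_gen d' (T : measurableType d') (f : OG -> T) :
  measurable_fun setT f -> measurable_fun setT (f : Omega -> T).
Proof. by move=> mf; exact: (measurableT_comp mf measurable_id_gen). Qed.

Lemma measurable_ball_gen (a : OG -> R) (r : R) : measurable_fun setT a ->
  d.-measurable [set w | `|v w - a w| < r].
Proof.
move=> /measurable_gen ma.
have : measurable_fun setT (fun w => `|v w - a w|).
  by apply: measurableT_comp => //; apply: measurable_funB.
move=> /(_ measurableT `]-oo, r[%classic (measurable_itv _)); rewrite setTI.
by congr measurable; apply/seteqP; split => w /=; rewrite in_itv.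
Qed.

(** The cells $kr\le a<(k+1)r$ are indexed by integers $k$ encoded as naturals; a natural that
    encodes no integer receives the empty cell. *)
Lemma grid_cells (a : OG -> R) (r : R) : 0 < r -> measurable_fun setT a ->
  exists F : nat -> set Omega, [/\ (forall n, <<s G >> (F n)), trivIset setT F,
    \bigcup_n F n = setT & forall n, exists c, forall w, F n w -> c <= a w < c + r].
Proof.
move=> r0 ma.
pose cell (k : int) : set Omega := [set w | k%:~R * r <= a w < k%:~R * r + r].
exists (fun n => if @pickle_inv int n is Some k then cell k else set0).
have cellE k w : cell k w -> Num.floor (a w / r) = k.
  move=> /andP[h1 h2]; apply: floor_def; rewrite ler_pdivlMr // h1 /=.
  by rewrite ltr_pdivrMr // intrD mulrDl mul1r.
split.
- move=> n; case: (@pickle_inv int n) => [k|]; last exact: sigma_algebra0.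
  have := ma measurableT `[(k%:~R * r), (k%:~R * r + r)[%classic (measurable_itv _).
  by rewrite setTI; congr (<<s G >>); apply/seteqP; split => w /=; rewrite in_itv.
- move=> m n _ _ [w []].
  have hm := @pickle_invK int m; have hn := @pickle_invK int n.
  case: (@pickle_inv int m) hm => [k|//] /= <-.
  case: (@pickle_inv int n) hn => [l|//] /= <-.
  by move=> /cellE <- /cellE <-.
- apply/seteqP; split => // w _.
  have /andP[] := floor_itv (a w / r); set k := Num.floor _ => h1 h2.
  exists (pickle k); first exact: I.
  rewrite pickleK_inv /cell /mkset.
  rewrite -ler_pdivlMr // h1 /= -[X in _ < _ + X]mul1r -mulrDl -ltr_pdivrMr //.
  by move: h2; rewrite intrD.
- move=> n; case: (@pickle_inv int n) => [k|]; last by exists 0.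
  by exists (k%:~R * r).
Qed.

(** The hypothesis [density] handles fixed intervals, while the centre [a] is random. On a cell
    $c\le a<c+r$ the ball lies in $]c-r,c+2r[$, whose length $3r$ explains the factor 3. *)
Lemma small_ball_set (a : OG -> R) (r : R) (A : set Omega) : 0 < r ->
  measurable_fun setT a -> <<s G >> A ->
  (P ([set w | (`|v w - a w| < r)%R] `&` A) <= (3 * C * r)%:E * P A)%E.
Proof.
move=> r0 ma sA.
have mA : measurable A := generated_measurable Gm sA.
have mB := measurable_ball_gen r ma.
have [F [sF tF cF hF]] := grid_cells r0 ma.
have mF n : measurable (F n) := generated_measurable Gm (sF n).
have -> : P A = mrestr P mA setT by rewrite /mrestr /= setTI.
rewrite -[X in P X]setIT -integral_indic //; last exact: measurableI.
apply: (integral_partition_le mF tF cF) => //.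
  by apply/measurable_EFinP; apply: measurable_indic; exact: measurableI.
move=> n; rewrite integral_indic //; last exact: measurableI.
have [c hc] := hF n.
rewrite /mrestr /=.
have sFA : <<s G >> (F n `&` A).
  exact: (@measurableI _ OG (F n) A (sF n) sA).
have := density (I := `]c - r, c + 2 * r[%classic) (measurable_itv _) sFA.
rewrite lebesgue_measure_itv /= lte_fin.
rewrite ifT; last by lra.
rewrite -EFinB -EFinM => /(le_trans _) h.
rewrite [3 * C * r](_ : _ = C * (c + 2 * r - (c - r))); last by ring.
apply: h; apply: le_measure; rewrite ?inE.
- apply: measurableI => //; exact: measurableI.
- apply: measurableI; last exact: measurableI.
  by rewrite -[X in measurable X]setTI; exact: mv.
- move=> w [[/= h1 h2] h3]; split => //=; rewrite in_itv /=.
  have := hc w h3; move: h1; rewrite ltr_norml; lra.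
Qed.

(** [small_ball_set] compares two measures on the sigma-algebra generated by [G], obtained by
    pushing forward along the identity; integrating [f] against both preserves the inequality. *)
Lemma small_ball (a : OG -> R) (r : R) (f : OG -> \bar R) : 0 < r ->
  measurable_fun setT a -> measurable_fun setT f -> (forall w, 0 <= f w)%E ->
  (\int[P]_(w in [set w | (`|v w - a w| < r)%R]) f w <=
   (3 * C * r)%:E * \int[P]_w f w)%E.
Proof.
move=> r0 ma mf f0.
have mB := measurable_ball_gen r ma.
have mfO := measurable_gen mf.
have Cr : 0 <= 3 * C * r by rewrite mulr_ge0 ?(ltW r0) // mulr_ge0.
have mid := measurable_id_gen.
pose mid_ : {mfun Omega >-> OG} := HB.pack (id : Omega -> OG) (isMeasurableFun.Build _ _ _ _ _ mid).
have e1 : (\int[pushforward (mscale (NngNum Cr) P) mid_]_w f w =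
          (3 * C * r)%:E * \int[P]_w f w)%E.
  rewrite ge0_integral_pushforward //.
  exact: (ge0_integral_mscale P measurableT (NngNum Cr) mfO (fun w _ => f0 w)).
have e2 : (\int[pushforward (mrestr P mB) mid_]_w f w =
          \int[P]_(w in [set w | (`|v w - a w| < r)%R]) f w)%E.
  rewrite ge0_integral_pushforward //.
  exact: (integral_mrestr mB mfO f0).
rewrite -e1 -e2.
apply: (@ge0_le_measure_integral _ OG R
  (pushforward (mrestr P mB) mid_) (pushforward (mscale (NngNum Cr) P) mid_)) => // S mS.
by have := small_ball_set r0 ma mS; rewrite setIC.
Qed.

(** The weight [f] is arbitrary, so that the same bound serves for the first moment and against the
    trace of a resolvent that does not see [v]. The 6 is $2\cdot 3$, from $2^{k+1}\cdot
    3C2^{-k}$. *)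
Lemma integral_cmod_le (a : OG -> R) (g : Omega -> R) (f : OG -> \bar R) (K : nat) :
  measurable_fun setT a -> measurable_fun setT g -> measurable_fun setT f ->
  (forall w, 0 <= f w)%E -> (forall w, 0 <= g w <= 2 ^+ K) ->
  (forall w, g w * `|v w - a w| <= 1) ->
  (\int[P]_w ((g w)%:E * f w) <= (1 + 6 * C * K%:R)%:E * \int[P]_w f w)%E.
Proof.
move=> ma mg mf f0 g0 ga; have mfO := measurable_gen mf.
pose ball k := [set w | `|v w - a w| < 2^-1 ^+ k].
have mball k : measurable (ball k) by exact: measurable_ball_gen.
pose h (k : 'I_K) w := ((2 ^+ k.+1)%:E * (\1_(ball k) w)%:E * f w)%E.
have mh k : measurable_fun setT (h k).
  apply: emeasurable_funM => //; apply/measurable_EFinP.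
  by apply: measurable_funM => //; exact: measurable_indic.
have h0 k w : (0 <= h k w)%E.
  by rewrite /h mule_ge0 // mule_ge0 // lee_fin // exprn_ge0.
apply: (@le_trans _ _ (\int[P]_w (f w + \sum_(k < K) h k w))%E).
  apply: ge0_le_integral => //.
  - by move=> w _; rewrite mule_ge0 // lee_fin; case/andP: (g0 w).
  - by apply: emeasurable_funM => //; exact/measurable_EFinP.
  - by apply: emeasurable_funD => //; exact: emeasurable_sum.
  - move=> w _.
    have /andP[_ gK] := g0 w.
    have := dyadic_inv gK (ga w); rewrite -lee_fin => /(lee_wpmul2r (f0 w)) /le_trans; apply.
    rewrite EFinD ge0_muleDl //; last first.
      by rewrite lee_fin sumr_ge0 // => k _; rewrite mulr_ge0 // exprn_ge0.
    rewrite mul1e leeD // -sumEFin ge0_sume_distrl; last first.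
      by move=> k _; rewrite lee_fin mulr_ge0 // exprn_ge0.
    apply: lee_sum => k _; rewrite /h -EFinM indicE.
    by rewrite /ball mem_setE.
rewrite ge0_integralD //; last 2 first.
- by move=> w _; exact: sume_ge0.
- exact: emeasurable_sum.
rewrite ge0_integral_sum //.
have -> : ((1 + 6 * C * K%:R)%:E * \int[P]_w f w =
           \int[P]_w f w + \sum_(k < K) (6 * C)%:E * \int[P]_w f w)%E.
  rewrite EFinD ge0_muleDl ?lee_fin // ?mul1e; last first.
    by rewrite mulr_ge0 // mulr_ge0.
  congr (_ + _)%E; rewrite -ge0_sume_distrl; last first.
    by move=> k _; rewrite lee_fin mulr_ge0.
  by rewrite sumEFin sumr_const card_ord mulr_natr.
rewrite leeD //; apply: lee_sum => k _.
rewrite /h.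
under eq_integral do rewrite -muleA.
rewrite ge0_integralZl //; last 2 first.
- apply: emeasurable_funM => //; apply/measurable_EFinP; exact: measurable_indic.
- by move=> w _; rewrite mule_ge0 // lee_fin.
have -> : (\int[P]_w ((\1_(ball k) w)%:E * f w) = \int[P]_(w in ball k) f w)%E.
  rewrite [RHS]integral_mkcond; apply: eq_integral => w _.
  by rewrite epatch_indic /= muleC.
have r0 : (0 : R) < 2^-1 ^+ k by rewrite exprn_gt0.
have := small_ball r0 ma mf f0.
have k0 : (0 <= (2 ^+ k.+1 : R)%:E)%E by rewrite lee_fin exprn_ge0.
move=> /(lee_wpmul2l k0) /le_trans; apply.
rewrite muleA -EFinM.
have -> // : 2 ^+ k.+1 * (3 * C * 2^-1 ^+ k) = 6 * C :> R.
by rewrite exprS exprVn; field; rewrite expf_neq0.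
Qed.

(** A Cauchy profile has mass independent of its width, so [eta] disappears from the bound. The 48
    is $8\cdot3\cdot2$: from [dyadic_cauchy], from [small_ball_set] and from the geometric series;
    the 1 is the truncation error. *)
Lemma integral_cauchy_le (a b : OG -> R) (eta : R) :
  measurable_fun setT a -> measurable_fun setT b -> 0 < eta ->
  (forall w, eta <= b w) ->
  (\int[P]_w (b w / ((v w - a w) ^+ 2 + b w ^+ 2))%:E <= (48 * C + 1)%:E)%E.
Proof.
move=> ma mb eta0 hb.
have b0 w : 0 < b w by exact: lt_le_trans (hb w).
pose h (w : Omega) := b w / ((v w - a w) ^+ 2 + b w ^+ 2).
have maO := measurable_gen ma; have mbO := measurable_gen mb.
have den0 w : 0 < (v w - a w) ^+ 2 + b w ^+ 2.
  by rewrite ltr_wpDl ?sqr_ge0 // exprn_gt0.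
have h0 w : 0 <= h w by rewrite divr_ge0 // ltW.
have mh : measurable_fun [set: Omega] h.
  apply: measurable_funM => //; apply: measurable_funV => [|w]; last exact/ltW/den0.
  by apply: measurable_funD; apply: measurable_funX => //; exact: measurable_funB.
(* On a cell that is met, $\beta\ge\eta/2$; hence this [K] makes the truncation error
   $8\beta^{-1}4^{-K}$ at most 1. *)
have [K hK] : exists K : nat, 16 / eta <= 4 ^+ K.
  exists (Num.truncn (16 / eta)).+1.
  apply: (@le_trans _ _ (Num.truncn (16 / eta)).+1%:R).
    exact/ltW/truncnS_gt.
  by rewrite -natrX ler_nat ltnW // ltn_expl.
have ln20 : 0 < ln (2 : R) by rewrite ln_gt0 // ltr1n.
have mlnb : measurable_fun setT (fun w : OG => ln (b w)).
  exact: (measurableT_comp (@measurable_ln R) mb).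
(* Cells of length $\ln 2$ for $\ln b$: on each one the random width is known up to a factor 2, the
   centre being left to [small_ball_set]. *)
have [F [sF tF cF hF]] := grid_cells ln20 mlnb.
have mF n : measurable (F n) := generated_measurable Gm (sF n).
rewrite -[X in (_ <= X)%E]mule1 -(probability_setT P).
apply: (integral_partition_le mF tF cF) => //; first exact/measurable_EFinP.
move=> n; have [->|/set0P[w0 Fw0]] := eqVneq (F n) set0.
  by rewrite integral_set0 measure0 mule0.
have [c0 hc0] := hF n.
pose beta := expR c0.
have beta0 : 0 < beta := expR_gt0 c0.
have hbeta w : F n w -> beta <= b w < 2 * beta.
  move=> /hc0/andP[h1 h2]; rewrite -(@lnK _ (b w)) ?posrE // ler_expR h1 /=.
  by rewrite -(@lnK _ 2) ?posrE // -expRD ltr_expR addrC.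
have etab : eta <= 2 * beta.
  by have /andP[_ /ltW] := hbeta w0 Fw0; apply: le_trans.
pose ball l := [set w | `|v w - a w| < 2 ^+ l * beta].
have mball l : measurable (ball l) by exact: measurable_ball_gen.
pose g (l : 'I_K) w := ((8 / beta * 4^-1 ^+ l)%:E * (\1_(ball l) w)%:E)%E.
have mg l : measurable_fun (F n) (g l).
  apply: measurable_funTS; apply: emeasurable_funM => //; apply/measurable_EFinP.
  exact: measurable_indic.
have cg l : 0 <= 8 / beta * 4^-1 ^+ l by rewrite mulr_ge0 ?exprn_ge0 // divr_ge0 // ltW.
have g0 l w : (0 <= g l w)%E by rewrite /g mule_ge0 // lee_fin.
apply: (@le_trans _ _ (\int[P]_(w in F n) (1 + \sum_(l < K) g l w))%E).
  apply: ge0_le_integral => //.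
  - by move=> w _; rewrite lee_fin; exact: h0.
  - exact/measurable_EFinP/measurable_funTS.
  - by apply: emeasurable_funD => //; exact: emeasurable_sum.
  - move=> w Fw; have /andP[b1 b2] := hbeta w Fw.
    have hw8 : h w <= 8 / beta.
      rewrite /h ler_pdivrMr //; apply: (@le_trans _ _ (8 / beta * b w ^+ 2)).
        rewrite mulrAC ler_pdivlMr // expr2 mulrA [leLHS]mulrC ler_wpM2r ?(ltW (b0 w)) //.
        by apply: (le_trans b1); rewrite ler_peMl ?ler1n // ltW.
      by rewrite ler_wpM2l ?lerDr ?sqr_ge0 // divr_ge0 // ltW.
    have hwy : h w * `|v w - a w| ^+ 2 <= 2 * beta.
      rewrite real_normK ?num_real // /h mulrAC ler_pdivrMr //.
      rewrite mulrDr -[leLHS]addr0 lerD //.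
        by rewrite ler_wpM2r ?sqr_ge0 // ltW.
      by rewrite mulr_ge0 ?sqr_ge0 // mulr_ge0 // ltW.
    have := dyadic_cauchy K beta0 (normr_ge0 (v w - a w)) (h0 w) hw8 hwy.
    have tail : 8 / beta * 4^-1 ^+ K <= 1.
      rewrite exprVn ler_pdivrMr ?exprn_gt0 // mul1r; apply: le_trans hK.
      rewrite ler_pdivrMr // mulrAC ler_pdivlMr //.
      by move: etab; lra.
    move=> /le_trans /(_ (lerD tail (lexx _))); rewrite -lee_fin => /le_trans; apply.
    rewrite EFinD leeD // -sumEFin; apply: lee_sum => l _.
    by rewrite /g -EFinM indicE /ball mem_setE.
rewrite ge0_integralD //; last 2 first.
- by move=> w _; exact: sume_ge0.
- exact: emeasurable_sum.
rewrite integral_cst // mul1e EFinD ge0_muleDl ?lee_fin // ?mulr_ge0 // mul1e addeC leeD //.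
rewrite ge0_integral_sum //.
apply: (@le_trans _ _ (\sum_(l < K) (24 * C * 2^-1 ^+ l)%:E * P (F n))%E).
  apply: lee_sum => l _; rewrite /g ge0_integralZl //; last 2 first.
  - by apply: measurable_funTS; apply/measurable_EFinP; exact: measurable_indic.
  - by rewrite lee_fin.
  rewrite integral_indic // setIC.
  have r0 : 0 < 2 ^+ l * beta by rewrite mulr_gt0 // exprn_gt0.
  have := small_ball_set r0 ma (sF n); rewrite setIC.
  have k0 : (0 <= (8 / beta * 4^-1 ^+ l)%:E)%E by rewrite lee_fin.
  move=> /(lee_wpmul2l k0) /le_trans; apply.
  rewrite muleA -EFinM lee_wpmul2r // lee_fin le_eqVlt; apply/orP; left; apply/eqP.
  have -> : (4 : R) = 2 * 2 by ring.
  by rewrite !exprVn exprMn; field; rewrite expf_neq0 // gt_eqF.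
rewrite -ge0_sume_distrl; last by move=> l _; rewrite lee_fin mulr_ge0 // mulr_ge0.
rewrite sumEFin lee_wpmul2r // lee_fin -mulr_sumr.
have geo : \sum_(l < K) (2^-1 : R) ^+ l <= 2.
  suff -> : \sum_(l < K) (2^-1 : R) ^+ l = 2 - 2 * 2^-1 ^+ K.
    by rewrite gerBl mulr_ge0 // exprn_ge0.
  elim: (K) => [|k IH]; first by rewrite big_ord0; ring.
  by rewrite big_ord_recr /= IH exprS; field.
rewrite (_ : 48 * C = 24 * C * 2); last by ring.
by rewrite ler_wpM2l // mulr_ge0.
Qed.

End ConditionalDensity.

(** * First and second moments of the trace over the potential *)

Section Wegner.
Context {R : realType} {d : measure_display} {Omega : measurableType d}.
Variable P : probability Omega R.
Variables (N : nat) (V : 'I_N -> Omega -> R) (C_V : R) (M : 'M[R]_N) (z : R[i]).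
Hypothesis mV : forall x, measurable_fun [set: Omega] (V x).
Hypothesis density : forall (x : 'I_N) (I : set R) (A : set Omega), measurable I ->
  sigma_of (I := {y : 'I_N | y != x}) (fun y => V (sval y)) A ->
  (P ((V x @^-1` I) `&` A) <= C_V%:E * lebesgue_measure I * P A)%E.
Hypotheses (sM : M^T = M) (z0 : 0 < Im z).

Definition potential (U : 'I_N -> Omega -> R) w : 'M[R]_N := diag_mx (\row_i U i w).

Let H w := M + potential V w.
Let G w := resolvent (H w) z.

Lemma sym_potential U w : (potential U w)^T = potential U w.
Proof. exact: tr_diag_mx. Qed.

Let sH w : (H w)^T = H w.
Proof. by rewrite /H linearD /= sM sym_potential. Qed.

Lemma measurable_potential d' (T : measurableType d') (U : 'I_N -> T -> R) i j :
  (forall x, measurable_fun [set: T] (U x)) ->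
  measurable_fun [set: T] (fun w => (M + diag_mx (\row_i U i w)) i j).
Proof.
move=> mU; under eq_fun do rewrite !mxE.
apply: measurable_funD => //; case: (i == j).
  by under eq_fun do rewrite mulr1n; exact: mU.
by under eq_fun do rewrite mulr0n; exact: measurable_cst.
Qed.

Let cmG i j : cmeasurable (fun w => G w i j).
Proof.
apply: cmeasurable_resolvent => // a b.
exact: measurable_potential.
Qed.

Section Site.
Variable x : 'I_N.

Let gen : set (set Omega) := \bigcup_(y in [set: {y : 'I_N | y != x}])
  preimage_set_system [set: Omega] (V (sval y)) measurable.

Let gen_sub : gen `<=` measurable.
Proof. by move=> A [y _ [B mB <-]]; exact: mV. Qed.

Local Notation OG := (g_sigma_algebraType gen).

(** With the entry at [x] set to zero, [A] is a function of the other sites only, and [H] is a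
    rank-one perturbation of it of strength [V x]. *)
Let U y w := if y == x then 0 else V y w.
Let A w := M + potential U w.

Let sA w : (A w)^T = A w.
Proof. by rewrite /A linearD /= sM sym_potential. Qed.

Let HE w : H w = A w + V x w *: delta_mx x x.
Proof.
apply/matrixP => i j; rewrite !mxE -addrA; congr (_ + _).
rewrite /U; have [<-|ij] := eqVneq i j; rewrite ?mulr1n ?mulr0n.
  by have [->|ix] := eqVneq i x; rewrite ?add0r ?mulr1 // mulr0 addr0.
rewrite add0r; have [ix|ix] := eqVneq i x; rewrite /= ?mulr0 //.
by rewrite -ix eq_sym (negbTE ij) mulr0.
Qed.

Let mU y : measurable_fun [set: OG] (U y).
Proof.
rewrite /U; have [_|yx] := eqVneq y x; first exact: measurable_cst.
move=> _ B mB; apply: sub_sigma_algebra; exists (exist _ y yx) => //.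
by exists B.
Qed.

Let cmA i j : cmeasurable (fun w : OG => resolvent (A w) z i j).
Proof.
apply: cmeasurable_resolvent => // a b.
exact: measurable_potential.
Qed.

Let a w := center (A w) z x.
Let b w := width (A w) z x.

Let ma : measurable_fun [set: OG] a.
Proof. by apply: measurableT_comp => //; case: (cmeasurableV (cmA x x)). Qed.

Let mb : measurable_fun [set: OG] b.
Proof. by apply: measurableT_comp => //; case: (cmeasurableV (cmA x x)). Qed.

(** No sign is assumed for [C_V], whereas the averaging lemmas take a nonnegative constant; this is
    why [C_V] appears in absolute value in all later bounds. *)
Let density' (I : set R) (B : set Omega) : measurable I -> <<s gen >> B ->
  (P ((V x @^-1` I) `&` B) <= `|C_V|%:E * lebesgue_measure I * P B)%E.
Proof.
move=> mI sB; apply: le_trans (density mI sB) _.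
by rewrite lee_wpmul2r // lee_wpmul2r // lee_fin ler_norm.
Qed.

Lemma wegner : (\int[P]_w (Im (G w x x))%:E <= (48 * `|C_V| + 1)%:E)%E.
Proof.
under eq_integral => w _ do rewrite /G HE Im_GxxE // -/(a w) -/(b w).
apply: (integral_cauchy_le gen_sub (mV x) (normr_ge0 C_V) density' ma mb z0).
by move=> w; exact: width_ge.
Qed.

Let L (K : nat) := 1 + 6 * `|C_V| * K%:R.

Lemma cmod_site (f : OG -> \bar R) K : (Im z)^-1 <= 2 ^+ K ->
  measurable_fun setT f -> (forall w, 0 <= f w)%E ->
  (\int[P]_w ((cmod (G w x x))%:E * f w) <= (L K)%:E * \int[P]_w f w)%E.
Proof.
move=> zK mf f0.
apply: (integral_cmod_le gen_sub (mV x) (normr_ge0 C_V) density' ma) => //.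
- exact: measurable_cmod.
- move=> w; rewrite cmod_ge0 /= (le_trans _ zK) //.
  exact: cmod_resolvent_diag.
- by move=> w; rewrite /G HE; exact: Gxx_center.
Qed.

Lemma cmod_site1 K : (Im z)^-1 <= 2 ^+ K ->
  (\int[P]_w (cmod (G w x x))%:E <= (L K)%:E)%E.
Proof.
move=> zK; have := @cmod_site (cst 1%E) K zK (measurable_cst _) (fun=> lee01).
rewrite integral_cst // mul1e [X in (_ <= _ * X)%E -> _](probability_setT P) mule1.
by under eq_integral do rewrite mule1.
Qed.

(** The trace of [G] is exchanged for that of the resolvent of [A], which is a legitimate weight in
    [cmod_site], and afterwards exchanged back. Each exchange costs $1/\mathrm{Im}\,z$ by
    [rank1_trace_le], hence the 2. *)
Lemma cmod_site_trace K : (Im z)^-1 <= 2 ^+ K ->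
  (\int[P]_w (cmod (G w x x) * cmod (\tr (G w)))%:E <=
   (L K)%:E * (\int[P]_w (cmod (\tr (G w)))%:E + (2 / Im z)%:E))%E.
Proof.
move=> zK.
have L0 : (0 <= (L K)%:E)%E by rewrite lee_fin addr_ge0 // mulr_ge0 // mulr_ge0.
have zi : 0 <= (Im z)^-1 by rewrite invr_ge0 ltW.
pose f (w : OG) := (cmod (\tr (resolvent (A w) z)) + (Im z)^-1)%:E.
have mf : measurable_fun setT f.
  apply/measurable_EFinP; apply: measurable_funD => //.
  by apply: measurable_cmod; exact: cmeasurable_trace.
have f0 w : (0 <= f w)%E by rewrite lee_fin addr_ge0 // cmod_ge0.
have mtr : measurable_fun setT (fun w : Omega => cmod (\tr (G w))).
  by apply: measurable_cmod; exact: cmeasurable_trace.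
have dif w : cmod (\tr (G w) - \tr (resolvent (A w) z)) <= (Im z)^-1.
  by rewrite /G HE; exact: rank1_trace_le.
apply: (@le_trans _ _ (\int[P]_w ((cmod (G w x x))%:E * f w))%E).
  apply: ge0_le_integral => //.
  - by move=> w _; rewrite lee_fin mulr_ge0 // cmod_ge0.
  - by apply/measurable_EFinP; apply: measurable_funM => //; exact: measurable_cmod.
  - apply: emeasurable_funM; first by apply/measurable_EFinP; exact: measurable_cmod.
    exact: (measurable_gen gen_sub mf).
  - move=> w _; rewrite -EFinM lee_fin ler_wpM2l ?cmod_ge0 //.
    rewrite -[X in cmod X](subrK (\tr (resolvent (A w) z))) addrC.
    by apply: le_trans (cmodD _ _) _; rewrite lerD.
apply: le_trans (cmod_site zK mf f0) _; rewrite lee_wpmul2l //.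
apply: (@le_trans _ _ (\int[P]_w ((cmod (\tr (G w)))%:E + (2 / Im z)%:E))%E).
  apply: ge0_le_integral => //.
  - exact: (measurable_gen gen_sub mf).
  - by apply: emeasurable_funD => //; exact/measurable_EFinP.
  - move=> w _; rewrite -EFinD lee_fin.
    have -> : 2 / Im z = (Im z)^-1 + (Im z)^-1 by ring.
    rewrite addrA lerD //.
    rewrite -[X in cmod X](addrNK (\tr (G w))) addrC.
    apply: le_trans (cmodD _ _) _; rewrite lerD // -cmodN opprB //.
rewrite ge0_integralD //.
- by rewrite integral_cst // [X in (_ * X)%E](probability_setT P) mule1.
- by move=> w _; rewrite lee_fin cmod_ge0.
- exact/measurable_EFinP.
- by move=> w _; rewrite lee_fin divr_ge0 // ltW.
Qed.

End Site.

Lemma wegner_trace : (\int[P]_w (Im (\tr (G w)))%:E <= (N%:R * (48 * `|C_V| + 1))%:E)%E.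
Proof.
under eq_integral do rewrite /mxtrace Im_sum -sumEFin.
rewrite ge0_integral_sum //; last 2 first.
- by move=> x; apply/measurable_EFinP; case: (cmG x x).
- by move=> x w _; rewrite lee_fin; exact: Im_resolvent_ge0.
apply: (@le_trans _ _ (\sum_(x < N) (48 * `|C_V| + 1)%:E)%E).
  by apply: lee_sum => x _; exact: wegner.
by rewrite sumEFin sumr_const card_ord [N%:R * _]mulr_natl.
Qed.

(* |tr G| <= |tr G'| + 1 / Im z, where G' does not depend on V x: the fluctuation
   of |tr G| decouples from that of G_xx. *)
Lemma wegner_trace_sqr K : (Im z)^-1 <= 2 ^+ K ->
  (\int[P]_w (cmod (\tr (G w)) ^+ 2)%:E <=
   (N%:R * (1 + 6 * `|C_V| * K%:R) *
     (N%:R * (1 + 6 * `|C_V| * K%:R) + 2 / Im z))%:E)%E.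
Proof.
move=> zK; set l := 1 + _; set L := N%:R * l.
have l0 : 0 <= l by rewrite /l addr_ge0 // mulr_ge0 // mulr_ge0.
have mtr : measurable_fun setT (fun w : Omega => cmod (\tr (G w))).
  by apply: measurable_cmod; exact: cmeasurable_trace.
have mG x : measurable_fun setT (fun w : Omega => cmod (G w x x)) by exact: measurable_cmod.
have trle w : cmod (\tr (G w)) <= \sum_x cmod (G w x x) by exact: cmod_sum.
have E1 : (\int[P]_w (cmod (\tr (G w)))%:E <= L%:E)%E.
  apply: (@le_trans _ _ (\int[P]_w (\sum_x (cmod (G w x x))%:E))%E).
    apply: ge0_le_integral => //.
    - by move=> w _; rewrite lee_fin cmod_ge0.
    - exact/measurable_EFinP.
    - by apply: emeasurable_sum => x; exact/measurable_EFinP.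
    - by move=> w _; rewrite sumEFin lee_fin.
  rewrite ge0_integral_sum //; last 2 first.
  - by move=> x; exact/measurable_EFinP.
  - by move=> x w _; rewrite lee_fin cmod_ge0.
  apply: (@le_trans _ _ (\sum_(x < N) l%:E)%E).
    by apply: lee_sum => x _; exact: cmod_site1.
  by rewrite sumEFin sumr_const card_ord /L [N%:R * _]mulr_natl.
apply: (@le_trans _ _ (\int[P]_w (\sum_x (cmod (G w x x) * cmod (\tr (G w)))%:E))%E).
  apply: ge0_le_integral => //.
  - by move=> w _; rewrite lee_fin sqr_ge0.
  - by apply/measurable_EFinP; exact: measurable_funX.
  - by apply: emeasurable_sum => x; apply/measurable_EFinP; exact: measurable_funM.
  - by move=> w _; rewrite sumEFin lee_fin -mulr_suml expr2 ler_wpM2r ?cmod_ge0.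
rewrite ge0_integral_sum //; last 2 first.
- by move=> x; apply/measurable_EFinP; exact: measurable_funM.
- by move=> x w _; rewrite lee_fin mulr_ge0 // cmod_ge0.
apply: (@le_trans _ _ (\sum_(x < N) (l * (L + 2 / Im z))%:E)%E).
  apply: lee_sum => x _; apply: le_trans (cmod_site_trace x zK) _.
  by rewrite [leRHS]EFinM [(L + _)%:E]EFinD lee_wpmul2l ?lee_fin // leeD.
by rewrite sumEFin sumr_const card_ord lee_fin -[leLHS]mulr_natl mulrA.
Qed.

End Wegner.

(** * Gaussian increments *)

Section Density.
Context {d : measure_display} {T : measurableType d} {R : realType}.
Variables (mu nu : {measure set T -> \bar R}) (p : T -> R).
Hypotheses (mp : measurable_fun setT p) (p0 : forall x, 0 <= p x).
Hypothesis nuE : forall A, measurable A -> (nu A = \int[mu]_(x in A) (p x)%:E)%E.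

Import HBNNSimple.

Let integral_density_nnsfun (f : {nnsfun T >-> R}) :
  (\int[nu]_x (f x)%:E = \int[mu]_x ((f x)%:E * (p x)%:E))%E.
Proof.
under [LHS]eq_integral do rewrite fimfunE -fsumEFin//.
rewrite [LHS]ge0_integral_fsum//; last 2 first.
- by move=> r; exact/measurable_EFinP/measurableT_comp.
- by move=> r x _; rewrite EFinM nnfun_muleindic_ge0.
under [RHS]eq_integral.
  move=> x _; rewrite fimfunE -fsumEFin// ge0_mule_fsuml; last first.
    by move=> r; rewrite EFinM nnfun_muleindic_ge0.
  over.
rewrite [RHS]ge0_integral_fsum//; last 2 first.
- move=> r; apply: emeasurable_funM; last exact/measurable_EFinP.
  by apply/measurable_EFinP/measurableT_comp.
- move=> r x _; rewrite mule_ge0 //; last by rewrite lee_fin.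
  by rewrite EFinM nnfun_muleindic_ge0.
apply: eq_fsbigr => r _.
have [r0|r0] := leP 0 r; last first.
  rewrite preimage_nnfun0 //.
  by rewrite !integral0_eq // => x _; rewrite indic0 mulr0 ?mul0e.
have mfr : measurable (f @^-1` [set r]) by [].
under eq_integral do rewrite EFinM.
rewrite ge0_integralZl ?lee_fin //; last first.
  by apply/measurable_EFinP; exact: measurable_indic.
rewrite integral_indic // setIT nuE //.
under [RHS]eq_integral do rewrite EFinM -muleA.
rewrite ge0_integralZl ?lee_fin //; last 2 first.
- apply: emeasurable_funM; last exact/measurable_EFinP.
  by apply/measurable_EFinP; exact: measurable_indic.
- by move=> x _; rewrite mule_ge0 ?lee_fin.
congr (_ * _)%E; rewrite [LHS]integral_mkcond; apply: eq_integral => x _.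
by rewrite epatch_indic muleC.
Qed.

(** From sets to simple functions by linearity, then to nonnegative functions by monotone
    convergence. *)
Lemma integral_density (f : T -> \bar R) :
  measurable_fun setT f -> (forall x, 0 <= f x)%E ->
  (\int[nu]_x f x = \int[mu]_x (f x * (p x)%:E))%E.
Proof.
move=> mf f0.
pose f_ := nnsfun_approx measurableT mf.
transitivity (lim (\int[nu]_x (f_ n x)%:E @[n --> \oo])%E).
  rewrite -monotone_convergence//=.
  - apply: eq_integral => ? /[!inE] xD; apply/esym/cvg_lim => //=.
    exact: cvg_nnsfun_approx.
  - by move=> n; exact/measurable_EFinP/measurable_funTS.
  - by move=> n ? _; rewrite lee_fin.
  - by move=> ? _ ? ? mn; rewrite lee_fin; exact/lefP/nd_nnsfun_approx.
under eq_fun do rewrite integral_density_nnsfun.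
rewrite -monotone_convergence//=.
- apply: eq_integral => x _; apply/cvg_lim => //=.
  apply: cvgeZr => //; exact: cvg_nnsfun_approx.
- by move=> n; apply: emeasurable_funM; apply/measurable_EFinP => //; exact/measurable_funTS.
- by move=> n x _; rewrite mule_ge0 ?lee_fin.
- move=> x _ m n mn; rewrite lee_wpmul2r ?lee_fin //.
  by exact/lefP/nd_nnsfun_approx.
Qed.

End Density.

Section GaussianMoments.
Context {R : realType}.
Variable s : R.
Hypothesis s0 : 0 < s.
Notation mu := (@lebesgue_measure R).
Notation nu := (normal_prob 0 (Num.sqrt s)).

Let sq0 : Num.sqrt s != 0 :> R.
Proof. by rewrite gt_eqF // sqrtr_gt0. Qed.

Lemma normal_pdf_sqrt (t x : R) : 0 < t ->
  normal_pdf 0 (Num.sqrt t) x = (Num.sqrt (t * pi *+ 2))^-1 * expR (- (x ^+ 2) / (t *+ 2)).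
Proof.
move=> t0; rewrite normal_pdfE ?gt_eqF ?sqrtr_gt0 //.
by rewrite /normal_peak /normal_fun sqr_sqrtr ?subr0 // ltW.
Qed.

Lemma normal_integral (f : R -> \bar R) :
  measurable_fun setT f -> (forall x, 0 <= f x)%E ->
  (\int[nu]_x f x = \int[mu]_x (f x * (normal_pdf 0 (Num.sqrt s) x)%:E))%E.
Proof.
move=> mf f0; apply: integral_density => //.
- exact: measurable_normal_pdf.
- exact: normal_pdf_ge0.
Qed.

(* f <= c exp (x^2 / 4 s) turns the density of N(0, s) into sqrt 2 times that of N(0, 2 s). *)
Lemma normal_integral_le (f : R -> R) (c : R) :
  measurable_fun setT f -> (forall x, 0 <= f x) -> 0 <= c ->
  (forall x, f x <= c * expR (x ^+ 2 / (s *+ 4))) ->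
  (\int[nu]_x (f x)%:E <= (2 * c)%:E)%E.
Proof.
move=> mf f0 c0 fc; rewrite normal_integral //; last exact/measurable_EFinP.
pose q := normal_pdf 0 (Num.sqrt (s *+ 2)).
have s20 : 0 < s *+ 2 by rewrite pmulrn_lgt0.
apply: (@le_trans _ _ (\int[mu]_x ((2 * c)%:E * (q x)%:E))%E); last first.
  rewrite ge0_integralZl //.
  - by rewrite integral_normal_pdf mule1.
  - by apply/measurable_EFinP; exact: measurable_normal_pdf.
  - by move=> x _; rewrite lee_fin normal_pdf_ge0.
  - by rewrite lee_fin mulr_ge0.
apply: ge0_le_integral => //.
- by move=> x _; rewrite mule_ge0 ?lee_fin ?normal_pdf_ge0.
- by apply: emeasurable_funM; apply/measurable_EFinP => //; exact: measurable_normal_pdf.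
- by apply: emeasurable_funM; apply/measurable_EFinP => //; exact: measurable_normal_pdf.
- move=> x _; rewrite -!EFinM lee_fin /q !normal_pdf_sqrt //.
  apply: (@le_trans _ _ (c * expR (x ^+ 2 / (s *+ 4)) *
    ((Num.sqrt (s * pi *+ 2))^-1 * expR (- (x ^+ 2) / (s *+ 2))))).
    by rewrite ler_wpM2r // mulr_ge0 ?expR_ge0 // invr_ge0 sqrtr_ge0.
  have -> : c * expR (x ^+ 2 / (s *+ 4)) *
    ((Num.sqrt (s * pi *+ 2))^-1 * expR (- (x ^+ 2) / (s *+ 2))) =
    c * (Num.sqrt (s * pi *+ 2))^-1 * expR (- (x ^+ 2) / (s *+ 2 *+ 2)).
    have -> : - (x ^+ 2) / (s *+ 2 *+ 2) = x ^+ 2 / (s *+ 4) + - (x ^+ 2) / (s *+ 2).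
      by field; rewrite gt_eqF.
    by rewrite expRD; ring.
  rewrite mulrA ler_wpM2r ?expR_ge0 // [2 * c]mulrC -mulrA ler_wpM2l //.
  have -> : s *+ 2 * pi *+ 2 = 2 * (s * pi *+ 2) by ring.
  rewrite sqrtrM // invfM mulrA -[leLHS]mul1r ler_wpM2r ?invr_ge0 ?sqrtr_ge0 //.
  rewrite ler_pdivlMr ?sqrtr_gt0 // mul1r.
  have -> : (2 : R) = Num.sqrt (2 ^+ 2) by rewrite sqrtr_sqr ger0_norm.
  by rewrite ler_sqrt ?sqrtr_sqr ?ger0_norm //; lra.
Qed.

(** With $y=x^2/(4s)$ this is $y\le e^y$ inserted into [normal_integral_le]. The resulting 8 is the
    source of the factors 16 and 8 in [trace_displacement]. *)
Lemma normal_moment2 : (\int[nu]_x (x ^+ 2)%:E <= (8 * s)%:E)%E.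
Proof.
rewrite (_ : 8 * s = 2 * (4 * s)); last by ring.
apply: normal_integral_le => //.
- by move=> x; exact: sqr_ge0.
- by rewrite mulr_ge0 // ltW.
move=> x; have y0 : 0 <= x ^+ 2 / (s *+ 4) by rewrite divr_ge0 ?sqr_ge0 // mulrn_wge0 // ltW.
have h : x ^+ 2 / (s *+ 4) <= expR (x ^+ 2 / (s *+ 4)).
  by apply: le_trans (expR_ge1Dx _); rewrite lerDr.
have s40 : 0 < 4 * s by rewrite mulr_gt0.
apply: le_trans (ler_wpM2l (ltW s40) h); rewrite le_eqVlt; apply/orP; left.
by apply/eqP; field; rewrite gt_eqF.
Qed.

(** With $y=x^2/(4s)$, $x^4=64s^2(y/2)^2$ and $(y/2)^2\le e^y$. What matters later is the order
    $s^2$. *)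
Lemma normal_moment4 : (\int[nu]_x (x ^+ 4)%:E <= (128 * s ^+ 2)%:E)%E.
Proof.
rewrite (_ : 128 * s ^+ 2 = 2 * (64 * s ^+ 2)); last by ring.
apply: normal_integral_le => //.
- by move=> x; exact: exprn_even_ge0.
- by rewrite mulr_ge0 // sqr_ge0.
move=> x; set y := x ^+ 2 / (s *+ 4).
have y0 : 0 <= y by rewrite divr_ge0 ?sqr_ge0 // mulrn_wge0 // ltW.
have h : (y / 2) ^+ 2 <= expR y.
  have -> : expR y = expR (y / 2) ^+ 2 by rewrite expr2 -expRD; congr expR; field.
  have y20 : 0 <= y / 2 by rewrite divr_ge0.
  rewrite ler_pXn2r ?nnegrE ?expR_ge0 //.
  by apply: le_trans (expR_ge1Dx _); rewrite lerDr.
have s60 : 0 <= 64 * s ^+ 2 by rewrite mulr_ge0 // sqr_ge0.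
apply: le_trans (ler_wpM2l s60 h); rewrite le_eqVlt; apply/orP; left.
by apply/eqP; rewrite /y; field; rewrite gt_eqF.
Qed.

(** The density is even; [gauss_mean] deduces from this that $X$ and $-X$ have the same expectation,
    hence mean zero. *)
Lemma normal_probN (A : set R) : measurable A ->
  nu ((-%R : R -> R) @^-1` A) = nu A.
Proof.
move=> mA; have mN : measurable_fun [set: R] (-%R : R -> measurableTypeR R).
  exact: oppr_measurable.
have mNA : measurable ((-%R : R -> R) @^-1` A) by rewrite -[X in measurable X]setTI; exact: mN.
rewrite /normal_prob.
pose f (x : R) := ((normal_pdf 0 (Num.sqrt s) x)%:E : \bar R).
have mf : measurable_fun [set: R] f.
  by apply/measurable_EFinP; exact: measurable_normal_pdf.
have f0 x : (0 <= f x)%E by rewrite lee_fin normal_pdf_ge0.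
transitivity (\int[pushforward mu (-%R : R -> measurableTypeR R)]_(x in A) f x)%E.
  rewrite ge0_integral_pushforward; [|exact: mN|exact: mA|exact: measurable_funTS|by move=> x _].
  apply: eq_integral => x _; rewrite /f /= !normal_pdf_sqrt //.
  by rewrite sqrrN.
by apply: eq_measure_integral => B mB _; exact: lebesgue_measureN.
Qed.

End GaussianMoments.

Section GaussianVariable.
Context {R : realType} {d : measure_display} {Omega : measurableType d}.
Variables (P : probability Omega R) (X : Omega -> R) (s : R).
Hypotheses (mX : measurable_fun setT X) (s0 : 0 < s).
Hypothesis lawX : forall A : set R, measurable A ->
  P (X @^-1` A) = normal_prob 0 (Num.sqrt s) A.

Let mX' : measurable_fun setT (X : Omega -> measurableTypeR R).
Proof. exact: mX. Qed.

Let X_ : {mfun Omega >-> measurableTypeR R} :=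
  HB.pack (X : Omega -> measurableTypeR R) (isMeasurableFun.Build _ _ _ _ _ mX').

Lemma law_integral (f : R -> R) : measurable_fun setT f -> (forall x, 0 <= f x) ->
  (\int[P]_w (f (X w))%:E = \int[normal_prob 0 (Num.sqrt s)]_x (f x)%:E)%E.
Proof.
move=> mf f0; transitivity (\int[distribution P X_]_x (f x)%:E)%E.
  by rewrite ge0_integral_pushforward //; [exact/measurable_EFinP|move=> x _; rewrite lee_fin].
by apply: eq_measure_integral => A mA _; exact: lawX.
Qed.

Lemma gauss_moment2 : (\int[P]_w (X w ^+ 2)%:E <= (8 * s)%:E)%E.
Proof.
rewrite (law_integral (f := fun x => x ^+ 2)) => [|//|x]; last exact: sqr_ge0.
exact: normal_moment2.
Qed.

Lemma gauss_moment4 : (\int[P]_w (X w ^+ 4)%:E <= (128 * s ^+ 2)%:E)%E.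
Proof.
rewrite (law_integral (f := fun x => x ^+ 4)) => [|//|x]; last exact: exprn_even_ge0.
exact: normal_moment4.
Qed.

Lemma gauss_integrable2 : P.-integrable setT (fun w => (X w ^+ 2)%:E).
Proof.
apply/integrableP; split; first by apply/measurable_EFinP; exact: measurable_funX.
under eq_integral do rewrite gee0_abs ?lee_fin ?sqr_ge0 //.
by rewrite (le_lt_trans gauss_moment2) // ltry.
Qed.

Lemma gauss_integrable : P.-integrable setT (EFin \o X).
Proof.
have I1 : P.-integrable setT (fun w => (1 + X w ^+ 2)%:E).
  exact: (integrableD measurableT (finite_measure_integrable_cst P 1 measurableT)
    gauss_integrable2).
apply: le_integrable I1 => //; first exact/measurable_EFinP.
move=> w _; rewrite !abse_EFin lee_fin [leRHS]ger0_norm ?addr_ge0 ?sqr_ge0 //.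
have := sqr_ge0 (`|X w| - 1); rewrite sqrrB1 real_normK ?num_real //.
by have := sqr_ge0 (`|X w|); rewrite real_normK ?num_real //; lra.
Qed.

Lemma gauss_mean : \int[P]_w X w = 0.
Proof.
have mN : measurable_fun setT ((\- X) : Omega -> measurableTypeR R).
  exact: (measurable_funN mX).
pose Y_ : {mfun Omega >-> measurableTypeR R} :=
  HB.pack ((\- X) : Omega -> measurableTypeR R) (isMeasurableFun.Build _ _ _ _ _ mN).
have e1 : (\int[distribution P X_]_x x%:E = \int[P]_w (X w)%:E)%E.
  by rewrite integral_pushforward //; exact: gauss_integrable.
have e2 : (\int[distribution P Y_]_x x%:E = \int[P]_w (- X w)%:E)%E.
  rewrite integral_pushforward //.
  have := integrableN gauss_integrable.
  by congr (_.-integrable _ _).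
have e : \int[P]_w X w = \int[P]_w (- X w).
  rewrite /Rintegral -e1 -e2; congr fine; apply: eq_measure_integral => A mA _.
  rewrite [LHS]lawX // -normal_probN //; apply/esym/lawX.
  rewrite -[X in measurable X]setTI; exact: oppr_measurable.
have : \int[P]_w (- X w) = -1 * \int[P]_w X w.
  rewrite -RintegralZl //; last exact: gauss_integrable.
  by apply: eq_Rintegral => w _; rewrite mulN1r.
rewrite -e; lra.
Qed.

End GaussianVariable.

Section Expectation.
Context {R : realType} {d : measure_display} {Omega : measurableType d}.
Variable P : probability Omega R.
Implicit Types (f g : Omega -> R) (c : R).

Definition rint f := P.-integrable setT (EFin \o f).
Definition expect f : R := \int[P]_w f w.

Lemma rint_measurable f : rint f -> measurable_fun setT f.
Proof. by move=> /integrableP[/measurable_EFinP]. Qed.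

Lemma rint_bounded f c : measurable_fun setT f -> (forall w, `|f w| <= c) -> rint f.
Proof.
move=> mf fc; apply: (@le_integrable _ _ _ P setT measurableT _ (EFin \o cst c)).
- exact/measurable_EFinP.
- by move=> w _; rewrite !abse_EFin lee_fin (le_trans (fc w)) // ler_norm.
- exact: finite_measure_integrable_cst.
Qed.

Lemma rint_le f g : measurable_fun setT f -> rint g -> (forall w, `|f w| <= g w) -> rint f.
Proof.
move=> mf Ig fg; apply: (le_integrable measurableT _ _ Ig); first exact/measurable_EFinP.
by move=> w _; rewrite !abse_EFin lee_fin (le_trans (fg w)) // ler_norm.
Qed.

Lemma rint_cst c : rint (fun=> c).
Proof. exact: finite_measure_integrable_cst. Qed.

Lemma rintD f g : rint f -> rint g -> rint (fun w => f w + g w).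
Proof. by move=> If Ig; exact: (integrableD measurableT If Ig). Qed.

Lemma rintZ c f : rint f -> rint (fun w => c * f w).
Proof. by move=> If; exact: (integrableZl measurableT c If). Qed.

Lemma rintN f : rint f -> rint (fun w => - f w).
Proof. by move=> If; exact: (integrableN If). Qed.

Lemma rintB f g : rint f -> rint g -> rint (fun w => f w - g w).
Proof. by move=> If Ig; apply: rintD => //; exact: rintN. Qed.

Lemma rint_sum (I : Type) (r : seq I) (F : I -> Omega -> R) :
  (forall i, rint (F i)) -> rint (fun w => \sum_(i <- r) F i w).
Proof.
move=> h; elim: r => [|i r IH].
  by under [X in rint X]eq_fun do rewrite big_nil; exact: rint_cst.
by under [X in rint X]eq_fun do rewrite big_cons; exact: rintD.
Qed.

Lemma rint_bM f g c : measurable_fun setT f -> (forall w, `|f w| <= c) -> rint g ->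
  rint (fun w => f w * g w).
Proof.
move=> mf fc Ig.
have Ig' : rint (fun w => c * `|g w|) by apply: rintZ; exact: (integrable_abse Ig).
apply: rint_le Ig' _; first by apply: measurable_funM => //; exact: rint_measurable.
by move=> w; rewrite normrM ler_wpM2r.
Qed.

Lemma expectD f g : rint f -> rint g ->
  expect (fun w => f w + g w) = expect f + expect g.
Proof. by move=> If Ig; exact: RintegralD. Qed.

Lemma expectZ c f : rint f -> expect (fun w => c * f w) = c * expect f.
Proof. by move=> If; exact: RintegralZl. Qed.

Lemma expectN f : rint f -> expect (fun w => - f w) = - expect f.
Proof.
move=> If; rewrite -mulN1r -expectZ //.
by congr expect; apply/funext => w; rewrite mulN1r.
Qed.

Lemma expectB f g : rint f -> rint g ->
  expect (fun w => f w - g w) = expect f - expect g.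
Proof. by move=> If Ig; exact: RintegralB. Qed.

Lemma expect_cst c : expect (fun=> c) = c.
Proof. by rewrite /expect Rintegral_cst // [X in fine X](probability_setT P) mulr1. Qed.

Lemma expect_sum (I : Type) (r : seq I) (F : I -> Omega -> R) :
  (forall i, rint (F i)) ->
  expect (fun w => \sum_(i <- r) F i w) = \sum_(i <- r) expect (F i).
Proof.
move=> h; elim: r => [|i r IH].
  rewrite big_nil; under [X in expect X]eq_fun do rewrite big_nil.
  exact: expect_cst.
rewrite big_cons -IH -expectD //; last exact: rint_sum.
by congr expect; apply/funext => w; rewrite big_cons.
Qed.

Lemma expect_le f g : rint f -> rint g -> (forall w, f w <= g w) -> expect f <= expect g.
Proof. by move=> If Ig fg; apply: le_Rintegral. Qed.

Lemma expect_EFin f : rint f -> (\int[P]_w (f w)%:E = (expect f)%:E)%E.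
Proof. by move=> If; rewrite /expect /Rintegral fineK //; exact: integrable_fin_num. Qed.

Lemma expect_le_ereal f c : rint f -> (\int[P]_w (f w)%:E <= c%:E)%E -> expect f <= c.
Proof. by move=> If; rewrite expect_EFin. Qed.

Lemma expect_ge0 f : (forall w, 0 <= f w) -> 0 <= expect f.
Proof. by move=> f0; apply: Rintegral_ge0 => w _. Qed.

Lemma rint_ge0_bounded f c : measurable_fun setT f -> (forall w, 0 <= f w) ->
  (\int[P]_w (f w)%:E <= c%:E)%E -> rint f.
Proof.
move=> mf f0 h; apply/integrableP; split; first exact/measurable_EFinP.
under eq_integral do rewrite gee0_abs ?lee_fin //.
by rewrite (le_lt_trans h) // ltry.
Qed.

End Expectation.

(** * One step of the flow *)

Section MatrixBounds.
Context {R : realType} {n : nat}.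
Implicit Types (A B : 'M[R[i]]_n) (W : 'M[R]_n).
Local Notation toC := (map_mx (real_complex R)).

(** A crude size of the increment, used only in remainders that vanish with the mesh, where losses
    in $N$ do no harm. *)
Definition abs_sum W : R := \sum_i \sum_j `|W i j|.

Definition mxbound A (a : R) := forall i j, cmod (A i j) <= a.

Lemma abs_sum_ge0 W : 0 <= abs_sum W.
Proof. by rewrite sumr_ge0 // => i _; rewrite sumr_ge0. Qed.

Lemma mxbound_sandwich A B W a b : mxbound A a -> mxbound B b ->
  mxbound (A *m toC W *m B) (a * abs_sum W * b).
Proof.
move=> hA hB i j; rewrite mxE; under eq_bigr do rewrite mxE mulr_suml.
rewrite exchange_big /=; apply: le_trans (cmod_sum _ _ _) _.
rewrite /abs_sum mulr_sumr mulr_suml; apply: ler_sum => k _.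
apply: le_trans (cmod_sum _ _ _) _; rewrite mulr_sumr mulr_suml; apply: ler_sum => l _.
rewrite mxE !cmodM cmod_real; apply: ler_pM; rewrite ?mulr_ge0 ?cmod_ge0 //.
by rewrite ler_wpM2r.
Qed.

Lemma mxbound_trace A a : mxbound A a -> cmod (\tr A) <= n%:R * a.
Proof.
move=> hA; apply: le_trans (cmod_sum _ _ _) _.
apply: (@le_trans _ _ (\sum_(i < n) a)); first by apply: ler_sum => i _; exact: hA.
by rewrite sumr_const card_ord [leRHS]mulr_natl.
Qed.

Lemma trace_mulmx A B : \tr (A *m B) = \sum_i \sum_j A j i * B i j.
Proof.
by rewrite /mxtrace exchange_big /=; apply: eq_bigr => i _; rewrite mxE.
Qed.

Lemma trace_linear A W :
  \tr (A *m toC W *m A) = \sum_i \sum_j (A *m A) j i * (W i j)%:C%C.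
Proof.
rewrite mxtrace_mulC mulmxA trace_mulmx.
by apply: eq_bigr => i _; apply: eq_bigr => j _; rewrite [toC W _ _]mxE.
Qed.

Lemma trace_quadratic A W :
  \tr (A *m toC W *m A *m toC W *m A) =
  \sum_j \sum_l \sum_i \sum_k ((A *m A) l i * A j k) * (W i j * W k l)%:C%C.
Proof.
rewrite mxtrace_mulC !mulmxA -[_ *m A *m toC W]mulmxA trace_mulmx.
apply: eq_bigr => j _; apply: eq_bigr => l _.
rewrite [(_ *m toC W) l j]mxE mulr_suml; apply: eq_bigr => i _.
rewrite [(A *m toC W) j l]mxE mulr_sumr; apply: eq_bigr => k _.
by rewrite [toC W i j]mxE [toC W k l]mxE rmorphM /=; ring.
Qed.

(** The two pairings of a real symmetric Gaussian matrix: $W_{ij}$ is correlated with $W_{kl}$ when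
    the index pairs coincide directly or after transposition. *)
Lemma pairing_sum (F : 'I_n -> 'I_n -> 'I_n -> 'I_n -> R) :
  \sum_j \sum_l \sum_i \sum_k
    F i j k l * (((i, j) == (k, l))%:R + ((i, j) == (l, k))%:R) =
  \sum_j \sum_i (F i j i j + F i j j i).
Proof.
apply: eq_bigr => j _.
transitivity (\sum_l \sum_i \sum_k F i j k l * ((i, j) == (k, l))%:R +
              \sum_l \sum_i \sum_k F i j k l * ((i, j) == (l, k))%:R).
  rewrite -big_split; apply: eq_bigr => l _; rewrite -big_split; apply: eq_bigr => i _.
  by rewrite -big_split; apply: eq_bigr => k _; rewrite mulrDr.
rewrite big_split /=; congr (_ + _).
  rewrite (bigD1 j) //= [X in _ + X]big1 => [|l lj]; last first.
    rewrite big1 // => i _; rewrite big1 // => k _.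
    by rewrite xpair_eqE (eq_sym j) (negbTE lj) andbF mulr0.
  rewrite addr0; apply: eq_bigr => i _.
  rewrite (bigD1 i) //= big1 => [|k ki]; last first.
    by rewrite xpair_eqE (eq_sym i) (negbTE ki) mulr0.
  by rewrite eqxx mulr1 addr0.
apply: eq_bigr => l _; rewrite (bigD1 l) //= [X in _ + X]big1 => [|i il]; last first.
  by rewrite big1 // => k _; rewrite xpair_eqE (negbTE il) mulr0.
rewrite (bigD1 j) //= big1 => [|k kj]; last first.
  by rewrite xpair_eqE (eq_sym j) (negbTE kj) andbF mulr0.
by rewrite eqxx mulr1 !addr0.
Qed.

End MatrixBounds.

(** * Quadratic variation and drift of the trace over one increment *)

Section Step.
Context {R : realType} {d : measure_display} {Omega : measurableType d}.
Variable P : probability Omega R.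
Variables (N : nat) (A W : Omega -> 'M[R]_N) (z : R[i]) (u : Omega -> R[i]).
Variables (m2 m4 : R) (pm : (Omega -> R) -> Prop).
Hypotheses (sA : forall w, (A w)^T = A w) (sW : forall w, (W w)^T = W w).
Hypotheses (mA : forall i j, measurable_fun setT (fun w => A w i j))
           (mW : forall i j, measurable_fun setT (fun w => W w i j)).
Hypotheses (z0 : 0 < Im z) (m20 : 0 <= m2).
Hypotheses (mu : cmeasurable u) (u1 : forall w, cmod (u w) <= 1).
(* pm singles out the observables of the past; the increment W is only known through its
   first two moments against these and through m4. *)
Hypothesis rW1 : forall phi c i j, pm phi -> (forall w, `|phi w| <= c) ->
  rint P (fun w => phi w * W w i j).
Hypothesis EW1 : forall phi c i j, pm phi -> (forall w, `|phi w| <= c) ->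
  expect P (fun w => phi w * W w i j) = 0.
Hypothesis rW2 : forall phi c i j k l, pm phi -> (forall w, `|phi w| <= c) ->
  rint P (fun w => phi w * (W w i j * W w k l)).
Hypothesis EW2 : forall phi c i j k l, pm phi -> (forall w, `|phi w| <= c) ->
  expect P (fun w => phi w * (W w i j * W w k l)) =
  m2 / N%:R * (((i, j) == (k, l))%:R + ((i, j) == (l, k))%:R) * expect P phi.
Hypothesis rW4 : rint P (fun w => abs_sum (W w) ^+ 4).
Hypothesis EW4 : expect P (fun w => abs_sum (W w) ^+ 4) <= m4.

Local Notation toC := (map_mx (real_complex R)).
Let G w := resolvent (A w) z.
Let X w := G w *m G w.
Let G' w := resolvent (A w + W w) z.
Let tau w := \tr (G w).
Let tau' w := \tr (G' w).
Let e : R := (Im z)^-1.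

(** The coefficients met by the expansion: [pm1] in the first-order term, [pm2] in the second-order
    term, [pmR] and [pmI] in the squared modulus of the first-order term, split into real and
    imaginary parts because [W] is real. *)
Hypothesis pm1 : forall i j, pm (fun w => Re (u w * X w i j)).
Hypothesis pm2 : forall i j k l, pm (fun w => Re (u w * (X w l i * G w j k))).
Hypothesis pmR : forall i j k l, pm (fun w => Re (X w j i) * Re (X w l k)).
Hypothesis pmI : forall i j k l, pm (fun w => Im (X w j i) * Im (X w l k)).

Let e0 : 0 <= e. Proof. by rewrite invr_ge0 ltW. Qed.

Let sAW w : (A w + W w)^T = A w + W w.
Proof. by rewrite linearD /= sA sW. Qed.

Let cG w : mxbound (G w) e.
Proof. by move=> i j; exact: cmod_resolvent. Qed.

Let cG' w : mxbound (G' w) e.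
Proof. by move=> i j; exact: cmod_resolvent. Qed.

Let cX w i j : cmod (X w i j) <= N%:R * e ^+ 2.
Proof.
rewrite mxE; apply: le_trans (cmod_sum _ _ _) _.
apply: (@le_trans _ _ (\sum_(k < N) e ^+ 2)).
  by apply: ler_sum => k _; rewrite cmodM expr2 ler_pM ?cmod_ge0 //; exact: cG.
by rewrite sumr_const card_ord [leRHS]mulr_natl.
Qed.

(** Two expansions are kept. For the quadratic variation $\tau'-\tau$ is [rest] minus [lin], where
    [rest] is of second order and is squared afterwards; for the drift the second-order term is
    needed exactly, so [rest] is split into [quad] minus [cubic]. *)
Let quad w := \tr (G w *m toC (W w) *m G w *m toC (W w) *m G w).
Let cubic w := \tr (G w *m toC (W w) *m G w *m toC (W w) *m G w *m toC (W w) *m G' w).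
Let lin w := \tr (G w *m toC (W w) *m G w).
Let rest w := \tr (G w *m toC (W w) *m G w *m toC (W w) *m G' w).

Let tau_diff2 w : tau' w - tau w = rest w - lin w.
Proof.
by rewrite /tau' /tau -raddfB /= resolvent_diff2 // raddfD raddfN /= addrC.
Qed.

Let tau_diff3 w : tau' w - tau w = quad w - cubic w - lin w.
Proof.
rewrite tau_diff2; congr (_ - _); rewrite /rest /quad /cubic -raddfB /=.
congr (\tr _); rewrite -!mulmxA -!mulmxBr; do 4 congr (_ *m _).
apply/eqP; rewrite -subr_eq0 opprB addrCA -/(G w).
have := resolvent_diff (sA w) (sW w) z0; rewrite -/(G w) -/(G' w) => h.
by rewrite h mulmxA addrN.
Qed.

Let Gcm i j : cmeasurable (fun w => G w i j).
Proof. exact: cmeasurable_resolvent. Qed.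

Let G'cm i j : cmeasurable (fun w => G' w i j).
Proof.
apply: cmeasurable_resolvent => // a b.
by under eq_fun do rewrite mxE; exact: measurable_funD.
Qed.

Let Xcm i j : cmeasurable (fun w => X w i j).
Proof. exact: cmeasurable_mulmx. Qed.

Let Wcm i j : cmeasurable (fun w => toC (W w) i j).
Proof. by under [Z in cmeasurable Z]eq_fun do rewrite mxE; exact: cmeasurable_real. Qed.

Let cubiccm : cmeasurable cubic.
Proof.
apply: cmeasurable_trace; do 6 (apply: cmeasurable_mulmx => //).
Qed.

Let taucm : cmeasurable tau.
Proof. exact: cmeasurable_trace. Qed.

Let tau'cm : cmeasurable tau'.
Proof. exact: cmeasurable_trace. Qed.

Let rest_le w : cmod (rest w) <= N%:R * e ^+ 3 * abs_sum (W w) ^+ 2.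
Proof.
rewrite (_ : _ * _ = N%:R * (e * abs_sum (W w) * e * abs_sum (W w) * e)); last by ring.
by apply: mxbound_trace; do 2 (apply: mxbound_sandwich => //).
Qed.

Let cubic_le w : cmod (cubic w) <= N%:R * e ^+ 4 * abs_sum (W w) ^+ 3.
Proof.
rewrite (_ : _ * _ =
  N%:R * (e * abs_sum (W w) * e * abs_sum (W w) * e * abs_sum (W w) * e)); last by ring.
by apply: mxbound_trace; do 3 (apply: mxbound_sandwich => //).
Qed.

Let tau_le w : cmod (tau w) <= N%:R * e.
Proof. exact: mxbound_trace. Qed.

Let tau'_le w : cmod (tau' w) <= N%:R * e.
Proof. exact: mxbound_trace. Qed.

Definition mean_Im := expect P (fun w => Im (tau w)).
Definition mean_sqr := expect P (fun w => cmod (tau w) ^+ 2).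

Section QuadraticForm.
Variables (F : 'I_N -> 'I_N -> 'I_N -> 'I_N -> Omega -> R) (c : R).
Hypotheses (pmF : forall i j k l, pm (F i j k l)) (Fc : forall i j k l w, `|F i j k l w| <= c).
Hypothesis mF : forall i j k l, measurable_fun setT (F i j k l).

Let Q w := \sum_j \sum_l \sum_i \sum_k F i j k l w * (W w i j * W w k l).

Let rterm i j k l : rint P (fun w => F i j k l w * (W w i j * W w k l)).
Proof. exact: rW2. Qed.

Lemma rint_quadratic : rint P Q.
Proof. by do 4 (apply: rint_sum => ?). Qed.

Let rF i j k l : rint P (F i j k l).
Proof. exact: rint_bounded. Qed.

Lemma expect_quadratic : expect P Q =
  m2 / N%:R * expect P (fun w => \sum_j \sum_i (F i j i j w + F i j j i w)).
Proof.
have r4 j l i := rint_sum (index_enum 'I_N) (rterm i j ^~ l).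
rewrite /Q expect_sum; last by move=> ?; do 3 (apply: rint_sum => ?).
have -> : expect P (fun w => \sum_j \sum_i (F i j i j w + F i j j i w)) =
          \sum_j \sum_i (expect P (F i j i j) + expect P (F i j j i)).
  rewrite expect_sum; last by move=> j; apply: rint_sum => i; exact: rintD.
  apply: eq_bigr => j _; rewrite expect_sum; last by move=> i; exact: rintD.
  by apply: eq_bigr => i _; rewrite expectD.
rewrite -(pairing_sum (fun i j k l => expect P (F i j k l))) mulr_sumr.
apply: eq_bigr => j _; rewrite expect_sum; last by move=> ?; do 2 (apply: rint_sum => ?).
rewrite mulr_sumr; apply: eq_bigr => l _.
rewrite expect_sum; last by move=> ?; apply: rint_sum => ?.
rewrite mulr_sumr; apply: eq_bigr => i _; rewrite expect_sum //.
rewrite mulr_sumr; apply: eq_bigr => k _.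
by rewrite (EW2 _ _ _ _ (pmF i j k l) (Fc i j k l)) -!mulrA; congr (_ * (_ * _)); rewrite mulrC.
Qed.

End QuadraticForm.

Let linE w : lin w = \sum_i \sum_j X w j i * (W w i j)%:C%C.
Proof. exact: trace_linear. Qed.

Let Xsym w i j : X w i j = X w j i.
Proof.
rewrite /X -[in LHS](trmxK (G w *m G w)) mxE trmx_mul.
by rewrite (resolvent_sym z (sA w)).
Qed.

Let cXb := N%:R * e ^+ 2.

Let ReX w i j : `|Re (X w i j)| <= cXb.
Proof. exact: le_trans (Re_le_cmod _) (cX w i j). Qed.

Let ImX w i j : `|Im (X w i j)| <= cXb.
Proof. exact: le_trans (Im_le_cmod _) (cX w i j). Qed.

Let ReXm i j : measurable_fun setT (fun w => Re (X w i j)).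
Proof. by case: (Xcm i j). Qed.

Let ImXm i j : measurable_fun setT (fun w => Im (X w i j)).
Proof. by case: (Xcm i j). Qed.

Let lin_part (f : R[i] -> R) w : (f = @Re R \/ f = @Im R) -> f (lin w) ^+ 2 =
  \sum_j \sum_l \sum_i \sum_k (f (X w j i) * f (X w l k)) * (W w i j * W w k l).
Proof.
move=> hf; have -> : f (lin w) = \sum_j \sum_i f (X w j i) * W w i j.
  rewrite exchange_big /= linE; case: hf => ->.
    rewrite Re_sum; apply: eq_bigr => i _; rewrite Re_sum; apply: eq_bigr => j _.
    by rewrite mulrC ReZ mulrC.
  rewrite Im_sum; apply: eq_bigr => i _; rewrite Im_sum; apply: eq_bigr => j _.
  by rewrite mulrC ImZ mulrC.
rewrite expr2 mulr_suml; apply: eq_bigr => j _.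
rewrite mulr_sumr; apply: eq_bigr => l _.
rewrite mulr_suml; apply: eq_bigr => i _.
rewrite mulr_sumr; apply: eq_bigr => k _; ring.
Qed.

Let lin_sqr w : cmod (lin w) ^+ 2 =
  (\sum_j \sum_l \sum_i \sum_k (Re (X w j i) * Re (X w l k)) * (W w i j * W w k l)) +
  (\sum_j \sum_l \sum_i \sum_k (Im (X w j i) * Im (X w l k)) * (W w i j * W w k l)).
Proof. by rewrite cmod_sqr (lin_part w (or_introl erefl)) (lin_part w (or_intror erefl)). Qed.

Let XX_le (f : Omega -> 'I_N -> 'I_N -> R) : (forall w i j, `|f w i j| <= cXb) ->
  forall i j k l w, `|f w j i * f w l k| <= cXb * cXb.
Proof. by move=> h i j k l w; rewrite normrM ler_pM. Qed.

Let rint_lin : rint P (fun w => cmod (lin w) ^+ 2).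
Proof.
under [Z in rint P Z]eq_fun do rewrite lin_sqr.
apply: rintD.
- exact: (rint_quadratic pmR (XX_le ReX)).
- exact: (rint_quadratic pmI (XX_le ImX)).
Qed.

Let rint_Im_tau : rint P (fun w => Im (tau w)).
Proof.
apply: (@rint_bounded _ _ _ P _ (N%:R * e)); first by case: taucm.
by move=> w; exact: le_trans (Im_le_cmod _) (tau_le w).
Qed.

Let rint_sqr_tau : rint P (fun w => cmod (tau w) ^+ 2).
Proof.
apply: (@rint_bounded _ _ _ P _ ((N%:R * e) ^+ 2)).
  by apply: measurable_funX; exact: measurable_cmod.
move=> w; rewrite ger0_norm ?sqr_ge0 // lerXn2r ?nnegrE ?cmod_ge0 //.
by rewrite mulr_ge0.
Qed.

Let m2N : 0 <= m2 / N%:R.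
Proof. by rewrite divr_ge0. Qed.

(** As [X] is symmetric, both pairings contribute the same sum, together twice
    $\sum|X_{ij}|^2=\mathrm{tr}(GG\bar G\bar G)$, which [hs_sqr] bounds. *)
Let expect_lin : expect P (fun w => cmod (lin w) ^+ 2) <=
  2 * (m2 / N%:R) * (e ^+ 3 * mean_Im).
Proof.
under [Z in expect P Z]eq_fun do rewrite lin_sqr.
have hR := XX_le ReX; have hI := XX_le ImX.
have mR i j k l : measurable_fun setT (fun w => Re (X w j i) * Re (X w l k)).
  exact: measurable_funM.
have mI i j k l : measurable_fun setT (fun w => Im (X w j i) * Im (X w l k)).
  exact: measurable_funM.
rewrite expectD; last 2 first.
- exact: (rint_quadratic pmR hR).
- exact: (rint_quadratic pmI hI).
rewrite (expect_quadratic pmR hR mR) (expect_quadratic pmI hI mI) -mulrDr.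
rewrite [leRHS](_ : _ = m2 / N%:R * (2 * (e ^+ 3 * mean_Im))); last by ring.
rewrite ler_wpM2l // -expectD; last 2 first.
- apply: rint_sum => j; apply: rint_sum => i; apply: rintD; exact: rint_bounded.
- apply: rint_sum => j; apply: rint_sum => i; apply: rintD; exact: rint_bounded.
rewrite mulrA -expectZ //; apply: expect_le.
- by apply: rintD; apply: rint_sum => j; apply: rint_sum => i; apply: rintD; exact: rint_bounded.
- exact: rintZ.
- move=> w; have := hs_sqr (sA w) z0; rewrite -/(G w) -/(tau w) -/e -/(X w) => h.
  rewrite -mulrA; apply: le_trans (ler_wpM2l _ h) => //.
  rewrite -big_split mulr_sumr le_eqVlt; apply/orP; left; apply/eqP; apply: eq_bigr => j _.
  rewrite -big_split mulr_sumr; apply: eq_bigr => i _ /=.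
  by rewrite (Xsym w i j) cmod_sqr; ring.
Qed.

Lemma step_rint : rint P (fun w => cmod (tau' w - tau w) ^+ 2).
Proof.
apply: (@rint_bounded _ _ _ P _ ((N%:R * e + N%:R * e) ^+ 2)).
  by apply: measurable_funX; apply: measurable_cmod; exact: cmeasurableB.
move=> w; rewrite ger0_norm ?sqr_ge0 // lerXn2r ?nnegrE ?cmod_ge0 //.
  by rewrite addr_ge0 // mulr_ge0.
by apply: le_trans (cmodD _ _) _; rewrite cmodN lerD.
Qed.

Lemma step_quad : expect P (fun w => cmod (tau' w - tau w) ^+ 2) <=
  4 * (m2 / N%:R) * (e ^+ 3 * mean_Im) + 2 * (N%:R * e ^+ 3) ^+ 2 * m4.
Proof.
apply: (@le_trans _ _ (expect P (fun w => 2 * cmod (lin w) ^+ 2 +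
    2 * (N%:R * e ^+ 3) ^+ 2 * abs_sum (W w) ^+ 4))).
  apply: expect_le; first exact: step_rint.
    by apply: rintD; exact: rintZ.
  move=> w; rewrite tau_diff2.
  have h1 : cmod (rest w - lin w) <= cmod (rest w) + cmod (lin w).
    by apply: le_trans (cmodD _ _) _; rewrite cmodN.
  have h2 : cmod (rest w) ^+ 2 <= (N%:R * e ^+ 3) ^+ 2 * abs_sum (W w) ^+ 4.
    rewrite (exprM _ 2 2) -exprMn lerXn2r ?nnegrE ?cmod_ge0 //.
    by rewrite mulr_ge0 ?exprn_ge0 // ?abs_sum_ge0 // mulr_ge0 // exprn_ge0.
  have h3 : cmod (rest w - lin w) ^+ 2 <= (cmod (rest w) + cmod (lin w)) ^+ 2.
    by rewrite lerXn2r ?nnegrE ?addr_ge0 ?cmod_ge0.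
  have := sqr_ge0 (cmod (rest w) - cmod (lin w)).
  rewrite -[2 * _ ^+ 2 * _]mulrA; move: h2 h3; rewrite sqrrD sqrrB.
  move: ((N%:R * e ^+ 3) ^+ 2 * _) (cmod (rest w - lin w) ^+ 2) => q r.
  move: (cmod (rest w)) (cmod (lin w)) => x y; lra.
rewrite expectD ?expectZ //; [|exact: rintZ..].
apply: lerD.
  rewrite (_ : 4 * _ * _ = 2 * (2 * (m2 / N%:R) * (e ^+ 3 * mean_Im))); last by ring.
  by rewrite ler_wpM2l.
by rewrite ler_wpM2l // mulr_ge0 // sqr_ge0.
Qed.

Let u_le (x : R[i]) w b : cmod x <= b -> `|Re (u w * x)| <= b.
Proof.
move=> h; apply: le_trans (Re_le_cmod _) _; rewrite cmodM.
by apply: le_trans h; rewrite ler_piMl ?cmod_ge0.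
Qed.

Let lin_zero : expect P (fun w => Re (u w * lin w)) = 0 /\ rint P (fun w => Re (u w * lin w)).
Proof.
have E w : Re (u w * lin w) = \sum_i \sum_j Re (u w * X w j i) * W w i j.
  rewrite linE mulr_sumr Re_sum; apply: eq_bigr => i _.
  rewrite mulr_sumr Re_sum; apply: eq_bigr => j _.
  by rewrite mulrA mulrC ReZ mulrC.
have uX i j w : `|Re (u w * X w j i)| <= cXb by exact: u_le.
under [Z in expect P Z]eq_fun do rewrite E.
under [Z in rint P Z]eq_fun do rewrite E.
have r i j : rint P (fun w => Re (u w * X w j i) * W w i j) by apply: rW1 (uX i j).
split; last by apply: rint_sum => i; exact: rint_sum.
rewrite expect_sum; last by move=> i; exact: rint_sum.
rewrite big1 // => i _; rewrite expect_sum // big1 // => j _.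
exact: EW1 (uX i j).
Qed.

(** The direct pairing turns the quadratic form into $\mathrm{tr}\,G^3$, the transposed one into
    $\mathrm{tr}\,G^2\,\mathrm{tr}\,G$; these are bounded by [cmod_trGGG] and [cmod_trGG]. *)
Let quad_part : rint P (fun w => Re (u w * quad w)) /\
  expect P (fun w => Re (u w * quad w)) <= m2 / N%:R * (e ^+ 2 * mean_Im + e * mean_sqr).
Proof.
pose F i j k l w := Re (u w * (X w l i * G w j k)).
have E w : Re (u w * quad w) = \sum_j \sum_l \sum_i \sum_k F i j k l w * (W w i j * W w k l).
  rewrite /quad trace_quadratic mulr_sumr Re_sum; apply: eq_bigr => j _.
  rewrite mulr_sumr Re_sum; apply: eq_bigr => l _.
  rewrite mulr_sumr Re_sum; apply: eq_bigr => i _.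
  rewrite mulr_sumr Re_sum; apply: eq_bigr => k _.
  by rewrite mulrA mulrC ReZ mulrC.
have Fc i j k l w : `|F i j k l w| <= cXb * e.
  by apply: u_le; rewrite cmodM ler_pM ?cmod_ge0 //; exact: cG.
have mF i j k l : measurable_fun setT (F i j k l).
  by have [] : cmeasurable (fun w => u w * (X w l i * G w j k)) by do 2 apply: cmeasurableM => //.
under [Z in expect P Z]eq_fun do rewrite E.
under [Z in rint P Z]eq_fun do rewrite E.
split; first exact: (rint_quadratic pm2 Fc).
rewrite (expect_quadratic pm2 Fc mF) ler_wpM2l //.
rewrite -!expectZ // -expectD; [|exact: rintZ..].
apply: expect_le.
- apply: rint_sum => j; apply: rint_sum => i.
  exact: (rintD (rint_bounded P (mF _ _ _ _) (Fc i j i j))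
    (rint_bounded P (mF _ _ _ _) (Fc i j j i))).
- by apply: rintD; exact: rintZ.
- move=> w.
  have -> : \sum_j \sum_i (F i j i j w + F i j j i w) =
     Re (u w * (\sum_j \sum_i X w j i * G w j i)) + Re (u w * (\tr (X w) * tau w)).
    rewrite -ReD -mulrDr.
    have -> : \tr (X w) * tau w = \sum_j \sum_i X w i i * G w j j.
      rewrite mulrC /tau /mxtrace mulr_suml; apply: eq_bigr => j _.
      by rewrite mulr_sumr; apply: eq_bigr => i _; rewrite mulrC.
    rewrite -big_split mulr_sumr Re_sum; apply: eq_bigr => j _.
    rewrite -big_split mulr_sumr Re_sum; apply: eq_bigr => i _.
    by rewrite mulrDr ReD.
  have h1 : cmod (\sum_j \sum_i X w j i * G w j i) <= e ^+ 2 * Im (tau w) by exact: cmod_trGGG.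
  have h2 : cmod (\tr (X w) * tau w) <= e * cmod (tau w) ^+ 2.
    rewrite cmodM expr2 mulrA ler_wpM2r ?cmod_ge0 //.
    apply: le_trans (cmod_trGG (sA w) z0) _; rewrite ler_wpM2l //.
    by apply: le_trans (Im_le_cmod _); exact: ler_norm.
  by apply: lerD; apply: le_trans (ler_norm _) _; exact: u_le.
Qed.

Lemma step_drift (delta : R) : 0 < delta ->
  rint P (fun w => Re (u w * (tau' w - tau w))) /\
  expect P (fun w => Re (u w * (tau' w - tau w))) <=
  m2 / N%:R * (e ^+ 2 * mean_Im + e * mean_sqr) +
  N%:R * e ^+ 4 * (delta ^+ 3 + m4 / delta).
Proof.
move=> d0; have [l1 l2] := lin_zero; have [q1 q2] := quad_part.
have ne4 : 0 <= N%:R * e ^+ 4 by rewrite mulr_ge0 // exprn_ge0.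
have rR : rint P (fun w => N%:R * e ^+ 4 * (delta ^+ 3 + delta^-1 * abs_sum (W w) ^+ 4)).
  by apply: rintZ; apply: rintD; [exact: rint_cst|exact: rintZ].
(* y^3 <= delta^3 + y^4 / delta *)
have cub w : `|Re (u w * cubic w)| <=
    N%:R * e ^+ 4 * (delta ^+ 3 + delta^-1 * abs_sum (W w) ^+ 4).
  apply: u_le; apply: le_trans (cubic_le w) _; rewrite ler_wpM2l //.
  move: (abs_sum_ge0 (W w)); move: (abs_sum _) => y y0.
  have [yd|yd] := leP y delta.
    apply: (@le_trans _ _ (delta ^+ 3)); first by rewrite lerXn2r ?nnegrE // ltW.
    by rewrite lerDl mulr_ge0 ?exprn_ge0 // invr_ge0 ltW.
  apply: (@le_trans _ _ (delta^-1 * y ^+ 4)); last by rewrite lerDr exprn_ge0 // ltW.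
  rewrite [leRHS]mulrC ler_pdivlMr // [leRHS]exprSr ler_wpM2l ?exprn_ge0 //.
  by rewrite ltW.
have rcub : rint P (fun w => Re (u w * cubic w)).
  apply: rint_le rR cub.
  by have [] : cmeasurable (fun w => u w * cubic w) by exact: cmeasurableM.
have E w : Re (u w * (tau' w - tau w)) = Re (u w * quad w) - Re (u w * cubic w) - Re (u w * lin w).
  by rewrite tau_diff3 -!ReN -!ReD; congr Re; ring.
under [Z in expect P Z]eq_fun do rewrite E.
under [Z in rint P Z]eq_fun do rewrite E.
split; first by apply: rintB => //; exact: rintB.
rewrite expectB //; last exact: rintB.
rewrite l1 subr0 expectB // lerD //.
rewrite -expectN //; apply: (@le_trans _ _ (expect P (fun w =>
    N%:R * e ^+ 4 * (delta ^+ 3 + delta^-1 * abs_sum (W w) ^+ 4)))).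
  apply: expect_le => //; first exact: rintN.
  by move=> w; apply: le_trans (cub w); rewrite -normrN ler_norm.
rewrite expectZ; last by apply: rintD; [exact: rint_cst|exact: rintZ].
rewrite ler_wpM2l // expectD; [|exact: rint_cst|exact: rintZ].
rewrite expect_cst lerD // expectZ // mulrC ler_wpM2r // invr_ge0.
by rewrite ltW.
Qed.

End Step.

(** * The Brownian increments and their past *)

Section GeneratedSets.
Context {R : realType} {d : measure_display} {Omega : measurableType d}.
Implicit Types G : set (set Omega).

Lemma sigma_setT G : <<s G >> setT.
Proof. exact: (@measurableT _ (g_sigma_algebraType G)). Qed.

Lemma sigma_setI G A B : <<s G >> A -> <<s G >> B -> <<s G >> (A `&` B).
Proof. exact: (@measurableI _ (g_sigma_algebraType G)). Qed.

Lemma sigma_bigcap (I : finType) (D : set I) (F : I -> set Omega) G :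
  (forall i, D i -> <<s G >> (F i)) -> <<s G >> (\bigcap_(i in D) F i).
Proof.
by move=> h; apply: (@fin_bigcap_measurable _ (g_sigma_algebraType G)).
Qed.

Lemma sigma_of_preimage (I : Type) (f : I -> Omega -> R) i (A : set R) :
  measurable A -> sigma_of f (f i @^-1` A).
Proof.
move=> mA; apply: sub_sigma_algebra; exists i => //; exists A => //.
by rewrite setTI.
Qed.

Lemma sigma_of_sub (I : Type) (f : I -> Omega -> R) G :
  (forall i, measurable_fun [set: g_sigma_algebraType G] (f i)) ->
  sigma_of f `<=` <<s G >>.
Proof.
move=> h; apply: smallest_sub; first exact: smallest_sigma_algebra.
by move=> _ [i _ [A mA <-]]; exact: h.
Qed.

Lemma measurable_sigma_of (I : Type) (f : I -> Omega -> R) :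
  (forall i, measurable_fun setT (f i)) -> sigma_of f `<=` measurable.
Proof.
move=> h; apply: smallest_sub; first exact: sigma_algebra_measurable.
by move=> _ [i _ [A mA <-]]; exact: h.
Qed.

End GeneratedSets.

(** Each new summand costs a factor 8, from $(x+y)^2\le2(x^2+y^2)$ applied twice. The exponential
    constant multiplies only terms that vanish with the mesh. *)
Lemma pow4_sum {R : realType} (I : Type) (r : seq I) (a : I -> R) :
  (forall i, 0 <= a i) ->
  (\sum_(i <- r) a i) ^+ 4 <= 8 ^+ size r * \sum_(i <- r) a i ^+ 4.
Proof.
move=> a0; elim: r => [|i r IH]; first by rewrite !big_nil expr0n /= mulr0.
rewrite !big_cons /=; set S := \sum_(j <- r) a j in IH *.
have S0 : 0 <= S by rewrite sumr_ge0.
have T0 : 0 <= \sum_(j <- r) a j ^+ 4 by rewrite sumr_ge0 // => j _; rewrite exprn_ge0.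
have p8 : (1 : R) <= 8 ^+ size r by rewrite exprn_ege1 // ler1n.
have sq (x y : R) : (x + y) ^+ 2 <= 2 * (x ^+ 2 + y ^+ 2).
  by have := sqr_ge0 (x - y); rewrite sqrrB sqrrD; lra.
have h : (a i + S) ^+ 4 <= 8 * (a i ^+ 4 + S ^+ 4).
  rewrite (exprM _ 2 2) (exprM (a i) 2 2) (exprM S 2 2).
  apply: (@le_trans _ _ ((2 * (a i ^+ 2 + S ^+ 2)) ^+ 2)).
    by rewrite lerXn2r ?nnegrE ?sqr_ge0 // mulr_ge0 // addr_ge0 ?sqr_ge0.
  have := sq (a i ^+ 2) (S ^+ 2).
  have -> : (2 * (a i ^+ 2 + S ^+ 2)) ^+ 2 = 4 * (a i ^+ 2 + S ^+ 2) ^+ 2 by ring.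
  lra.
apply: (le_trans h); rewrite [8 ^+ _.+1]exprS -mulrA ler_wpM2l // mulrDr lerD //.
by rewrite ler_peMl // exprn_ge0.
Qed.

Section Flow.
Context {R : realType} {d : measure_display} {Omega : measurableType d}.
Variable P : probability Omega R.
Variables (N : nat) (T : 'I_N -> 'I_N -> Omega -> R) (V : 'I_N -> Omega -> R)
  (B : 'I_N -> 'I_N -> R -> Omega -> R).
Hypothesis mT : forall x y, measurable_fun [set: Omega] (T x y).
Hypothesis mV : forall x, measurable_fun [set: Omega] (V x).
Hypothesis sB : forall x y s w, B x y s w = B y x s w.
Hypothesis BM : forall x y : 'I_N, (x <= y)%N -> standard_BM P (B x y).

Local Notation upper := (fun p : 'I_N * 'I_N => (p.1 <= p.2)%N).
Local Notation sigT := (sigma_of (fun p : 'I_N * 'I_N => T p.1 p.2)).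
Local Notation sigV := (sigma_of V).
Local Notation sigB :=
  (sigma_of (fun q : 'I_N * 'I_N * {s : R | 0 <= s} => B q.1.1 q.1.2 (sval q.2))).
Local Notation sigP p :=
  (sigma_of (fun s : {s : R | 0 <= s} => B p.1 p.2 (sval s))).

Hypothesis indepB : mutually_independent P (I := ('I_N * 'I_N)%type) upper
  (fun p => sigP p).
Hypothesis indepTVB : mutually_independent P (I := 'I_3) predT
  (fun k => if val k == 0%N then sigT else if val k == 1%N then sigV else sigB).

Lemma measurable_B x y s : 0 <= s -> measurable_fun [set: Omega] (B x y s).
Proof.
move=> s0; have [xy|/ltnW yx] := leqP x y; first by have [+ _ _ _] := BM xy; apply.
have -> : B x y s = B y x s by apply/funext => w; exact: sB.
by have [+ _ _ _] := BM yx; apply.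
Qed.

Lemma path_sub (p : 'I_N * 'I_N) : sigP p `<=` sigB.
Proof.
apply: sigma_of_sub => -[t t0] _ A mA; rewrite setTI.
exact: (@sigma_of_preimage _ _ _ _ _ (p, exist _ t t0)).
Qed.

Lemma indep3 AT AV AB : sigT AT -> sigV AV -> sigB AB ->
  (P (AT `&` AV `&` AB) = P AT * P AV * P AB)%E.
Proof.
move=> hT hV hB.
pose A (k : 'I_3) := if val k == 0%N then AT else if val k == 1%N then AV else AB.
have := indepTVB (A := A).
rewrite (_ : \bigcap_(i in _) A i = AT `&` AV `&` AB).
  rewrite 3!big_ord_recl big_ord0 mule1 muleA /A /=; apply.
  by move=> i _; rewrite /A; case: ifP => // _; case: ifP.
apply/seteqP; split => w.
  move=> h; split; first split.
  - exact: (h (@Ordinal 3 0 isT)).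
  - exact: (h (@Ordinal 3 1 isT)).
  - exact: (h (@Ordinal 3 2 isT)).
by move=> [[h1 h2] h3] i _; rewrite /A; case: ifP => // _; case: ifP.
Qed.

Definition random_part t w : 'M[R]_N := \matrix_(i < N, j < N) T i j w + Phi B t w.

Hypothesis sT : forall x y w, T x y w = T y x w.

Lemma Phi_sym t w : (Phi B t w)^T = Phi B t w.
Proof. by apply/matrixP => i j; rewrite !mxE (eq_sym j) (sB j). Qed.

Lemma random_part_sym t w : (random_part t w)^T = random_part t w.
Proof.
rewrite /random_part linearD /= Phi_sym; congr (_ + _).
by apply/matrixP => i j; rewrite !mxE (sT j).
Qed.

Lemma HflowE t w : Hflow T V B t w = random_part t w + potential V w.
Proof. by rewrite /Hflow /random_part /potential addrAC. Qed.

Lemma Hflow_sym t w : (Hflow T V B t w)^T = Hflow T V B t w.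
Proof. by rewrite HflowE linearD /= random_part_sym sym_potential. Qed.

Lemma measurable_Hflow t i j : 0 <= t ->
  measurable_fun [set: Omega] (fun w => Hflow T V B t w i j).
Proof.
move=> t0; under eq_fun do rewrite HflowE !mxE.
apply: measurable_funD.
  apply: measurable_funD => //; apply: measurable_funM => //.
  exact: measurable_B.
case: (i == j); first by under eq_fun do rewrite mulr1n; exact: mV.
by under eq_fun do rewrite mulr0n; exact: measurable_cst.
Qed.

(** * Separating the potential from $T+\Phi_t$ *)

Section Decoupling.
Variable t : R.
Hypothesis t0 : 0 <= t.

(** A pi-system generating the joint sigma-algebra of [T] and the Brownian paths; on its members
    independence from [V] is the threefold product formula. *)
Let gTB : set (set Omega) :=
  [set E | exists AT AB, [/\ sigT AT, sigB AB & E = AT `&` AB]].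

Local Notation OM := (g_sigma_algebraType gTB).
Local Notation OV := (g_sigma_algebraType sigV).

Let gTB_sub : gTB `<=` measurable.
Proof.
move=> _ [AT [AB [h1 h2 ->]]]; apply: measurableI.
  by apply: (measurable_sigma_of _ h1) => q; exact: mT.
by apply: (measurable_sigma_of _ h2) => -[q [r r0]]; exact: measurable_B.
Qed.

Let sigV_sub : sigV `<=` measurable.
Proof. exact: measurable_sigma_of. Qed.

Let indepM A C : <<s gTB >> A -> <<s sigV >> C -> P (A `&` C) = (P A * P C)%E.
Proof.
apply: indep_generated => //.
- move=> _ _ [AT [AB [h1 h2 ->]]] [AT' [AB' [h1' h2' ->]]].
  exists (AT `&` AT'), (AB `&` AB'); split; [exact: sigma_setI..|by rewrite setIACA].
- by move=> A1 A2 h1 h2; exact: sigma_setI.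
- by exists setT, setT; split; [exact: sigma_setT..|rewrite setIT].
- exact: sigma_setT.
- move=> _ AV [AT [AB [h1 h2 ->]]] hV.
  rewrite setIAC indep3 // muleAC; congr (_ * _)%E.
  have hT : sigV setT by exact: sigma_setT.
  have := indep3 h1 hT h2; rewrite setIT probability_setT mule1.
  by move=> ->.
Qed.

Let mM i j : measurable_fun [set: OM] (fun w => random_part t w i j).
Proof.
under eq_fun do rewrite !mxE; apply: measurable_funD.
  move=> _ A mA; rewrite setTI; apply: sub_sigma_algebra.
  exists (T i j @^-1` A), setT; split; [|exact: sigma_setT|by rewrite setIT].
  exact: (@sigma_of_preimage _ _ _ _ (fun p : 'I_N * 'I_N => T p.1 p.2) (i, j)).
apply: measurable_funM; first exact: measurable_cst.
move=> _ A mA; rewrite setTI; apply: sub_sigma_algebra.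
exists setT, (B i j t @^-1` A); split; [exact: sigma_setT| |by rewrite setTI].
exact: (@sigma_of_preimage _ _ _ _ _ ((i, j), exist _ t t0)).
Qed.

Let mVV x : measurable_fun [set: OV] (V x).
Proof.
move=> _ A mA; rewrite setTI; apply: sub_sigma_algebra.
exact: sigma_of_preimage.
Qed.

Let H2 (x : OM * OV) : 'M[R]_N := random_part t x.1 + potential V x.2.

Let H2_measurable i j : measurable_fun [set: OM * OV] (fun x => H2 x i j).
Proof.
under eq_fun do rewrite mxE; apply: measurable_funD.
  exact: (measurableT_comp (mM i j) measurable_fst).
under eq_fun do rewrite !mxE.
case: (i == j); last by under eq_fun do rewrite mulr0n; exact: measurable_cst.
under eq_fun do rewrite mulr1n.
exact: (measurableT_comp (mVV i) measurable_snd).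
Qed.

(** The potential estimates hold for every deterministic symmetric [M] with one constant; freezing
    $M=T+\Phi_t$ transfers them to the flow at any time [t]. The function [f] will be the imaginary
    part and the squared modulus. *)
Lemma decouple (z : R[i]) (f : R[i] -> R) (c : R) : 0 < Im z ->
  (forall d' (T' : measurableType d') (g : T' -> R[i]), cmeasurable g ->
     measurable_fun setT (fun x => f (g x))) ->
  (forall A : 'M[R]_N, A^T = A -> 0 <= f (\tr (resolvent A z))) ->
  (forall M : 'M[R]_N, M^T = M ->
     \int[P]_w (f (\tr (resolvent (M + potential V w) z)))%:E <= c%:E)%E ->
  (\int[P]_w (f (\tr (resolvent (Hflow T V B t w) z)))%:E <= c%:E)%E.
Proof.
move=> z0 mf f0 hc.
have sH2 x : (H2 x)^T = H2 x by rewrite /H2 linearD /= random_part_sym sym_potential.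
pose F (x : OM * OV) := (f (\tr (resolvent (H2 x) z)))%:E.
have mF : measurable_fun [set: OM * OV] F.
  apply/measurable_EFinP; apply: mf; apply: cmeasurable_trace => i j.
  by apply: cmeasurable_resolvent.
have F0 x : (0 <= F x)%E by rewrite lee_fin f0.
have h := indep_ge0_integral_le (P := P) (measurable_id_gen gTB_sub)
  (measurable_id_gen sigV_sub) (fun A C mA mC => indepM mA mC) (c := c) mF F0.
under eq_integral do rewrite HflowE.
apply: h => w1; have := hc _ (random_part_sym t w1).
by rewrite /F /H2.
Qed.

End Decoupling.

(** * Increments along a grid and the past of each entry *)

Section Grid.
Variable s : R.
Hypothesis s0 : 0 < s.

Definition grid (i : nat) : R := i%:R * s.

Lemma grid_ge0 i : 0 <= grid i.
Proof. by rewrite mulr_ge0 // ltW. Qed.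

Lemma grid_step i : grid i.+1 - grid i = s.
Proof. by rewrite /grid -natr1 mulrDl mul1r addrAC subrr add0r. Qed.

Lemma grid_lt i : grid i < grid i.+1.
Proof. by rewrite -subr_gt0 grid_step. Qed.

Definition incr (p : 'I_N * 'I_N) (k : nat) (w : Omega) : R :=
  B p.1 p.2 (grid k.+1) w - B p.1 p.2 (grid k) w.

Local Notation sigD p k := (sigma_of (I := unit) (fun _ w => incr p k w)).

Lemma measurable_incr p k : measurable_fun setT (incr p k).
Proof. by apply: measurable_funB; apply: measurable_B; exact: grid_ge0. Qed.

Lemma incr_law p k (A : set R) : upper p -> measurable A ->
  P (incr p k @^-1` A) = normal_prob 0 (Num.sqrt s) A.
Proof.
move=> up mA; have [_ _ _ h] := BM up.
have [_ hl] := h k.+1 grid (grid_ge0 0) (fun i _ => grid_lt i).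
by have := hl ord_max A mA; rewrite grid_step.
Qed.

Lemma measurable_path (p : 'I_N * 'I_N) t : 0 <= t ->
  measurable_fun [set: g_sigma_algebraType
    (\bigcup_(i in [set: {s : R | 0 <= s}]) preimage_set_system [set: Omega]
      (B p.1 p.2 (sval i)) measurable)] (B p.1 p.2 t).
Proof.
move=> t0 _ A mA; rewrite setTI.
exact: (@sigma_of_preimage _ _ _ _ _ (exist _ t t0)).
Qed.

Lemma sigD_path p k : sigD p k `<=` sigP p.
Proof.
apply: sigma_of_sub => _; apply: measurable_funB; apply: measurable_path; exact: grid_ge0.
Qed.

Lemma indep_incr p k (D : nat -> set Omega) : upper p ->
  (forall j, (j <= k)%N -> sigD p j (D j)) ->
  (P (\bigcap_(j in [set j | (j < k)%N]) D j `&` D k) =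
   \prod_(j < k) P (D j) * P (D k))%E.
Proof.
move=> up hD; have [_ _ _ h] := BM up.
have [hi _] := h k.+1 grid (grid_ge0 0) (fun i _ => grid_lt i).
have := hi (fun i => D i); rewrite big_ord_recr /= => <-; last first.
  by move=> i _; apply: hD; rewrite -ltnS.
congr (P _); apply/seteqP; split => w.
  move=> [h1 h2] i _; have := ltn_ord i; rewrite ltnS leq_eqVlt => /predU1P[->//|ik].
  exact: h1.
move=> hw; split; last exact: (hw ord_max).
by move=> j jk; exact: (hw (Ordinal (ltnW jk : (j < k.+1)%N))).
Qed.

(* A pi-system of events independent of the increment of B_p after time k s: it sees T, V, the
   whole paths of the other Brownian motions, and the earlier increments of B_p. *)
Definition past (p : 'I_N * 'I_N) (k : nat) : set (set Omega) :=
  [set E | exists AT AV (A : 'I_N * 'I_N -> set Omega) (D : nat -> set Omega),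
    [/\ sigT AT, sigV AV, forall q, upper q -> q != p -> sigP q (A q),
        forall j, (j < k)%N -> sigD p j (D j) &
        E = AT `&` AV `&` (\bigcap_(q in [set q | upper q /\ q != p]) A q `&`
              \bigcap_(j in [set j | (j < k)%N]) D j)]].

Lemma past_setI p k : setI_closed (past p k).
Proof.
move=> _ _ [AT [AV [A [D [h1 h2 h3 h4 ->]]]]] [AT' [AV' [A' [D' [h1' h2' h3' h4' ->]]]]].
exists (AT `&` AT'), (AV `&` AV'), (fun q => A q `&` A' q), (fun j => D j `&` D' j).
split.
- exact: sigma_setI.
- exact: sigma_setI.
- by move=> q uq qp; apply: sigma_setI; [exact: h3|exact: h3'].
- by move=> j jk; apply: sigma_setI; [exact: h4|exact: h4'].
- by rewrite !bigcapI setIACA (setIACA AT) (setIACA (\bigcap_(q in _) A q)).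
Qed.

Lemma past_measurable p k : past p k `<=` measurable.
Proof.
move=> _ [AT [AV [A [D [h1 h2 h3 h4 ->]]]]].
apply: measurableI; apply: measurableI.
- by apply: (measurable_sigma_of _ h1) => q; exact: mT.
- exact: (measurable_sigma_of _ h2).
- apply: fin_bigcap_measurable => // q [uq qp].
  by apply: (measurable_sigma_of _ (h3 _ uq qp)) => -[t t0]; exact: measurable_B.
- apply: bigcap_measurableType => j jk.
  by apply: (measurable_sigma_of _ (h4 _ jk)) => _; exact: measurable_incr.
Qed.

Let path_family p k (A : 'I_N * 'I_N -> set Omega) (D : nat -> set Omega) : upper p ->
  (forall q, upper q -> q != p -> sigP q (A q)) ->
  (forall j, (j <= k)%N -> sigD p j (D j)) ->
  let H := \bigcap_(j in [set j | (j < k)%N]) D j in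
  forall q, upper q -> sigP q (if q == p then H `&` D k else A q).
Proof.
move=> up hA hD H q uq; have [->|qp] := eqVneq q p; last exact: hA.
apply: sigma_setI; last by apply: sigD_path; exact: hD (leqnn k).
apply: (@bigcap_measurableType _ (g_sigma_algebraType _)) => j jk.
by apply: sigD_path; exact: hD (ltnW jk).
Qed.

(** In the family of independent paths, the event of path [p] is taken to be an intersection of
    events of its increments; [indep_incr] then factors it further. *)
Let path_prob p k (A : 'I_N * 'I_N -> set Omega) (D : nat -> set Omega) : upper p ->
  (forall q, upper q -> q != p -> sigP q (A q)) ->
  (forall j, (j <= k)%N -> sigD p j (D j)) ->
  let Q := \bigcap_(q in [set q | upper q /\ q != p]) A q in
  let H := \bigcap_(j in [set j | (j < k)%N]) D j in
  (P (Q `&` (H `&` D k)) =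
    \prod_(q | upper q && (q != p)) P (A q) * (\prod_(j < k) P (D j) * P (D k)))%E.
Proof.
move=> up hA hD Q H.
rewrite -(indep_incr up hD) -/H.
have := indepB (path_family up hA hD); rewrite (bigD1 p) //= eqxx muleC.
under eq_bigr => q /andP[_ /negbTE ->] do [].
move=> <-; congr (P _); apply/seteqP; split => w.
  move=> [hQ hH] q /= uq; case: eqP => // /eqP qp; exact: hQ.
move=> h; split; last by have := h p up; rewrite eqxx.
by move=> q [uq qp]; have := h q uq; rewrite (negbTE qp).
Qed.

Lemma indep_past_incr p k : upper p ->
  forall E D, <<s past p k >> E -> sigD p k D -> P (E `&` D) = (P E * P D)%E.
Proof.
move=> up E D hE hD.
have mD : sigD p k `<=` measurable.
  by apply: measurable_sigma_of => _; exact: measurable_incr.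
apply: (indep_generated (G1 := past p k) (G2 := sigD p k)) => //.
- exact: past_measurable.
- exact: past_setI.
- exact: sigma_setI.
- exists setT, setT, (fun=> setT), (fun=> setT); split; try by move=> *; exact: sigma_setT.
  + exact: sigma_setT.
  + exact: sigma_setT.
  + by rewrite !bigcapT ?setTI.
- exact: sigma_setT.
- move=> _ D' [AT [AV [A [F [h1 h2 h3 h4 ->]]]]] hD'.
  pose F' (X : set Omega) j := if j == k then X else F j.
  have hF' X : sigD p k X -> forall j, (j <= k)%N -> sigD p j (F' X j).
    move=> hX j jk; rewrite /F'; have [->//|jne] := eqVneq j k.
    by apply: h4; rewrite ltn_neqAle jne.
  set Q := \bigcap_(q in _) A q; set H := \bigcap_(j in _) F j.
  have HE X : \bigcap_(j in [set j | (j < k)%N]) F' X j = H.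
    by apply: eq_bigcapr => j /= jk; rewrite /F' ltn_eqF.
  (* Taking [X] to be the whole space computes the probability of the past event itself; comparison
     with $X=D'$ yields independence. *)
  have key X : sigD p k X -> P (AT `&` AV `&` (Q `&` (H `&` X))) =
      (P AT * P AV * (\prod_(q | upper q && (q != p)) P (A q) *
        (\prod_(j < k) P (F j) * P X)))%E.
    move=> hX; have := path_prob up h3 (hF' X hX).
    rewrite /= HE {1 3}/F' eqxx -/Q => e.
    rewrite indep3 // ?e.
      congr (_ * (_ * (_ * _)))%E; apply: eq_bigr => j _.
      by rewrite /F' ltn_eqF // ltn_ord.
    apply: sigma_setI; last apply: sigma_setI.
    + apply: sigma_bigcap => q [uq qp].
      by apply: path_sub; exact: h3.
    + apply: (@bigcap_measurableType _ (g_sigma_algebraType _)) => j jk.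
      by apply: (@path_sub p); apply: sigD_path; exact: h4.
    + by apply: (@path_sub p); apply: sigD_path; exact: hX.
  have hT : sigD p k setT by exact: sigma_setT.
  have e1 := key _ hT; have e2 := key D' hD'.
  rewrite !setIT in e1; rewrite -(setIA (AT `&` AV)) -(setIA Q) e2 e1 probability_setT mule1.
  by rewrite !muleA.
- by apply: sub_sigma_algebra.
Qed.

Lemma past_of (p : 'I_N * 'I_N) k AT AV (A : 'I_N * 'I_N -> set Omega)
    (D : nat -> set Omega) (E : set Omega) :
  sigT AT -> sigV AV -> (forall q, upper q -> q != p -> sigP q (A q)) ->
  (forall j, (j < k)%N -> sigD p j (D j)) ->
  E = AT `&` AV `&` (\bigcap_(q in [set q | upper q /\ q != p]) A q `&`
              \bigcap_(j in [set j | (j < k)%N]) D j) -> <<s past p k >> E.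
Proof. by move=> *; apply: sub_sigma_algebra; exists AT, AV, A, D. Qed.

Lemma past_T p k a b : measurable_fun [set: g_sigma_algebraType (past p k)] (T a b).
Proof.
move=> _ A mA; rewrite setTI.
apply: (past_of (AT := T a b @^-1` A) (AV := setT) (A := fun=> setT) (D := fun=> setT)).
- exact: (@sigma_of_preimage _ _ _ _ (fun p : 'I_N * 'I_N => T p.1 p.2) (a, b)).
- exact: sigma_setT.
- by move=> *; exact: sigma_setT.
- by move=> *; exact: sigma_setT.
- by rewrite !bigcapT // !setIT.
Qed.

Lemma past_V p k a : measurable_fun [set: g_sigma_algebraType (past p k)] (V a).
Proof.
move=> _ A mA; rewrite setTI.
apply: (past_of (AV := V a @^-1` A) (AT := setT) (A := fun=> setT) (D := fun=> setT)).
- exact: sigma_setT.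
- exact: sigma_of_preimage.
- by move=> *; exact: sigma_setT.
- by move=> *; exact: sigma_setT.
- by rewrite !bigcapT // !setIT setTI.
Qed.

Lemma past_B p k q t : upper q -> q != p -> 0 <= t ->
  measurable_fun [set: g_sigma_algebraType (past p k)] (B q.1 q.2 t).
Proof.
move=> uq qp t0 _ A mA; rewrite setTI.
pose A' r := if r == q then B q.1 q.2 t @^-1` A else setT.
apply: (past_of (AV := setT) (AT := setT) (A := A') (D := fun=> setT)).
- exact: sigma_setT.
- exact: sigma_setT.
- move=> r ur rp; rewrite /A'; case: eqP => [->|_]; last exact: sigma_setT.
  exact: (@sigma_of_preimage _ _ _ _ _ (exist _ t t0)).
- by move=> *; exact: sigma_setT.
- apply/seteqP; split => w.
    move=> hw; split=> //; split=> // r [ur rp].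
    by rewrite /A'; case: eqP => // ->.
  by move=> [_ [/(_ q (conj uq qp)) + _]]; rewrite /A' eqxx.
Qed.

Lemma past_incr p k j : (j < k)%N ->
  measurable_fun [set: g_sigma_algebraType (past p k)] (incr p j).
Proof.
move=> jk _ A mA; rewrite setTI.
pose D' i := if i == j then incr p j @^-1` A else setT.
apply: (past_of (AV := setT) (AT := setT) (A := fun=> setT) (D := D')).
- exact: sigma_setT.
- exact: sigma_setT.
- by move=> *; exact: sigma_setT.
- move=> i ik; rewrite /D'; case: eqP => [->|_]; last exact: sigma_setT.
  exact: (@sigma_of_preimage _ _ _ _ (fun (_ : unit) w => incr p j w) tt).
- apply/seteqP; split => w.
    move=> hw; split=> //; split=> // i ik.
    by rewrite /D'; case: eqP => // ->.
  by move=> [_ [_ /(_ j jk)]]; rewrite /D' eqxx.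
Qed.

(** The past of [p] contains increments of path [p] but not its values; these are recovered as
    partial sums, starting from $B(0)=0$. *)
Lemma past_Bgrid p k j a b : upper p -> (j <= k)%N ->
  measurable_fun [set: g_sigma_algebraType (past p k)] (B a b (grid j)).
Proof.
move=> up jk; wlog ab : a b / (a <= b)%N.
  move=> h; have [ab|/ltnW ba] := leqP a b; first exact: h.
  by have -> : B a b (grid j) = B b a (grid j); [apply/funext => w; exact: sB|exact: h].
have [e|ne] := eqVneq (a, b) p; last first.
  exact: (@past_B p k (a, b) (grid j) ab ne (grid_ge0 j)).
elim: j jk => [_|j IH jk].
  have [_ B0 _ _] := BM ab; rewrite /grid mul0r.
  have -> : B a b 0 = cst 0 by apply/funext => w; exact: B0.
  exact: measurable_cst.
have -> : B a b (grid j.+1) = fun w => B a b (grid j) w + incr p j w.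
  by apply/funext => w; rewrite /incr -e /= addrC subrK.
apply: measurable_funD; first by apply: IH; exact: ltnW.
exact: past_incr.
Qed.

(** Measurability is required for the past of every entry at once. The observables of the flow up to
    grid time [k] satisfy this, and each entry of the increment can then be averaged using its own
    past. *)
Definition past_fun k (phi : Omega -> R) :=
  forall p, upper p -> measurable_fun [set: g_sigma_algebraType (past p k)] phi.

Definition m2 : R := fine (\int[normal_prob 0 (Num.sqrt s)]_x (x ^+ 2)%:E)%E.

Lemma rint_incr2 p k : upper p -> rint P (fun w => incr p k w ^+ 2).
Proof.
move=> up; apply: (gauss_integrable2 (measurable_incr p k) s0) => A mA.
exact: incr_law.
Qed.

Lemma rint_incr p k : upper p -> rint P (incr p k).
Proof.
move=> up; apply: (gauss_integrable (measurable_incr p k) s0) => A mA.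
exact: incr_law.
Qed.

Lemma expect_incr2 p k : upper p -> expect P (fun w => incr p k w ^+ 2) = m2.
Proof.
move=> up; rewrite /expect /Rintegral /m2; congr fine.
apply: (law_integral (measurable_incr p k) _ (f := fun x => x ^+ 2)) => //.
- by move=> A mA; exact: incr_law.
- by move=> x; exact: sqr_ge0.
Qed.

Lemma expect_incr p k : upper p -> expect P (incr p k) = 0.
Proof.
move=> up; apply: (gauss_mean (measurable_incr p k) s0) => A mA.
exact: incr_law.
Qed.

Lemma m2_ge0 : 0 <= m2.
Proof. by rewrite fine_ge0 // integral_ge0 // => x _; rewrite lee_fin sqr_ge0. Qed.

Lemma m2_le : m2 <= 8 * s.
Proof.
have := normal_moment2 s0; rewrite /m2.
have : (0 <= \int[normal_prob 0 (Num.sqrt s)]_x (x ^+ 2)%:E)%E.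
  by apply: integral_ge0 => x _; rewrite lee_fin sqr_ge0.
by case: integral.
Qed.

Section PastProduct.
Variables (p : 'I_N * 'I_N) (k : nat) (phi : Omega -> R) (g : R -> R).
Hypotheses (up : upper p)
  (mphi : measurable_fun [set: g_sigma_algebraType (past p k)] phi)
  (Iphi : rint P phi) (mg : measurable_fun setT g) (Ig : rint P (g \o incr p k)).

Let indep (A : set (g_sigma_algebraType (past p k))) (C : set R) :
  measurable A -> measurable C ->
  P ((id : Omega -> g_sigma_algebraType (past p k)) @^-1` A `&` incr p k @^-1` C) =
  (P ((id : Omega -> g_sigma_algebraType (past p k)) @^-1` A) * P (incr p k @^-1` C))%E.
Proof.
move=> mA mC; apply: (indep_past_incr (k := k) up mA).
exact: (@sigma_of_preimage R d Omega unit (fun (_ : unit) w => incr p k w) tt C mC).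
Qed.

Lemma expect_past :
  expect P (fun w => phi w * g (incr p k w)) = expect P phi * expect P (g \o incr p k).
Proof.
exact: (indep_Rintegral (measurable_id_gen (@past_measurable p k))
  (measurable_incr p k) indep mphi mg Iphi Ig).
Qed.

End PastProduct.

Lemma rint_incr4 p k : upper p -> rint P (fun w => incr p k w ^+ 4).
Proof.
move=> up; apply: (@rint_ge0_bounded _ _ _ P _ (128 * s ^+ 2)).
- by apply: measurable_funX; exact: measurable_incr.
- by move=> w; exact: exprn_even_ge0.
- apply: (gauss_moment4 (measurable_incr p k) s0) => A mA; exact: incr_law.
Qed.

Lemma expect_incr4 p k : upper p -> expect P (fun w => incr p k w ^+ 4) <= 128 * s ^+ 2.
Proof.
move=> up; apply: expect_le_ereal; first exact: rint_incr4.
by apply: (gauss_moment4 (measurable_incr p k) s0) => A mA; exact: incr_law.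
Qed.

Definition coef (i j : 'I_N) : R := Num.sqrt ((1 + (i == j)%:R) / N%:R).

Definition dW (k : nat) (w : Omega) : 'M[R]_N :=
  \matrix_(i, j) (coef i j * incr (i, j) k w).

Definition ordered (i j : 'I_N) := if (i <= j)%N then (i, j) else (j, i).

Lemma ordered_upper i j : upper (ordered i j).
Proof. by rewrite /ordered; case: (leqP i j) => // /ltnW. Qed.

Lemma incr_ordered i j k w : incr (i, j) k w = incr (ordered i j) k w.
Proof. by rewrite /ordered /incr; case: ifP => //= _; rewrite !(sB i j). Qed.

Lemma dWE i j k w : dW k w i j = coef i j * incr (ordered i j) k w.
Proof. by rewrite mxE incr_ordered. Qed.

Lemma coefC i j : coef i j = coef j i.
Proof. by rewrite /coef eq_sym. Qed.

Lemma dW_sym k w : (dW k w)^T = dW k w.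
Proof.
apply/matrixP => i j; rewrite mxE !mxE coefC; congr (_ * _).
by rewrite /incr /= !(sB i j).
Qed.

Lemma measurable_dW i j k : measurable_fun setT (fun w => dW k w i j).
Proof.
under eq_fun do rewrite mxE.
by apply: measurable_funM => //; exact: measurable_incr.
Qed.

Lemma coef_sqr i j : coef i j ^+ 2 = (1 + (i == j)%:R) / N%:R.
Proof. by rewrite sqr_sqrtr // divr_ge0 // addr_ge0. Qed.

(** For a diagonal entry both Kronecker symbols equal 1, which reproduces its doubled variance
    $2/N$; off the diagonal exactly one of them does. *)
Lemma coef_cov i j k l : ordered i j = ordered k l ->
  coef i j * coef k l = (((i, j) == (k, l))%:R + ((i, j) == (l, k))%:R) / N%:R.
Proof.
move=> e; have [[-> ->]|[-> ->]] : (i = k /\ j = l) \/ (i = l /\ j = k).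
- move: e; rewrite /ordered; case: ifP => _; case: ifP => _ [-> ->]; by [left|right].
- rewrite eqxx -expr2 coef_sqr xpair_eqE; congr ((_ + _) / _).
  by rewrite (eq_sym l) andbb.
- rewrite eqxx (coefC k) -expr2 coef_sqr xpair_eqE addrC; congr ((_ + _) / _).
  by rewrite (eq_sym k) andbb.
Qed.

Lemma ordered_neq i j k l : ordered i j != ordered k l ->
  (((i, j) == (k, l)) = false) * (((i, j) == (l, k)) = false).
Proof.
move=> ne; split; apply/negP => /eqP [ei ej]; move: ne; rewrite ei ej ?eqxx //.
rewrite /ordered; case: ltngtP => // [||/val_inj ->]; by rewrite eqxx.
Qed.

Section FlowIncrements.
Variables (k : nat) (phi : Omega -> R) (c : R).
Hypotheses (mphi : past_fun k phi) (phic : forall w, `|phi w| <= c).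

Lemma past_fun_measurable (i : 'I_N) : measurable_fun setT phi.
Proof.
exact: (measurable_gen (@past_measurable (i, i) k) (mphi (leqnn i : upper (i, i)))).
Qed.

Let Iphi (i : 'I_N) : rint P phi.
Proof. exact: rint_bounded (past_fun_measurable i) phic. Qed.

Lemma rint_dW i j : rint P (fun w => phi w * dW k w i j).
Proof.
have := rintZ (coef i j) (rint_bM (past_fun_measurable i) phic
  (rint_incr k (ordered_upper i j))).
by congr rint; apply/funext => w; rewrite dWE mulrCA.
Qed.

Lemma expect_dW i j : expect P (fun w => phi w * dW k w i j) = 0.
Proof.
have up := ordered_upper i j.
transitivity (expect P (fun w => coef i j * (phi w * incr (ordered i j) k w))).
  by congr expect; apply/funext => w; rewrite dWE mulrCA.
rewrite expectZ; last exact: (rint_bM (past_fun_measurable i) phic (rint_incr k up)).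
have := expect_past (g := id) up (mphi up) (Iphi i) (@measurable_id _ _ setT) (rint_incr k up).
by rewrite /= => ->; rewrite [X in _ * (_ * X)]expect_incr // !mulr0.
Qed.

Lemma rint_incrM p q : upper p -> upper q -> rint P (fun w => incr p k w * incr q k w).
Proof.
move=> up uq.
have I : rint P (fun w => incr p k w ^+ 2 + incr q k w ^+ 2).
  by apply: rintD; exact: rint_incr2.
apply: rint_le I _ => [|w].
  by apply: measurable_funM; exact: measurable_incr.
rewrite normrM -(real_normK (num_real (incr p k w))) -(real_normK (num_real (incr q k w))).
move: (normr_ge0 (incr p k w)) (normr_ge0 (incr q k w)).
move: `|_| `|_| => a b a0 b0.
have := sqr_ge0 (a - b); rewrite sqrrB.
have := mulr_ge0 a0 b0; lra.
Qed.

Let dW2E i j i' j' w : phi w * (dW k w i j * dW k w i' j') =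
  coef i j * coef i' j' * (phi w * (incr (ordered i j) k w * incr (ordered i' j') k w)).
Proof. by rewrite !dWE; ring. Qed.

Lemma rint_dW2 i j i' j' : rint P (fun w => phi w * (dW k w i j * dW k w i' j')).
Proof.
under [X in rint P X]eq_fun do rewrite dW2E.
apply: rintZ; apply: (rint_bM (past_fun_measurable i) phic).
by apply: rint_incrM; exact: ordered_upper.
Qed.

Lemma expect_dW2 i j i' j' : expect P (fun w => phi w * (dW k w i j * dW k w i' j')) =
  m2 / N%:R * (((i, j) == (i', j'))%:R + ((i, j) == (j', i'))%:R) * expect P phi.
Proof.
have up := ordered_upper i j; have uq := ordered_upper i' j'.
under [X in expect P X]eq_fun do rewrite dW2E.
rewrite expectZ; last first.
  by apply: (rint_bM (past_fun_measurable i) phic); exact: rint_incrM.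
have [e|ne] := eqVneq (ordered i j) (ordered i' j').
  rewrite coef_cov // -e.
  have msq : measurable_fun [set: R] (fun x : R => x ^+ 2) by [].
  have := expect_past (g := fun x => x ^+ 2) up (mphi up) (Iphi i) msq (rint_incr2 k up).
  rewrite /= => h; rewrite [X in _ * X = _]h [X in _ * (_ * X)]expect_incr2 //.
  by ring.
rewrite !(ordered_neq ne) addr0 mulr0 mul0r.
have Ipq : rint P (fun w => phi w * incr (ordered i' j') k w).
  exact: (rint_bM (past_fun_measurable i) phic (rint_incr k uq)).
(* The past of one entry contains the whole path of the other, including its current increment; that
   increment is absorbed into the past factor and the remaining one has mean zero. *)
have mpq : measurable_fun [set: g_sigma_algebraType (past (ordered i j) k)]
    (fun w => phi w * incr (ordered i' j') k w).
  apply: measurable_funM; first exact: mphi.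
  by apply: measurable_funB; apply: past_B => //; rewrite ?grid_ge0 // eq_sym.
have := expect_past (g := id) up mpq Ipq (@measurable_id _ _ setT) (rint_incr k up).
rewrite /= [X in _ = _ * X]expect_incr // mulr0 => h.
rewrite (_ : expect P _ = 0) ?mulr0 // -h.
by congr expect; apply/funext => w; ring.
Qed.

End FlowIncrements.

Definition moment4_cst : R :=
  8 ^+ size (index_enum (('I_N * 'I_N)%type)) * \sum_(p : 'I_N * 'I_N) coef p.1 p.2 ^+ 4 * 128.

Let abs_sum_le k w : abs_sum (dW k w) ^+ 4 <=
  8 ^+ size (index_enum (('I_N * 'I_N)%type)) *
  \sum_(p : 'I_N * 'I_N) coef p.1 p.2 ^+ 4 * incr (ordered p.1 p.2) k w ^+ 4.
Proof.
rewrite /abs_sum pair_big /=; apply: le_trans (pow4_sum _ _) _ => //.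
rewrite ler_wpM2l ?exprn_ge0 //; apply: ler_sum => p _.
rewrite -normrX ger0_norm ?exprn_even_ge0 // dWE exprMn //.
Qed.

Let rint_majorant k : rint P (fun w => 8 ^+ size (index_enum (('I_N * 'I_N)%type)) *
  \sum_(p : 'I_N * 'I_N) coef p.1 p.2 ^+ 4 * incr (ordered p.1 p.2) k w ^+ 4).
Proof.
apply: rintZ; apply: rint_sum => p; apply: rintZ; apply: rint_incr4.
exact: ordered_upper.
Qed.

Lemma rint_dW4 k : rint P (fun w => abs_sum (dW k w) ^+ 4).
Proof.
apply: rint_le (rint_majorant k) _.
  apply: measurable_funX; apply: measurable_sum => i; apply: measurable_sum => j.
  by apply: measurableT_comp => //; exact: measurable_dW.
by move=> w; rewrite ger0_norm ?exprn_ge0 ?abs_sum_ge0.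
Qed.

Lemma expect_dW4 k : expect P (fun w => abs_sum (dW k w) ^+ 4) <= moment4_cst * s ^+ 2.
Proof.
apply: le_trans (expect_le (rint_dW4 k) (rint_majorant k) (abs_sum_le k)) _.
have r4 p := rint_incr4 k (ordered_upper p.1 p.2).
rewrite expectZ; last by apply: rint_sum => p; exact: rintZ.
rewrite -mulrA ler_wpM2l ?exprn_ge0 // expect_sum; last by move=> p; exact: rintZ.
rewrite mulr_suml; apply: ler_sum => p _; rewrite expectZ // -mulrA ler_wpM2l //.
  by rewrite exprn_ge0 // sqrtr_ge0.
by apply: expect_incr4; exact: ordered_upper.
Qed.

Lemma Hflow_step k w : Hflow T V B (grid k.+1) w = Hflow T V B (grid k) w + dW k w.
Proof.
apply/matrixP => i j; rewrite !mxE /incr /coef /=; ring.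
Qed.

Lemma past_Hflow p k j a b : upper p -> (j <= k)%N ->
  measurable_fun [set: g_sigma_algebraType (past p k)] (fun w => Hflow T V B (grid j) w a b).
Proof.
move=> up jk; under eq_fun do rewrite HflowE !mxE.
apply: measurable_funD.
  apply: measurable_funD; first exact: past_T.
  by apply: measurable_funM => //; exact: past_Bgrid.
case: (a == b); last by under eq_fun do rewrite mulr0n; exact: measurable_cst.
by under eq_fun do rewrite mulr1n; exact: past_V.
Qed.

End Grid.
End Flow.

(** * Telescoping along a grid *)

Section Asymptotics.
Context {R : realType}.

(** [K] is taken so large that $t/K\le r^2$ with $r\le1$; then $t/K$ and its square root are both at
    most $r$, and $r(a+b+1)\le\delta$. *)
Lemma grid_limit (X M t a b : R) : 0 < t -> 0 <= a -> 0 <= b ->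
  (forall K : nat, (0 < K)%N ->
     X <= M + (a * (t / K%:R) + b * Num.sqrt (t / K%:R))) ->
  X <= M.
Proof.
move=> t0 a0 b0 hX; apply/ler_addgt0Pr => delta delta0.
pose r := Num.min 1 (delta / (a + b + 1)).
have ab0 : 0 < a + b + 1 by rewrite ltr_wpDl // addr_ge0.
have r0 : 0 < r by rewrite lt_min ltr01 divr_gt0.
have r1 : r <= 1 by rewrite ge_min lexx.
have rd : r * (a + b + 1) <= delta by rewrite -ler_pdivlMr // ge_min lexx orbT.
pose K := (Num.trunc (t / r ^+ 2)).+1.
have K0 : 0 < K%:R :> R by rewrite ltr0n.
have tK : t / K%:R <= r ^+ 2.
  rewrite ler_pdivrMr // mulrC -ler_pdivrMr ?exprn_gt0 //.
  exact/ltW/Num.Theory.truncnS_gt.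
have sr : Num.sqrt (t / K%:R) <= r.
  by rewrite -[leRHS](@gtr0_norm _ r) // -sqrtr_sqr ler_wsqrtr.
have tr : t / K%:R <= r.
  by apply: le_trans tK _; rewrite expr2 ler_piMl // ltW.
apply: le_trans (hX K isT) _; rewrite lerD2l; apply: le_trans rd.
have := ler_wpM2l a0 tr; have := ler_wpM2l b0 sr.
move: (a * (t / _)) (b * Num.sqrt _) => x y; nra.
Qed.

Lemma dyadic_bound (x : R) : 0 <= x -> exists K, x <= 2 ^+ K <= 2 * (1 + x).
Proof.
move=> x0; have ex : exists K, x <= 2 ^+ K.
  exists (Num.trunc x).+1; apply: ltW; apply: lt_trans (Num.Theory.truncnS_gt x) _.
  by rewrite -natrX ltr_nat ltn_expl.
case: (ex_minnP ex) => -[|m] h hmin; first by exists 0%N; rewrite h expr0; lra.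
exists m.+1; rewrite h /=.
have : ~~ (x <= 2 ^+ m) by apply/negP => /hmin; rewrite ltnn.
by rewrite -ltNge exprS => mx; rewrite ler_wpM2l // ltW // (lt_le_trans mx) // lerDr.
Qed.

(* from exp (d K ln 2) >= 1 + d K ln 2 *)
Lemma dyadic_exponent_le (d : R) K : 0 < d -> K%:R <= (d * ln 2)^-1 * (2 ^+ K) `^ d.
Proof.
move=> d0; have l2 : 0 < ln 2 :> R by rewrite ln_gt0 // ltr1n.
have dl : 0 < d * ln 2 by exact: mulr_gt0.
rewrite mulrC ler_pdivlMr // /powR gt_eqF ?exprn_gt0 //.
have -> : ln (2 ^+ K) = K%:R * ln 2 :> R by rewrite lnXn // mulr_natl.
apply: le_trans (expR_ge1Dx _); rewrite mulrCA.
by rewrite lerDr.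
Qed.

(** The exponent $d=\min(c/4,1/2)$ ensures $2d\le c/2$ and $2d\le1$, so that
    $(2(1+mv))^{2d}\le2m^{c/2}(1+v)$. The 144 is $2\cdot72$, with $72\kappa^2K^2$ from $(1+6\kappa
    K)^2\le2+72\kappa^2K^2$. *)
Definition log_cst (c kappa : R) : R :=
  4 + 144 * kappa ^+ 2 * ((Num.min (c / 4) (1 / 2) * ln 2)^-1) ^+ 2.

Lemma log_cst_ge0 c kappa : 0 <= log_cst c kappa.
Proof. by rewrite addr_ge0 // mulr_ge0 ?sqr_ge0 // mulr_ge0 ?sqr_ge0. Qed.

Lemma log_factor_le (c kappa m v : R) K : 0 < c -> 0 <= kappa -> 1 <= m -> 0 <= v ->
  2 ^+ K <= 2 * (1 + m * v) ->
  (1 + 6 * kappa * K%:R) ^+ 2 <= log_cst c kappa * (m `^ (c / 2) * (1 + v)).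
Proof.
move=> c0 k0 m1 v0 hK; rewrite /log_cst; set d := Num.min _ _; set A := (d * _)^-1.
have d0 : 0 < d by rewrite lt_min divr_gt0 // divr_gt0.
have m0 : 0 <= m by apply: le_trans m1.
pose q : R := m `^ (c / 2) * (1 + v).
have v1 : 1 <= 1 + v by rewrite lerDl.
have v1' : 0 <= 1 + v by apply: le_trans v1.
have q1 : 1 <= q.
  rewrite -[1]mulr1 ler_pM //.
  by rewrite -[leLHS](powRr0 m) ler_powR // divr_ge0 // ltW.
have K2 : (2 ^+ K) `^ d ^+ 2 <= 2 * q.
  have d2 : d * 2 <= 1 by rewrite -ler_pdivlMr // ge_min lexx orbT.
  have dc : d * 2 <= c / 2.
    by rewrite -ler_pdivlMr // -mulrA -invfM ge_min -natrM lexx.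
  have d20 : 0 <= d * 2 by rewrite mulr_ge0 // ltW.
  rewrite -powR_mulrn ?powR_ge0 // -powRrM.
  apply: (@le_trans _ _ ((2 * (m * (1 + v))) `^ (d * 2))).
    apply: ge0_ler_powR => //; rewrite ?nnegrE ?exprn_ge0 ?mulr_ge0 //.
    apply: le_trans hK _; rewrite ler_wpM2l // mulrDr mulr1 lerD2r //.
  rewrite powRM ?mulr_ge0 // powRM //; apply: ler_pM; rewrite ?mulr_ge0 ?powR_ge0 //.
    by apply: ler1_powR => //; rewrite ler1n.
  apply: ler_pM; rewrite ?powR_ge0 //; first by rewrite ler_powR.
  exact: ler1_powR.
have hA : K%:R ^+ 2 <= A ^+ 2 * (2 * q).
  apply: le_trans (_ : (A * (2 ^+ K) `^ d) ^+ 2 <= _).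
    rewrite lerXn2r ?nnegrE ?mulr_ge0 ?powR_ge0 //; last exact: dyadic_exponent_le.
    by rewrite invr_ge0 mulr_ge0 ?ltW // ln_gt0 // ltr1n.
  by rewrite exprMn ler_wpM2l // sqr_ge0.
have kA : 72 * kappa ^+ 2 * K%:R ^+ 2 <= 72 * kappa ^+ 2 * (A ^+ 2 * (2 * q)).
  by rewrite ler_wpM2l // mulr_ge0 // sqr_ge0.
rewrite -/q; move: kA q1 (sqr_ge0 (1 - 6 * kappa * K%:R)); move: (K%:R) => y; nra.
Qed.

(* Here v stands for 1 / (N eta), p for N^(-c/2), and L for the factor 1 + 6 |C_V| K that
   grows logarithmically in 1 / eta. *)
Lemma error_terms_le (CW CL p v L : R) : 0 <= CW -> 0 <= CL -> 0 <= p <= 1 -> 0 <= v ->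
  L <= L ^+ 2 -> p * L ^+ 2 <= CL * (1 + v) ->
  p * (1 + v + v ^+ 3) + 16 * CW * p +
    8 * p ^+ 2 * (v ^+ 2 * CW + v * L * (L + 2 * v)) <=
  (1 + 24 * CW + 40 * CL) * p * (1 + v + v ^+ 3).
Proof.
move=> CW0 CL0 /andP[p0 p1] v0 LL pL.
have v3 : 0 <= v ^+ 3 by rewrite exprn_ge0.
have v2 : v ^+ 2 <= v + v ^+ 3.
  by have := mulr_ge0 v0 (sqr_ge0 (v - 1)); rewrite !exprS expr0; have := v0; nra.
have pp : p ^+ 2 <= p by rewrite expr2 ler_piMl.
set w := 1 + v + v ^+ 3.
have w1 : 1 <= w by rewrite /w -addrA lerDl addr_ge0.
have T1 : CW * p <= CW * p * w by rewrite ler_peMr // mulr_ge0.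
have T2 : p ^+ 2 * (v ^+ 2 * CW) <= CW * p * w.
  rewrite mulrA mulrC -mulrA ler_wpM2l // ler_pM ?sqr_ge0 //.
  by rewrite /w -addrA; apply: le_trans v2 _; rewrite lerDr.
(* The 5 comes from $(1+v)(v+2v^2)=v+3v^2+2v^3\le4v+5v^3$, using $v^2\le v+v^3$. *)
have T3 : p ^+ 2 * (v * L * (L + 2 * v)) <= 5 * CL * p * w.
  apply: (@le_trans _ _ (p * (p * L ^+ 2) * (v + 2 * v ^+ 2))).
    rewrite -subr_ge0 [leRHS](_ : _ = 2 * (p ^+ 2 * v ^+ 2 * (L ^+ 2 - L))); last by ring.
    by rewrite mulr_ge0 // mulr_ge0 ?subr_ge0 // mulr_ge0 ?sqr_ge0.
  apply: (@le_trans _ _ (p * (CL * (1 + v)) * (v + 2 * v ^+ 2))).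
    by rewrite ler_wpM2r ?ler_wpM2l // addr_ge0 // mulr_ge0 ?sqr_ge0.
  rewrite (_ : p * _ * _ = p * CL * ((1 + v) * (v + 2 * v ^+ 2))); last by ring.
  rewrite (_ : 5 * _ * _ * _ = p * CL * (5 * w)); last by ring.
  rewrite ler_wpM2l ?mulr_ge0 // /w; move: v2; rewrite !exprS expr0; lra.
rewrite (_ : 8 * _ * _ = 8 * (p ^+ 2 * (v ^+ 2 * CW) + p ^+ 2 * (v * L * (L + 2 * v))));
  last by ring.
rewrite (_ : (1 + _ + _) * p * w = p * w + 24 * (CW * p * w) + 8 * (5 * CL * p * w));
  last by ring.
rewrite -[16 * CW * p]mulrA; move: T1 T2 T3.
move: (p ^+ 2 * _) (p ^+ 2 * _) (CW * p) (5 * CL * p * w) (CW * p * w) (p * w) => *; lra.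
Qed.

End Asymptotics.

Lemma cmeasurable_conj {R : realType} {d : measure_display} {T : measurableType d}
  (f : T -> R[i]) : cmeasurable f -> cmeasurable (fun x => conjc (f x)).
Proof.
move=> [f1 f2]; split.
  rewrite (_ : (fun x => _) = (fun x => Re (f x))) //.
  by apply/funext => x; case: (f x).
rewrite (_ : (fun x => _) = (fun x => - Im (f x))); first exact: measurableT_comp.
by apply/funext => x; case: (f x).
Qed.

(** * The smoothed modulus and its gradient *)

Section SmoothModulus.
Context {R : realType}.
Variable eps : R.
Hypothesis eps0 : 0 < eps.

Definition smod (a : R[i]) : R := Num.sqrt (eps ^+ 2 + cmod a ^+ 2).

(** The gradient of [smod]: its derivative at $a$ along $b$ is the real part of
    [direction a * b]. *)
Definition direction (a : R[i]) : R[i] := conjc a * ((smod a)^-1)%:C%C.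

Lemma smod_sqr a : smod a ^+ 2 = eps ^+ 2 + cmod a ^+ 2.
Proof. by rewrite sqr_sqrtr // addr_ge0 // sqr_ge0. Qed.

Lemma smod_ge a : eps <= smod a.
Proof.
have eps1 := ltW eps0.
by rewrite -(@ler_pXn2r _ 2) ?nnegrE ?sqrtr_ge0 // smod_sqr lerDl sqr_ge0.
Qed.

Lemma cmod_le_smod a : cmod a <= smod a.
Proof.
rewrite -(@ler_pXn2r _ 2) ?nnegrE ?sqrtr_ge0 ?cmod_ge0 // smod_sqr.
by rewrite lerDr sqr_ge0.
Qed.

Lemma smod_gt0 a : 0 < smod a.
Proof. exact: lt_le_trans (smod_ge a). Qed.

Lemma smod0 : smod 0 = eps.
Proof. by rewrite /smod cmod0 expr0n /= addr0 sqrtr_sqr gtr0_norm. Qed.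

Lemma smod_le a : smod a <= eps + cmod a.
Proof.
have ea : 0 <= eps + cmod a by rewrite addr_ge0 ?cmod_ge0 ?ltW.
rewrite -(@ler_pXn2r _ 2) ?nnegrE ?sqrtr_ge0 // smod_sqr sqrrD lerD2r lerDl.
by rewrite mulrn_wge0 // mulr_ge0 ?cmod_ge0 ?ltW.
Qed.

Lemma cmod_conj (a : R[i]) : cmod (conjc a) = cmod a.
Proof. by apply: complexI; rewrite -!cmodE normcJ. Qed.

Lemma direction_le1 a : cmod (direction a) <= 1.
Proof.
rewrite cmodM cmod_conj cmod_real ger0_norm ?invr_ge0 ?(ltW (smod_gt0 a)) //.
by rewrite ler_pdivrMr ?smod_gt0 // mul1r cmod_le_smod.
Qed.

(* concavity of the square root: r <= q + (r^2 - q^2) / (2 q) *)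
Lemma smod_step a b :
  smod (a + b) <= smod a + (2 * eps)^-1 * cmod b ^+ 2 + Re (direction a * b).
Proof.
have q0 := smod_gt0 a; have qe := smod_ge a.
have hr := smod_sqr (a + b); have hq := smod_sqr a.
have hab : cmod (a + b) ^+ 2 = cmod a ^+ 2 + cmod b ^+ 2 + 2 * Re (conjc a * b).
  rewrite !cmod_sqr ReD ImD; case: a b {q0 qe hr hq} => [a1 a2] [b1 b2] /=; ring.
have hd : Re (direction a * b) = Re (conjc a * b) / smod a.
  by rewrite /direction mulrAC mulrC ReZ mulrC.
rewrite hd; move: (smod (a + b)) (smod a) (Re (conjc a * b)) (cmod b) (cmod a) (cmod (a + b))
  q0 qe hr hq hab => r q x y a' c' q0 qe hr hq hab.
have h1 : r <= q + (r ^+ 2 - q ^+ 2) / (2 * q).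
  rewrite -subr_ge0.
  have -> : q + (r ^+ 2 - q ^+ 2) / (2 * q) - r = (r - q) ^+ 2 / (2 * q).
    by field; rewrite gt_eqF.
  by rewrite divr_ge0 ?sqr_ge0 // mulr_ge0 // ltW.
apply: le_trans h1 _.
have -> : r ^+ 2 - q ^+ 2 = y ^+ 2 + 2 * x by rewrite hr hq hab; ring.
rewrite mulrDl -[leRHS]addrA lerD2l lerD //; last first.
  by rewrite le_eqVlt; apply/orP; left; apply/eqP; field; rewrite gt_eqF.
rewrite mulrC ler_wpM2r ?sqr_ge0 // lef_pV2 ?posrE ?mulr_gt0 //.
by rewrite ler_wpM2l.
Qed.

Lemma measurable_smod {d : measure_display} {T : measurableType d} (f : T -> R[i]) :
  cmeasurable f -> measurable_fun [set: T] (fun x => smod (f x)).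
Proof.
move=> mf; apply: (measurableT_comp (f := @Num.sqrt R)).
  by apply: continuous_measurable_fun; exact: sqrt_continuous.
by apply: measurable_funD => //; apply: measurable_funX; exact: measurable_cmod.
Qed.

Lemma cmeasurable_direction {d : measure_display} {T : measurableType d} (f : T -> R[i]) :
  cmeasurable f -> cmeasurable (fun x => direction (f x)).
Proof.
move=> mf; apply: cmeasurableM; first exact: cmeasurable_conj.
apply: cmeasurable_real; apply: measurable_funV; first exact: measurable_smod.
by move=> x; exact/ltW/smod_gt0.
Qed.

End SmoothModulus.

(** * Displacement of the trace over $[0,t]$ *)

Section Telescoping.
Context {R : realType} {d : measure_display} {Omega : measurableType d}.
Variable P : probability Omega R.
Variables (N : nat) (T : 'I_N -> 'I_N -> Omega -> R) (V : 'I_N -> Omega -> R)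
  (B : 'I_N -> 'I_N -> R -> Omega -> R) (C_V : R).
Hypothesis mT : forall x y, measurable_fun [set: Omega] (T x y).
Hypothesis sT : forall x y w, T x y w = T y x w.
Hypothesis mV : forall x, measurable_fun [set: Omega] (V x).
Hypothesis density : forall (x : 'I_N) (I : set R) (A : set Omega), measurable I ->
  sigma_of (I := {y : 'I_N | y != x}) (fun y => V (sval y)) A ->
  (P ((V x @^-1` I) `&` A) <= C_V%:E * lebesgue_measure I * P A)%E.
Hypothesis sB : forall x y s w, B x y s w = B y x s w.
Hypothesis BM : forall x y : 'I_N, (x <= y)%N -> standard_BM P (B x y).
Hypothesis indepB : mutually_independent P (I := ('I_N * 'I_N)%type)
  (fun p => (p.1 <= p.2)%N)
  (fun p => sigma_of (fun s : {s : R | 0 <= s} => B p.1 p.2 (sval s))).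
Hypothesis indepTVB : mutually_independent P (I := 'I_3) predT
  (fun k => if val k == 0%N then sigma_of (fun p : 'I_N * 'I_N => T p.1 p.2)
            else if val k == 1%N then sigma_of V
            else sigma_of (fun q : 'I_N * 'I_N * {s : R | 0 <= s} =>
              B q.1.1 q.1.2 (sval q.2))).
Variable z : R[i].
Hypothesis z0 : 0 < Im z.

Let e : R := (Im z)^-1.

Let e0 : 0 <= e. Proof. by rewrite invr_ge0 ltW. Qed.

Definition trace_at t w : R[i] := \tr (resolvent (Hflow T V B t w) z).

Let sH t w := Hflow_sym V sB sT t w.

Lemma cmeasurable_trace_at t : 0 <= t -> cmeasurable (trace_at t).
Proof.
move=> t0; apply: cmeasurable_trace => i j; apply: cmeasurable_resolvent => // a b.
exact: (measurable_Hflow mT mV sB BM _ _ t0).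
Qed.

Lemma trace_at_le t w : cmod (trace_at t w) <= N%:R * e.
Proof. by apply: mxbound_trace => i j; exact: cmod_resolvent. Qed.

Lemma mean_Im_le t : 0 <= t ->
  expect P (fun w => Im (trace_at t w)) <= N%:R * (48 * `|C_V| + 1).
Proof.
move=> t0; apply: expect_le_ereal.
  apply: (@rint_bounded _ _ _ P _ (N%:R * e)); first by case: (cmeasurable_trace_at t0).
  by move=> w; apply: le_trans (Im_le_cmod _) (trace_at_le _ _).
apply: (decouple mT mV sB BM indepTVB sT t0 (f := @Im R) z0).
- by move=> d' T' g [].
- by move=> A sA; rewrite Im_sum sumr_ge0 // => i _; exact: Im_resolvent_ge0.
- by move=> M sM; exact: (wegner_trace mV density sM z0).
Qed.

Lemma mean_sqr_le t K : 0 <= t -> e <= 2 ^+ K ->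
  expect P (fun w => cmod (trace_at t w) ^+ 2) <=
  N%:R * (1 + 6 * `|C_V| * K%:R) * (N%:R * (1 + 6 * `|C_V| * K%:R) + 2 * e).
Proof.
move=> t0 eK; apply: expect_le_ereal.
  apply: (@rint_bounded _ _ _ P _ ((N%:R * e) ^+ 2)).
    by apply: measurable_funX; apply: measurable_cmod; exact: cmeasurable_trace_at.
  move=> w; rewrite ger0_norm ?sqr_ge0 // lerXn2r ?nnegrE ?cmod_ge0 ?mulr_ge0 //.
  exact: trace_at_le.
apply: (decouple mT mV sB BM indepTVB sT t0 (f := fun x => cmod x ^+ 2) z0).
- by move=> d' T' g mg; apply: measurable_funX; exact: measurable_cmod.
- by move=> A sA; exact: sqr_ge0.
- by move=> M sM; exact: (wegner_trace_sqr mV density sM z0 eK).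
Qed.

Section Steps.
Variables (s eps Q I : R).
Hypotheses (s0 : 0 < s) (eps0 : 0 < eps).
Hypothesis hI : forall t, 0 <= t -> expect P (fun w => Im (trace_at t w)) <= I.
Hypothesis hQ : forall t, 0 <= t -> expect P (fun w => cmod (trace_at t w) ^+ 2) <= Q.

Local Notation tau k := (trace_at (grid s k)).
Let y k w := smod eps (tau k w - tau 0 w).
Let u k w := direction eps (tau k w - tau 0 w).

Let past_trace (p : 'I_N * 'I_N) k j : (p.1 <= p.2)%N -> (j <= k)%N ->
  cmeasurable (T := g_sigma_algebraType (past T V B s p k)) (tau j).
Proof.
move=> up jk; apply: cmeasurable_trace => a b; apply: cmeasurable_resolvent => // i j'.
exact: (past_Hflow sB BM s0 i j' up jk).
Qed.

Let past_G (p : 'I_N * 'I_N) k a b : (p.1 <= p.2)%N ->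
  cmeasurable (T := g_sigma_algebraType (past T V B s p k))
    (fun w => resolvent (Hflow T V B (grid s k) w) z a b).
Proof.
move=> up; apply: cmeasurable_resolvent => // i j.
exact: (past_Hflow sB BM s0 i j up (leqnn k)).
Qed.

Let past_u (p : 'I_N * 'I_N) k : (p.1 <= p.2)%N ->
  cmeasurable (T := g_sigma_algebraType (past T V B s p k)) (u k).
Proof.
by move=> up; apply: cmeasurable_direction => //; apply: cmeasurableB; exact: past_trace.
Qed.

Let g0 k : 0 <= grid s k := grid_ge0 s0 k.

Let rint_y k : rint P (y k).
Proof.
have mt := cmeasurableB (cmeasurable_trace_at (g0 k)) (cmeasurable_trace_at (g0 0)).
apply: (@rint_bounded _ _ _ P _ (eps + (N%:R * e + N%:R * e))).
  exact: measurable_smod.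
move=> w; rewrite ger0_norm ?(ltW (smod_gt0 eps0 _)) //.
apply: le_trans (smod_le eps0 _) _; rewrite lerD2l.
by apply: le_trans (cmodD _ _) _; rewrite cmodN lerD // trace_at_le.
Qed.

Let cst := 8 * s / N%:R.

(** [smod_step] in mean, with the predicate [pm] of the one-step estimates instantiated by
    [past_fun]: the direction [u k] depends on the flow up to time [k] only, so it may multiply the
    increment. *)
Lemma smod_increment k : expect P (y k.+1) <= expect P (y k) +
  ((2 * eps)^-1 * (4 * cst * (e ^+ 3 * I) +
      2 * (N%:R * e ^+ 3) ^+ 2 * (@moment4_cst R N * s ^+ 2)) +
   (cst * (e ^+ 2 * I + e * Q) +
      N%:R * e ^+ 4 * (Num.sqrt s ^+ 3 + @moment4_cst R N * s ^+ 2 / Num.sqrt s))).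
Proof.
pose A w := Hflow T V B (grid s k) w; pose W := dW B s k.
have sA w : (A w)^T = A w by exact: sH.
have sW w : (W w)^T = W w by exact: dW_sym.
have mA i j : measurable_fun setT (fun w => A w i j).
  exact: (measurable_Hflow mT mV sB BM i j (g0 k)).
have mW i j : measurable_fun setT (fun w => W w i j) by exact: (measurable_dW sB BM s0 i j k).
have m20 := m2_ge0 s.
have rW1 phi c i j (h : past_fun T V B s k phi) (hc : forall w, `|phi w| <= c) :=
  rint_dW mT mV sB BM s0 h hc i j.
have EW1 phi c i j (h : past_fun T V B s k phi) (hc : forall w, `|phi w| <= c) :=
  expect_dW mT mV sB BM indepB indepTVB s0 h hc i j.
have rW2 phi c i j i' j' (h : past_fun T V B s k phi) (hc : forall w, `|phi w| <= c) :=
  rint_dW2 mT mV sB BM s0 h hc i j i' j'.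
have EW2 phi c i j i' j' (h : past_fun T V B s k phi) (hc : forall w, `|phi w| <= c) :=
  expect_dW2 mT mV sB BM indepB indepTVB s0 h hc i j i' j'.
have rW4 := rint_dW4 sB BM s0 k; have EW4 := expect_dW4 sB BM s0 k.
have sq0 : 0 < Num.sqrt s by rewrite sqrtr_gt0.
have tauS w : \tr (resolvent (A w + W w) z) = tau k.+1 w.
  by rewrite /trace_at Hflow_step.
have pX (p : 'I_N * 'I_N) a b : (p.1 <= p.2)%N ->
    cmeasurable (T := g_sigma_algebraType (past T V B s p k))
    (fun w => (resolvent (A w) z *m resolvent (A w) z) a b).
  by move=> up; apply: cmeasurable_mulmx => i j; exact: past_G.
have mu : cmeasurable (u k).
  apply: cmeasurable_direction => //.
  exact: cmeasurableB (cmeasurable_trace_at (g0 k)) (cmeasurable_trace_at (g0 0)).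
have u1 w : cmod (u k w) <= 1 by exact: direction_le1.
have rq := step_rint P sA sW mA mW z0.
have pmR i j i' j' : past_fun T V B s k
    (fun w => Re ((resolvent (A w) z *m resolvent (A w) z) j i) *
              Re ((resolvent (A w) z *m resolvent (A w) z) j' i')).
  by move=> p up; apply: measurable_funM; [have [] := pX p j i up|have [] := pX p j' i' up].
have pmI i j i' j' : past_fun T V B s k
    (fun w => Im ((resolvent (A w) z *m resolvent (A w) z) j i) *
              Im ((resolvent (A w) z *m resolvent (A w) z) j' i')).
  by move=> p up; apply: measurable_funM; [have [] := pX p j i up|have [] := pX p j' i' up].
have pm1 i j : past_fun T V B s k
    (fun w => Re (u k w * (resolvent (A w) z *m resolvent (A w) z) i j)).
  by move=> p up; have [] := cmeasurableM (past_u k up) (pX p i j up).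
have pm2 i j i' j' : past_fun T V B s k
    (fun w => Re (u k w * ((resolvent (A w) z *m resolvent (A w) z) j' i *
                            resolvent (A w) z j i'))).
  move=> p up.
  by have [] := cmeasurableM (past_u k up) (cmeasurableM (pX p j' i up) (past_G k j i' up)).
have Eq := step_quad sA sW mA mW z0 m20 rW2 EW2 rW4 EW4 pmR pmI.
(* The choice $\delta=\sqrt s$ makes $\delta^3$ and $m_4/\delta$ both of order $s^{3/2}$, as $m_4$
   is of order $s^2$. *)
have [rd Ed] := step_drift sA sW mA mW z0 m20 mu u1 rW1 EW1 rW2 EW2 rW4 EW4 pm1 pm2 sq0.
have {}rq : rint P (fun w => cmod (tau k.+1 w - tau k w) ^+ 2).
  by move: rq; congr rint; apply/funext => w; rewrite /= tauS.
have {}Eq : expect P (fun w => cmod (tau k.+1 w - tau k w) ^+ 2) <=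
    4 * cst * (e ^+ 3 * I) + 2 * (N%:R * e ^+ 3) ^+ 2 * (@moment4_cst R N * s ^+ 2).
  rewrite [leLHS](_ : _ = expect P (fun w => cmod (\tr (resolvent (A w + W w) z) -
    \tr (resolvent (A w) z)) ^+ 2)); last first.
    by congr expect; apply/funext => w; rewrite tauS.
  apply: le_trans Eq _; rewrite lerD2r.
  have hm := hI (g0 k).
  apply: ler_pM.
  - by rewrite mulr_ge0 // divr_ge0.
  - rewrite mulr_ge0 ?exprn_ge0 // expect_ge0 // => w; rewrite Im_sum sumr_ge0 // => i _.
    exact: Im_resolvent_ge0.
  - by rewrite ler_wpM2l // ler_wpM2r ?invr_ge0 // m2_le.
  - by rewrite ler_wpM2l ?exprn_ge0.
have {}rd : rint P (fun w => Re (u k w * (tau k.+1 w - tau k w))).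
  by move: rd; congr rint; apply/funext => w; rewrite /= tauS.
have {}Ed : expect P (fun w => Re (u k w * (tau k.+1 w - tau k w))) <=
   cst * (e ^+ 2 * I + e * Q) +
      N%:R * e ^+ 4 * (Num.sqrt s ^+ 3 + @moment4_cst R N * s ^+ 2 / Num.sqrt s).
  rewrite [leLHS](_ : _ = expect P (fun w => Re (u k w * (\tr (resolvent (A w + W w) z) -
    \tr (resolvent (A w) z))))); last first.
    by congr expect; apply/funext => w; rewrite tauS.
  apply: le_trans Ed _; rewrite lerD2r.
  have hm := hI (g0 k); have hs := hQ (g0 k).
  apply: ler_pM.
  - by rewrite divr_ge0.
  - rewrite addr_ge0 // mulr_ge0 ?exprn_ge0 // expect_ge0 // => w; last exact: sqr_ge0.
    by rewrite Im_sum sumr_ge0 // => i _; exact: Im_resolvent_ge0.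
  - by rewrite ler_wpM2r ?invr_ge0 // m2_le.
  - by rewrite lerD // ler_wpM2l ?exprn_ge0.
have rq' := rintZ (2 * eps)^-1 rq.
apply: (@le_trans _ _ (expect P (fun w => y k w +
    ((2 * eps)^-1 * cmod (tau k.+1 w - tau k w) ^+ 2 + Re (u k w * (tau k.+1 w - tau k w)))))).
  apply: expect_le; [exact: rint_y|by apply: rintD => //; exact: rintD|].
  move=> w; have := smod_step eps0 (tau k w - tau 0 w) (tau k.+1 w - tau k w).
  by rewrite [in X in X -> _]addrC subrKA -addrA.
rewrite expectD //; last exact: rintD.
rewrite lerD2l expectD // lerD // expectZ // ler_wpM2l // invr_ge0.
by rewrite mulr_ge0 // ltW.
Qed.

Lemma smod_telescope K : expect P (y K) <= eps + K%:R *
  ((2 * eps)^-1 * (4 * cst * (e ^+ 3 * I) +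
      2 * (N%:R * e ^+ 3) ^+ 2 * (@moment4_cst R N * s ^+ 2)) +
   (cst * (e ^+ 2 * I + e * Q) +
      N%:R * e ^+ 4 * (Num.sqrt s ^+ 3 + @moment4_cst R N * s ^+ 2 / Num.sqrt s))).
Proof.
elim: K => [|K IH].
  rewrite mul0r addr0 -[leRHS](expect_cst P) le_eqVlt; apply/orP; left; apply/eqP.
  by congr expect; apply/funext => w; rewrite /y subrr smod0.
apply: le_trans (smod_increment K) _.
rewrite -[K.+1%:R]natr1 [X in _ <= _ + X]mulrDl mul1r [leRHS]addrA lerD2r.
exact: IH.
Qed.

Lemma cmod_telescope K : expect P (fun w => cmod (tau K w - tau 0 w)) <= expect P (y K).
Proof.
have mt := cmeasurableB (cmeasurable_trace_at (g0 K)) (cmeasurable_trace_at (g0 0)).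
apply: expect_le; [|exact: rint_y|by move=> w; exact: cmod_le_smod].
apply: rint_le (rint_y K) _; first exact: measurable_cmod.
by move=> w; rewrite ger0_norm ?cmod_ge0 // cmod_le_smod.
Qed.

End Steps.
(** With $K$ steps of length $s=t/K$ the terms of order $s$ add up to multiples of $t$, while those
    of order $s^2$ and $s^{3/2}$ leave $ts$ and $t\sqrt s$, removed by [grid_limit]. The 16 is
    $4\cdot8/2$. *)
Lemma trace_displacement (t eps Q I : R) : (0 < N)%N -> 0 < t -> 0 < eps ->
  (forall t, 0 <= t -> expect P (fun w => Im (trace_at t w)) <= I) ->
  (forall t, 0 <= t -> expect P (fun w => cmod (trace_at t w) ^+ 2) <= Q) ->
  expect P (fun w => cmod (trace_at t w - trace_at 0 w)) <=
  eps + 16 * (t / N%:R) * (e ^+ 3 * I) / eps + 8 * (t / N%:R) * (e ^+ 2 * I + e * Q).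
Proof.
move=> N0 t0 eps0 hI hQ.
have m40 : 0 <= @moment4_cst R N.
  rewrite /moment4_cst mulr_ge0 ?exprn_ge0 // sumr_ge0 // => p _.
  by rewrite mulr_ge0 // exprn_ge0 // sqrtr_ge0.
have ne4 : 0 <= N%:R * e ^+ 4 by rewrite mulr_ge0 // exprn_ge0.
have mN0 : 0 <= (N%:R * e ^+ 3) ^+ 2 * @moment4_cst R N by rewrite mulr_ge0 // sqr_ge0.
apply: (@grid_limit _ _ _ t (t * (eps^-1 * ((N%:R * e ^+ 3) ^+ 2 * @moment4_cst R N)))
  (t * (N%:R * e ^+ 4 * (1 + @moment4_cst R N)))) => //.
- by apply: mulr_ge0 (ltW t0) _; apply: mulr_ge0 => //; rewrite invr_ge0 ltW.
- by apply: mulr_ge0 (ltW t0) _; apply: mulr_ge0 => //; exact: addr_ge0.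
move=> K K0; set s := t / K%:R.
have K1 : 0 < K%:R :> R by rewrite ltr0n.
have s0 : 0 < s by rewrite divr_gt0.
have Ks : K%:R * s = t by rewrite mulrC divfK // gt_eqF.
have sq0 : 0 < Num.sqrt s by rewrite sqrtr_gt0.
have sE : Num.sqrt s ^+ 2 = s by rewrite sqr_sqrtr // ltW.
have gK : grid s K = t by rewrite /grid.
have g0 : grid s 0 = 0 by rewrite /grid mul0r.
have := le_trans (cmod_telescope s0 eps0 K) (smod_telescope s0 eps0 hI hQ K).
rewrite gK g0 => /le_trans; apply.
rewrite -[leRHS]addrA -[leRHS]addrA lerD2l le_eqVlt; apply/orP; left; apply/eqP.
rewrite -Ks; move: (@moment4_cst R N) sE s0 sq0 => m4; move: (Num.sqrt s) => r <- s0 r0.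
by field; rewrite !gt_eqF // ltr0n.
Qed.

End Telescoping.

Theorem theorem2p1 (R : realType) (c : R) (hc : 0 < c) (C_V : R) :
  exists C : R, forall (N : nat) (d : measure_display) (Omega : measurableType d)
    (P : probability Omega R)
    (T : 'I_N -> 'I_N -> Omega -> R) (V : 'I_N -> Omega -> R)
    (B : 'I_N -> 'I_N -> R -> Omega -> R),
    (* T: random real symmetric matrix *)
    (forall x y, measurable_fun [set: Omega] (T x y)) ->
    (forall x y w, T x y w = T y x w) ->
    (* V: random diagonal potential with bounded conditional densities *)
    (forall x, measurable_fun [set: Omega] (V x)) ->
    (forall (x : 'I_N) (I : set R) (A : set Omega), measurable I ->
       sigma_of (I := {y : 'I_N | y != x}) (fun y => V (sval y)) A ->
       (P ((V x @^-1` I) `&` A) <= C_V%:E * lebesgue_measure I * P A)%E) ->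
    (* B_xy = B_yx, x <= y, independent standard Brownian motions *)
    (forall x y s w, B x y s w = B y x s w) ->
    (forall x y : 'I_N, (x <= y)%N -> standard_BM P (B x y)) ->
    mutually_independent P (I := ('I_N * 'I_N)%type) (fun p => (p.1 <= p.2)%N)
      (fun p => sigma_of (fun s : {s : R | 0 <= s} => B p.1 p.2 (sval s))) ->
    (* T, V, (Phi_t) independent *)
    mutually_independent P (I := 'I_3) predT
      (fun k => if val k == 0%N then sigma_of (fun p : 'I_N * 'I_N => T p.1 p.2)
                else if val k == 1%N then sigma_of V
                else sigma_of (fun q : 'I_N * 'I_N * {s : R | 0 <= s} => B q.1.1 q.1.2 (sval q.2))) ->
    forall (t E eta : R), 0 <= t -> t <= powR (N%:R) (- (1 + c)) -> 0 < eta ->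
      (\int[P]_w (complex.Re `|Stieltjes T V B t (E +i* eta)%C w
                          - Stieltjes T V B 0 (E +i* eta)%C w|)%:E
       <= (C * powR (N%:R) (- (c / 2))
             * (1 + (N%:R * eta)^-1 + ((N%:R * eta) ^+ 3)^-1))%:E)%E.
Proof.
pose CW : R := 48 * `|C_V| + 1; pose CL := log_cst c `|C_V|.
have CW0 : 0 <= CW by rewrite addr_ge0 // mulr_ge0.
have CL0 : 0 <= CL by exact: log_cst_ge0.
(* The 1 pays for the smoothing, $24=16+8$ collects the terms with the mean of
   $\mathrm{Im}\,\mathrm{tr}\,G$, and $40=8\cdot5$ the term with the logarithm. *)
exists (1 + 24 * CW + 40 * CL).
move=> N d Omega P T V B mT sT mV density sB BM indepB indepTVB t E eta t0 tN eta0.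
set C := 1 + _ + _.
have C0 : 0 <= C by rewrite !addr_ge0 // mulr_ge0.
set z := (E +i* eta)%C; have z0 : 0 < Im z by [].
pose X w := cmod (trace_at T V B z t w - trace_at T V B z 0 w).
have mX : measurable_fun setT X.
  apply: measurable_cmod; apply: cmeasurableB;
    exact: (cmeasurable_trace_at mT sT mV sB BM z0).
have rX : rint P X.
  apply: (@rint_bounded _ _ _ P _ (N%:R * (Im z)^-1 + N%:R * (Im z)^-1)) => // w.
  rewrite ger0_norm ?cmod_ge0 //; apply: le_trans (cmodD _ _) _.
  by rewrite cmodN lerD // (trace_at_le V sT sB z0).
have -> : (\int[P]_w (complex.Re `|Stieltjes T V B t z w - Stieltjes T V B 0 z w|)%:E =
    (N%:R^-1 * expect P X)%:E)%E.
  rewrite -expectZ // -expect_EFin; last exact: rintZ.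
  apply: eq_integral => w _; congr EFin.
  rewrite -[LHS]/(cmod _) /Stieltjes -mulrBr cmodM; congr (_ * _).
  rewrite (_ : N%:R^-1 = (N%:R^-1)%:C%C); last by rewrite fmorphV rmorph_nat.
  by rewrite cmod_real ger0_norm // invr_ge0.
rewrite lee_fin.
have RHS0 : 0 <= C * N%:R `^ (- (c / 2)) * (1 + (N%:R * eta)^-1 + ((N%:R * eta) ^+ 3)^-1).
  have Ne : 0 <= N%:R * eta by rewrite mulr_ge0 // ltW.
  by rewrite !mulr_ge0 ?powR_ge0 // !addr_ge0 ?invr_ge0 // exprn_ge0.
(* Time zero is set apart because the mesh $t/K$ has to be positive. *)
have [{}t0|tz] := ltP 0 t; last first.
  have tE : t = 0 by apply/eqP; rewrite eq_le tz.
  rewrite (_ : expect P X = 0) ?mulr0 // -[RHS](expect_cst P); congr expect.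
  by apply/funext => w; rewrite /X tE subrr cmod0.
(* For $N=0$ the real power with nonzero exponent is 0 by convention, which would force $t\le0$. *)
have N0 : (0 < N)%N.
  rewrite lt0n; apply: contraTneq t0 => NE; rewrite -leNgt; apply: le_trans tN _.
  by rewrite NE powR0 // oppr_eq0 gt_eqF // addr_gt0.
have n0 : 0 < N%:R :> R by rewrite ltr0n.
have n1 : 1 <= N%:R :> R by rewrite ler1n.
pose p : R := N%:R `^ (- (c / 2)); pose v := (N%:R * eta)^-1.
have p0 : 0 < p by exact: powR_gt0.
have p1 : p <= 1 by rewrite -(powRr0 N%:R) ler_powR // oppr_le0 divr_ge0 // ltW.
have v0 : 0 < v by rewrite invr_gt0 mulr_gt0.
have eE : (Im z)^-1 = N%:R * v by rewrite /v invfM mulrA mulfV ?gt_eqF // mul1r.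
have tp : t / N%:R <= (p / N%:R) ^+ 2.
  rewrite exprMn (expr2 N%:R^-1) mulrA ler_pM2r ?invr_gt0 //.
  apply: le_trans tN _; rewrite le_eqVlt; apply/orP; left; apply/eqP.
  rewrite -powR_mulrn ?powR_ge0 // -powRrM -[N%:R^-1]powR_inv1 // -powRD ?(gt_eqF n0) ?implybT //.
  by congr (_ `^ _); field.
(* $Nv=1/\eta$, so [K] is about $\log_2(1/\eta)$; the upper bound on $2^K$ lets [log_factor_le]
   absorb it. *)
have [K /andP[K1 K2]] := dyadic_bound (mulr_ge0 (ltW n0) (ltW v0)).
pose L := 1 + 6 * `|C_V| * K%:R.
have L1 : 1 <= L by rewrite lerDl !mulr_ge0.
have LL : L <= L ^+ 2 by rewrite expr2 ler_peMl // (le_trans _ L1).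
have pL : p * L ^+ 2 <= CL * (1 + v).
  have := log_factor_le hc (normr_ge0 C_V) n1 (ltW v0) K2; rewrite -/L -/CL.
  move=> /(ler_wpM2l (ltW p0)) /le_trans; apply.
  rewrite mulrCA [p * (_ * _)]mulrA -powRD ?(gt_eqF n0) ?implybT // addNr powRr0 mul1r.
  exact: lexx.
rewrite [leLHS]mulrC ler_pdivrMr //.
pose w := 1 + v + v ^+ 3.
have w1 : 1 <= w by rewrite /w -addrA lerDl addr_ge0 ?exprn_ge0 ?(ltW v0).
have w0 : 0 < w by exact: lt_le_trans w1.
(* The smoothing scale is the target size of $|\tau_t-\tau_0|$, so that smoothing costs no more than
   the claimed bound. *)
have eps0 : 0 < N%:R * p * w by rewrite !mulr_gt0.
have hI t' : 0 <= t' -> expect P (fun w => Im (trace_at T V B z t' w)) <= N%:R * CW.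
  exact: (mean_Im_le mT sT mV density sB BM indepTVB z0).
have hQ t' : 0 <= t' -> expect P (fun w => cmod (trace_at T V B z t' w) ^+ 2) <=
    N%:R * L * (N%:R * L + 2 * (N%:R * v)).
  move=> t'0; rewrite -eE; apply: (mean_sqr_le mT sT mV density sB BM indepTVB z0 t'0).
  by rewrite eE.
have := trace_displacement mT sT mV sB BM indepB indepTVB z0 N0 t0 eps0 hI hQ.
rewrite eE => /le_trans; apply.
have h := error_terms_le CW0 CL0 (introT andP (conj (ltW p0) p1)) (ltW v0) LL pL.
rewrite -/p -exprVn -/v; apply: le_trans (ler_wpM2r (ltW n0) h).
rewrite -/w ![(_ + _) * N%:R]mulrDl.
have Nv0 : 0 <= N%:R * v by rewrite mulr_ge0 ?ltW.
apply: lerD; first apply: lerD.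
- by rewrite [leRHS]mulrC mulrA.
- rewrite (_ : 16 * _ * _ / _ = t / N%:R * (16 * ((N%:R * v) ^+ 3 * (N%:R * CW)) /
    (N%:R * p * w))); last by rewrite [16 * _]mulrC !mulrA.
  apply: le_trans (ler_wpM2r _ tp) _.
    apply: divr_ge0 (ltW eps0); apply: mulr_ge0 => //.
    by apply: mulr_ge0; [exact: exprn_ge0|exact: mulr_ge0].
  rewrite [leLHS](_ : _ = 16 * CW * p * N%:R * (v ^+ 3 / w)); last first.
    move: (w) w0 (p) p0 => y y0 q q0; by field; rewrite !gt_eqF.
  rewrite ler_piMr ?mulr_ge0 ?(ltW p0) // ler_pdivrMr // mul1r /w lerDr.
  by rewrite addr_ge0 // ltW.
- rewrite -[8 * _ * _]mulrA mulrCA.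
  have L0 : 0 <= L by exact: le_trans L1.
  have v1 := ltW v0; apply: le_trans (ler_wpM2r _ tp) _.
    by rewrite mulr_ge0 // addr_ge0 // !mulr_ge0 ?exprn_ge0 // ?addr_ge0 // !mulr_ge0.
  by rewrite le_eqVlt; apply/orP; left; apply/eqP; field; rewrite gt_eqF.
Qed.
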